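(* Let $n\ge 2$ and let $\Omega\subset\mathbb{C}^n$ be a bounded, balanced, convex and homogeneous domain. Let $G$ be a (nonempty) subdomain of $\Omega$ that is relatively compact in $\Omega$ and such that the pseudoconvex but not Levi flat points are dense in $\partial G$. If $D=\Omega\setminus\overline{G}$ is connected, then for every $z\in D$, $$s_D^\Omega(z)=\tilde e^{\Omega}_D(z)=d_{c_\Omega}^{\partial G}(z).$$
   Context: A domain $\Omega\subset\mathbb{C}^n$ is balanced if $\lambda z\in\Omega$ whenever $z\in\Omega$, $\lambda\in\mathbb{C}$, $|\lambda|\le 1$; it is homogeneous if its group of holomorphic automorphisms acts transitively. Let $\mathbb{D}$ be the unit disk in $\mathbb{C}$ and $O(X,Y)$ the set of holomorphic maps from $X$ into $Y$. A point $Q\in\partial G$ is a pseudoconvex but not Levi flat point if, near $Q$, $G=\{\rho<0\}$ for a local $C^2$ defining function $\rho$ (with $d\rho\ne0$), and the Levi form $\sum_{j,k}\frac{\partial^2\rho}{\partial z_j\partial\bar z_k}(Q)v_j\bar v_k$ is $\ge 0$ for all $v\in\mathbb{C}^n$ with $\sum_j\frac{\partial\rho}{\partial z_j}(Q)v_j=0$ and is $>0$ for at least one such $v$. Carathéodory pseudodistance on a domain $D$: $c_D(z,w)=\sup\{\tanh^{-1}|\lambda| : f\in O(D,\mathbb{D}),\ f(z)=0,\ f(w)=\lambda\}$; its balls are $B^c_D(z,r)=\{w\in D: c_D(z,w)<r\}$. For a nonempty compact $S\subset\Omega$ and $z\in\Omega\setminus S$, put $d_{c_\Omega}^{S}(z)=\min_{w\in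 S}\tanh[c_\Omega(z,w)]$. Generalized squeezing function: with the Minkowski function $\rho_\Omega(z)=\inf\{t>0: z/t\in\Omega\}$, for a bounded domain $D\subset\mathbb{C}^n$ and $z\in D$, $$s_D^\Omega(z)=\sup\{r>0:\ \{w\in\mathbb{C}^n:\rho_\Omega(w)<r\}\subset f(D)\ \text{for some injective } f\in O(D,\Omega)\text{ with } f(z)=0\}.$$ Fridman invariant (with respect to the Carathéodory pseudodistance): $$\tilde e^{\Omega}_D(z)=\sup\{\tanh(r):\ B^c_D(z,r)\subset f(\Omega)\ \text{for some injective } f\in O(\Omega,D)\}.$$ *)

(* Defs.v *)
From HB Require Import structures.
From mathcomp Require Import all_boot all_order all_algebra.
From mathcomp Require Import complex.
From mathcomp Require Import all_classical all_reals all_analysis.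

Set Implicit Arguments.
Unset Strict Implicit.
Unset Printing Implicit Defensive.

Import Order.TTheory GRing.Theory Num.Theory.
Import numFieldNormedType.Exports.

Local Open Scope classical_set_scope.
Local Open Scope ring_scope.

(* [R[i]] with its usual topology, as a normed module over itself; as a
   consequence ['rV[R[i]]_n] is a normed module over [R[i]] and [differentiable]
   on it means complex (Frechet) differentiable. *)
#[non_forgetful_inheritance]
HB.instance Definition _ (R : realType) := NormedModule.copy R[i] R[i]^o.

Section RealFunctions.
Context {R : realType}.

Definition tanh (x : R) : R :=
  (expR x - expR (- x)) / (expR x + expR (- x)).

(* The inverse of [tanh] on ]-1, 1[. *)
Definition artanh (x : R) : R := ln ((1 + x) / (1 - x)) / 2.

Definition is_min (A : set R) (m : R) : Prop := A m /\ lbound A m.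

End RealFunctions.

Section Domains.
Context {R : realType} {n : nat}.
Local Notation V := 'rV[R[i]]_n.
Implicit Types D G Om S : set V.

Definition is_domain D : Prop := [/\ open D, connected D & D !=set0].

Definition boundary D : set V := closure D `\` interior D.

Definition balanced Om : Prop :=
  forall (lambda : R[i]) (z : V), `|lambda| <= 1 -> Om z -> Om (lambda *: z).

(* [f] is in O(D, E), for [D] open; its values outside [D] are irrelevant. *)
Definition holo_map (W : normedModType R[i]) D (E : set W) (f : V -> W) : Prop :=
  (forall z, D z -> differentiable f z) /\ (forall z, D z -> E (f z)).

Definition inj_holo_map D (E : set V) (f : V -> V) : Prop :=
  holo_map D E f /\ set_inj D f.

Definition automorphism Om (f : V -> V) : Prop :=
  holo_map Om Om f /\
  exists g : V -> V,
    [/\ holo_map Om Om g, forall z, Om z -> g (f z) = z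
      & forall z, Om z -> f (g z) = z].

Definition homogeneous Om : Prop :=
  forall z w, Om z -> Om w -> exists2 f, automorphism Om f & f z = w.

End Domains.

Section LeviForm.
Context {R : realType} {n : nat}.
Local Notation V := 'rV[R[i]]_n.

(* The real coordinate directions of C^n = R^(2n): with z_j = x_j + i y_j,
   [rdir false j] is the direction of x_j and [rdir true j] that of y_j. *)
Definition rdir (b : bool) (j : 'I_n) : V :=
  (if b then 'i%C else 1) *: delta_mx ord0 j.

Definition rline (f : V -> R) (v z : V) : R -> R :=
  fun t => f (z + t%:C%C *: v).

Definition rpartial (b : bool) (j : 'I_n) (f : V -> R) : V -> R :=
  fun z => derive1 (rline f (rdir b j) z) 0.

(* C^k in the real sense on the open set [U]: all real partial derivatives of
   order at most [k] exist and are continuous on [U]. *)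
Fixpoint Ck_on (k : nat) (U : set V) (f : V -> R) : Prop :=
  (forall z, U z -> {for z, continuous f}) /\
  (if k is k'.+1 then
     forall b j, (forall z, U z -> derivable (rline f (rdir b j) z) 0 1) /\
                 Ck_on k' U (rpartial b j f)
   else True).

Definition cpartial (b : bool) (j : 'I_n) (f : V -> R[i]) : V -> R[i] :=
  fun z => (rpartial b j (fun w => complex.Re (f w)) z +i*
            rpartial b j (fun w => complex.Im (f w)) z)%C.

(* Wirtinger derivatives d/dz_j and d/dzbar_j. *)
Definition dz (j : 'I_n) (f : V -> R[i]) : V -> R[i] :=
  fun z => (cpartial false j f z - 'i%C * cpartial true j f z) / 2.

Definition dzbar (j : 'I_n) (f : V -> R[i]) : V -> R[i] :=
  fun z => (cpartial false j f z + 'i%C * cpartial true j f z) / 2.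

Definition complex_tangent (rho : V -> R) (Q : V) : set V :=
  [set v | \sum_j dz j (fun z => (rho z)%:C%C) Q * v ord0 j = 0].

(* For [rho] of class C^2 this is real; in [R[i]], [0 <= x] and [0 < x] mean that
   [x] is real and has the stated sign. *)
Definition levi_form (rho : V -> R) (Q v : V) : R[i] :=
  \sum_j \sum_k dz j (dzbar k (fun z => (rho z)%:C%C)) Q
                * v ord0 j * (v ord0 k)^*%C.

Definition local_defining_function (G : set V) (Q : V) (U : set V)
    (rho : V -> R) : Prop :=
  [/\ open U, U Q, Ck_on 2 U rho,
      forall z, U z -> exists b j, rpartial b j rho z != 0
    & forall z, U z -> (G z <-> rho z < 0)].

Definition pseudoconvex_not_Levi_flat (G : set V) (Q : V) : Prop :=
  boundary G Q /\
  exists (U : set V) (rho : V -> R),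
    [/\ local_defining_function G Q U rho,
        forall v, complex_tangent rho Q v -> 0 <= levi_form rho Q v
      & exists2 v, complex_tangent rho Q v & 0 < levi_form rho Q v].

End LeviForm.

Section Invariants.
Context {R : realType} {n : nat}.
Local Notation V := 'rV[R[i]]_n.
Implicit Types D Om S : set V.

(* The suprema below are those of [R]. The Caratheodory pseudodistance of a domain
   is finite, and for bounded domains the sets defining [squeezing] and [fridman]
   are nonempty and bounded above, so no default value is involved. *)

Definition unit_disk : set R[i] := [set x | `|x| < 1].

Definition carath D (z w : V) : R :=
  sup [set t : R | exists f : V -> R[i],
         [/\ holo_map D unit_disk f, f z = 0
           & t = artanh (complex.Re `|f w|)]].

Definition carath_ball D (z : V) (r : R) : set V :=
  [set w | D w /\ carath D z w < r].

Definition is_carath_dist Om S (z : V) (d : R) : Prop :=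
  is_min [set tanh (carath Om z w) | w in S] d.

Definition minkowski_fun Om (z : V) : R :=
  inf [set t : R | 0 < t /\ Om (t%:C%C^-1 *: z)].

Definition squeezing Om D (z : V) : R :=
  sup [set r : R | 0 < r /\
         exists f : V -> V,
           [/\ inj_holo_map D Om f, f z = 0
             & [set w | minkowski_fun Om w < r] `<=` f @` D]].

Definition fridman Om D (z : V) : R :=
  sup [set tanh r | r in [set r : R | 0 < r /\
         exists2 f : V -> V, inj_holo_map Om D f
           & carath_ball D z r `<=` f @` Om]].

End Invariants.

(* Main.v *)
(* Let N be the Minkowski function of Om, so that N is a norm and Om its unit ball, let
   phi be an automorphism of Om with phi z = 0, and let d > 0 be the minimum of
   N \o phi on closure G; it is attained at some w0 in boundary G. By the Schwarz
   lemma tanh (c_Om (z, w)) = N (phi w), and by Hartogs' theorem c_D = c_Om on D.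

   Lower bounds: phi embeds D and its image contains the ball of radius d, while
   y |-> phi^-1 (d y) embeds Om into D and its image contains the Caratheodory ball of
   tanh-radius d.

   Squeezing, upper bound: f extends to F : Om -> Om, and N (F w0) <= d by the Schwarz
   lemma. If the ball of radius r > d lay in f(D), then F w0 = f p with p in D; f being
   open at p, points of D close to w0 would have the same image as points close to p.

   Fridman, upper bound: if f(Om) contains the Caratheodory ball of tanh-radius r > d,
   this ball is D near some pseudoconvex, not Levi flat point Q of boundary G. There is
   a family of analytic discs lying in D and with boundaries in a compact subset of D,
   whose centres tend to Q. By the maximum principle for the inverse of f the centres
   stay in f({N <= s}) for some s < 1, so Q would be in D.

   Hartogs' theorem is obtained from Cauchy integrals on the lines through the origin,
   after moving G by an automorphism so that it misses a complex hyperplane. *)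
From HB Require Import structures.
Require Import Defs.
From mathcomp Require Import all_boot all_order all_algebra perm.
From mathcomp Require Import complex.
From mathcomp Require Import all_classical all_reals all_analysis.
From mathcomp Require Import zify ring lra.
Import Order.TTheory GRing.Theory Num.Theory.
Import numFieldNormedType.Exports.
Local Open Scope classical_set_scope.
Local Open Scope ring_scope.

Set Implicit Arguments.
Unset Strict Implicit.
Unset Printing Implicit Defensive.

(** * Real-valued norms and complex differentiability *)

(** One device recurs. The Jacobian determinant of an injective map, carried to the image by the
    inverse, is only known to be continuous, and holomorphic where it does not vanish; so the
    maximum principle and the uniqueness lemma are stated for functions of this kind. A factor that
    cannot be normalised is neutralised by powers: it stays fixed while a quotient below 1 is raised
    to a power tending to infinity. Schwarz's lemma, uniqueness along lines and the estimate on the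
    discs near a Levi point all follow this pattern. In Hartogs' theorem the candidate must be
    compared with the given function somewhere. Lines through the origin close to a hyperplane
    [L = 0] that misses the compact set miss it too, and Cauchy's formula holds on their whole
    discs. Homogeneity provides the hyperplane: a point near the boundary of the ball can be moved
    to the origin. For [n >= 2] the hyperplane contains a nonzero vector. *)

Section Norm.
Context {R : realType}.
Implicit Types V W : normedModType R[i].

(** Norms over [R[i]] take values in [R[i]]. The real part is the same number seen in [R], where the
    order is total and [lra] and [nra] apply. *)
Definition nrm W (w : W) : R := complex.Re `|w|.

Lemma nrmE W (w : W) : `|w| = (nrm w)%:C%C.
Proof.
rewrite /nrm; have : 0 <= `|w| := normr_ge0 w.
by case: `|w| => a b; rewrite lecE /= => /andP[/eqP -> _].
Qed.

Lemma nrm_ge0 W (w : W) : 0 <= nrm w.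
Proof. by have := normr_ge0 w; rewrite nrmE ler0c. Qed.

Lemma nrmD W (v w : W) : nrm (v + w) <= nrm v + nrm w.
Proof. by have := ler_normD v w; rewrite !nrmE -rmorphD /= lecR. Qed.

Lemma nrmN W (w : W) : nrm (- w) = nrm w.
Proof. by rewrite /nrm normrN. Qed.

Lemma nrm_distC W (v w : W) : nrm (v - w) = nrm (w - v).
Proof. by rewrite /nrm distrC. Qed.

Lemma nrmB_ge W (v w : W) : nrm v - nrm w <= nrm (v - w).
Proof. by rewrite lerBlDr; have := nrmD (v - w) w; rewrite subrK. Qed.

Lemma nrmM (x y : R[i]) : nrm (x * y) = nrm x * nrm y.
Proof. by apply: (@complexI R); rewrite rmorphM /= -!nrmE normrM. Qed.

Lemma nrmZ W (a : R[i]) (w : W) : nrm (a *: w) = nrm a * nrm w.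
Proof. by apply: (@complexI R); rewrite rmorphM /= -!nrmE normrZ. Qed.

Lemma nrm0 W : nrm (0 : W) = 0.
Proof. by rewrite /nrm normr0. Qed.

Lemma nrm0_eq0 W (w : W) : nrm w = 0 -> w = 0.
Proof. by move=> w0; apply/normr0_eq0; rewrite nrmE w0. Qed.

Lemma nrm_gt0 W (w : W) : (0 < nrm w) = (w != 0).
Proof.
rewrite lt_neqAle nrm_ge0 andbT eq_sym; apply/idP/idP.
  by apply: contra => /eqP ->; rewrite nrm0.
by apply: contra => /eqP/nrm0_eq0 ->.
Qed.

Lemma nrm_le0 W (w : W) : nrm w <= 0 -> w = 0.
Proof. by move=> h; apply: nrm0_eq0; apply/eqP; rewrite eq_le h nrm_ge0. Qed.

Lemma nrmX (x : R[i]) k : nrm (x ^+ k) = nrm x ^+ k.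
Proof. by apply: (@complexI R); rewrite rmorphXn /= -!nrmE normrX. Qed.

Lemma nrmV (x : R[i]) : nrm x^-1 = (nrm x)^-1.
Proof.
by apply: (@complexI R); rewrite fmorphV -!nrmE normfV.
Qed.

Lemma nrm_real (x : R) : nrm x%:C%C = `|x|.
Proof. by rewrite /nrm /= expr0n addr0 sqrtr_sqr. Qed.

Lemma nrm1 : nrm (1 : R[i]) = 1.
Proof. by rewrite /nrm normr1. Qed.

Lemma nrm_sqr (x : R[i]) :
  nrm x ^+ 2 = complex.Re x ^+ 2 + complex.Im x ^+ 2.
Proof.
by case: x => a b; rewrite /nrm /= sqr_sqrtr // addr_ge0 // sqr_ge0.
Qed.

Lemma Re_le_nrm (x : R[i]) : `|complex.Re x| <= nrm x.
Proof.
rewrite -(@ler_pXn2r _ 2) ?nnegrE ?nrm_ge0 //.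
by rewrite nrm_sqr real_normK ?num_real // lerDl sqr_ge0.
Qed.

Lemma Im_le_nrm (x : R[i]) : `|complex.Im x| <= nrm x.
Proof.
rewrite -(@ler_pXn2r _ 2) ?nnegrE ?nrm_ge0 //.
by rewrite nrm_sqr real_normK ?num_real // lerDr sqr_ge0.
Qed.

Lemma nrm_le_ReIm (x : R[i]) :
  nrm x <= `|complex.Re x| + `|complex.Im x|.
Proof.
rewrite -(@ler_pXn2r _ 2) ?nnegrE ?nrm_ge0 ?addr_ge0 //.
rewrite nrm_sqr -(real_normK (num_real (complex.Re x))).
rewrite -(real_normK (num_real (complex.Im x))).
have := normr_ge0 (complex.Re x); have := normr_ge0 (complex.Im x).
by nra.
Qed.

Lemma nrm_sum W I (r : seq I) (P : pred I) (F : I -> W) :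
  nrm (\sum_(i <- r | P i) F i) <= \sum_(i <- r | P i) nrm (F i).
Proof.
elim/big_rec2: _ => [|i b a _ h]; first by rewrite nrm0.
by apply: le_trans (nrmD _ _) _; rewrite lerD2l.
Qed.

Lemma nbhs_nrmP W (x : W) (A : set W) :
  nbhs x A <-> exists2 e : R, 0 < e & forall y, nrm (y - x) < e -> A y.
Proof.
split=> [/nbhs_ballP [e e0 eA]|[e e0 eA]].
  exists (complex.Re e); first by move: e0; rewrite /= ltcE => /andP[].
  move=> y yx; apply: eA; rewrite -ball_normE /ball_ /= distrC nrmE.
  by rewrite ltcE /= yx andbT; move: e0; rewrite /= ltcE => /andP[].
apply/nbhs_ballP; exists e%:C%C; first by rewrite /= ltcR.
move=> y; rewrite -ball_normE /ball_ /= distrC nrmE ltcR; exact: eA.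
Qed.

Lemma continuous_nrmP V W (f : V -> W) (x : V) :
  {for x, continuous f} <->
  forall e : R, 0 < e -> exists2 d : R, 0 < d &
    forall y, nrm (y - x) < d -> nrm (f y - f x) < e.
Proof.
split=> [cf e e0|h A].
  have /cf/nbhs_nrmP : nbhs (f x) [set w | nrm (w - f x) < e].
    by apply/nbhs_nrmP; exists e.
  by case=> d d0 dP; exists d.
move=> /nbhs_nrmP [e e0 eA]; have [d d0 dP] := h e e0.
by apply/nbhs_nrmP; exists d => // y /dP; exact: eA.
Qed.

End Norm.

(** * Differentiability in epsilon-delta form *)

Section Diff.
Context {R : realType}.
Implicit Types V W : normedModType R[i].

Lemma diff_nrmP V W (f : V -> W) (x : V) : differentiable f x ->
  forall e : R, 0 < e -> exists2 d : R, 0 < d &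
    forall v, nrm v < d -> nrm (f (x + v) - f x - 'd f x v) <= e * nrm v.
Proof.
move=> /diff_locally /eqaddoP fx e e0.
have /fx/nbhs_nrmP [d d0 dP] : 0 < e%:C%C by rewrite ltcR.
exists d => // v vd; have := dP v; rewrite subr0 => /(_ vd).
rewrite !nrmE -rmorphM lecR.
have -> : (f \o shift x - (cst (f x) + 'd f x)) v = f (x + v) - f x - 'd f x v.
  by rewrite /= !fctE /= [v + x]addrC opprD addrA.
by [].
Qed.

Lemma diff_lipschitz V W (f : V -> W) (x : V) : differentiable f x ->
  exists2 k : R, 0 < k & forall v, nrm ('d f x v) <= k * nrm v.
Proof.
move=> fx; have [k k0 kP] := linear_lipschitz (diff_continuous fx).
have kE : k = (complex.Re k)%:C%C.
  by move: k0; rewrite ltcE; case: {kP} k => a b /= /andP[/eqP -> _].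
exists (complex.Re k); first by move: k0; rewrite ltcE => /andP[].
by move=> v; have := kP v; rewrite kE !nrmE -rmorphM lecR.
Qed.

(** The bound by [k] supplies the continuity of [df], which a linear map between arbitrary normed
    modules may lack; the other hypothesis is the little-o condition. *)
Lemma nrm_diff V W (f : V -> W) (x : V) (df : {linear V -> W}) (k : R) :
  (forall v, nrm (df v) <= k * nrm v) ->
  (forall e : R, 0 < e -> exists2 d : R, 0 < d &
    forall v, nrm v < d -> nrm (f (x + v) - f x - df v) <= e * nrm v) ->
  is_diff x f df.
Proof.
move=> dfk fP.
have cdf : continuous df.
  move=> y; apply/continuous_nrmP => e e0.
  exists (e / (`|k| + 1)); first by rewrite divr_gt0 // ltr_wpDl.
  move=> z; rewrite ltr_pdivlMr ?ltr_wpDl // => h; rewrite -linearB.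
  apply: le_lt_trans (dfk _) _; apply: le_lt_trans h.
  rewrite mulrC ler_wpM2l ?nrm_ge0 //.
  by apply: le_trans (ler_norm k) _; rewrite lerDl.
have fo : f \o shift x = cst (f x) + df +o_ 0 id.
  apply/eqaddoP => e e0.
  have eE : e = (complex.Re e)%:C%C.
    by move: e0; rewrite ltcE; case: e => a b /= /andP[/eqP -> _].
  have /fP [d d0 dP] : 0 < complex.Re e by move: e0; rewrite ltcE => /andP[].
  apply/nbhs_nrmP; exists d => // v; rewrite subr0 => /dP.
  rewrite eE !nrmE -rmorphM lecR.
  by have -> : (f \o shift x - (cst (f x) + df)) v = f (x + v) - f x - df v
    by rewrite /= !fctE /= [v + x]addrC opprD addrA.
have dE := diff_unique cdf fo.
split => //; apply/diff_locallyP; split; rewrite dE //.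
Qed.

Lemma differentiable_nrm_cont V W (f : V -> W) (x : V) : differentiable f x ->
  forall e : R, 0 < e -> exists2 d : R, 0 < d &
    forall y, nrm (y - x) < d -> nrm (f y - f x) < e.
Proof. by move=> /differentiable_continuous /continuous_nrmP. Qed.

Lemma eq_near_differentiable V W (f g : V -> W) (x : V) (d : R) : 0 < d ->
  (forall y, nrm (y - x) < d -> f y = g y) ->
  differentiable f x -> differentiable g x.
Proof.
move=> d0 fg fx.
have [k k0 kP] := diff_lipschitz fx.
suff : is_diff x g ('d f x) by case.
apply: (nrm_diff kP) => e e0.
have [d' d'0 dP] := diff_nrmP fx e0.
exists (Num.min d d'); first by rewrite lt_min d0.
move=> v; rewrite lt_min => /andP[vd vd'].
by rewrite -!fg ?subrr ?nrm0 ?dP // addrC addKr.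
Qed.

End Diff.

(** * Compactness: uniform thresholds, extrema, closed balls *)

Section Compact.
Context {R : realType}.
Implicit Types V W : normedModType R[i].

(** Local thresholds are merged into one by compactness. The hypothesis asks for [P] at every
    smaller [d'], so that the threshold of one neighbourhood may be lowered to that of another. *)
Lemma compact_uniform V (K : set V) (P : V -> R -> Prop) : compact K ->
  (forall x, K x -> exists2 d : R, 0 < d &
     forall y d', nrm (y - x) < d -> 0 < d' < d -> P y d') ->
  exists2 d : R, 0 < d & forall y, K y -> P y d.
Proof.
move=> /compact_near_coveringP cK KP.
have := cK R (0 : R)^'+ (fun d y => P y d) _.
have H x : K x -> \forall x' \near x & i \near (0 : R)^'+, P x' i.
  move=> /KP [d d0 dP].
  exists ([set y | nrm (y - x) < d], [set i | 0 < i < d]); last first.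
    by case=> y i [] /=; exact: dP.
  split => /=; first by apply/nbhs_nrmP; exists d.
  near=> i; apply/andP; split; near: i.
    exact: nbhs_right_gt.
  exact: nbhs_right_lt.
move=> /(_ _ H) h.
have : \forall d \near (0 : R)^'+, 0 < d /\ K `<=` (fun y => P y d).
  apply: filterI => //; exact: nbhs_right_gt.
by move=> /filter_ex [d [d0 dP]]; exists d.
Unshelve. all: by end_near. Qed.

Lemma compact_argmax V (K : set V) (f : V -> R) : K !=set0 -> compact K ->
  (forall x, K x -> forall e : R, 0 < e -> exists2 d : R, 0 < d &
     forall y, K y -> nrm (y - x) < d -> `|f y - f x| < e) ->
  exists2 c, K c & forall y, K y -> f y <= f c.
Proof.
move=> K0 cK fK; have [|c cK' cP] := compact_EVT_max (f := f) K0 cK.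
  apply/subspace_continuousP => x Kx A /nbhs_ballP [e e0 eA].
  have [d d0 dP] := fK x Kx e e0.
  apply/nbhs_nrmP; exists d => // y yx Ky; apply: eA.
  by rewrite -ball_normE /ball_ /= distrC; apply: dP.
by exists c; [rewrite inE in cK' | move=> y Ky; apply: cP; rewrite inE].
Qed.

Lemma compact_argmin V (K : set V) (f : V -> R) : K !=set0 -> compact K ->
  (forall x, K x -> forall e : R, 0 < e -> exists2 d : R, 0 < d &
     forall y, K y -> nrm (y - x) < d -> `|f y - f x| < e) ->
  exists2 c, K c & forall y, K y -> f c <= f y.
Proof.
move=> K0 cK fK; have [|c Kc cP] := compact_argmax (f := fun x => - f x) K0 cK.
  move=> x Kx e /(fK x Kx) [d d0 dP]; exists d => // y Ky yx.
  by rewrite -opprD normrN; exact: dP.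
by exists c => // y /cP; rewrite lerN2.
Qed.

Lemma open_nrmP V (A : set V) : open A <->
  forall x, A x -> exists2 e : R, 0 < e & forall y, nrm (y - x) < e -> A y.
Proof.
rewrite openE; split=> h x /h; last by move=> ?; apply/nbhs_nrmP.
by move/nbhs_nrmP.
Qed.

Lemma open_nrm_lt V (c : V) (M : R) : open [set v | nrm (v - c) < M].
Proof.
apply/open_nrmP => x /= xM; exists (M - nrm (x - c)); first by rewrite subr_gt0.
move=> y yx; have := nrmD (y - x) (x - c); rewrite addrA subrK.
by move=> h; apply: le_lt_trans h _; rewrite -ltrBrDr.
Qed.

Lemma open_nrm_gt V (c : V) (M : R) : open [set v | M < nrm (v - c)].
Proof.
apply/open_nrmP => x /= xM; exists (nrm (x - c) - M); first by rewrite subr_gt0.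
move=> y yx; have := nrmD (x - y) (y - c); rewrite addrA subrK nrm_distC.
by move=> h; lra.
Qed.

Lemma closed_nrm_le V (c : V) (M : R) : closed [set v | nrm (v - c) <= M].
Proof.
rewrite (_ : [set _ | _] = ~` [set v | M < nrm (v - c)]).
  exact/open_closedC/open_nrm_gt.
by apply/seteqP; split => x /=; rewrite leNgt => /negP.
Qed.

(** The disk is a closed part of a square, which is the continuous image of a product of two
    segments. *)
Lemma compact_disk (M : R) : compact [set x : R[i] | nrm x <= M].
Proof.
pose g (p : R * R) : R[i] := (p.1 +i* p.2)%C.
have cg : continuous g.
  move=> p A /nbhs_nrmP [e e0 eA].
  apply/nbhs_ballP; exists (e / 2); first by rewrite /= divr_gt0.
  move=> q [] /=; rewrite -!ball_normE /ball_ /= => h1 h2; apply: eA.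
  apply: le_lt_trans (nrm_le_ReIm _) _ => /=.
  by rewrite [e]splitr ltrD // distrC.
have cI : compact (g @` (`[(- M), M]%classic `*` `[(- M), M]%classic)).
  apply: continuous_compact; first exact: continuous_subspaceT.
  by apply: compact_setX; exact: segment_compact.
apply: subclosed_compact cI _.
  by have := @closed_nrm_le R[i] 0 M; under eq_set do rewrite subr0.
move=> x /= xM; exists (complex.Re x, complex.Im x); last by case: {xM} x.
split => /=; rewrite in_itv /= -ler_norml.
  exact: le_trans (Re_le_nrm _) xM.
exact: le_trans (Im_le_nrm _) xM.
Qed.

Lemma nrm_coord n (v : 'rV[R[i]]_n) i : nrm (v ord0 i) <= nrm v.
Proof.
rewrite -lecR -!nrmE; have : mx_norm v <= mx_norm v by [].
rewrite [leLHS]mx_normE [in leRHS]mx_normE [_ <= _%:num]num_le.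
move=> /bigmax_leP [_ /(_ (ord0, i) isT)].
by rewrite -num_le -mx_normE.
Qed.

Lemma nrm_rowle n (v : 'rV[R[i]]_n) (M : R) : 0 <= M ->
  (forall i, nrm (v ord0 i) <= M) -> nrm v <= M.
Proof.
move=> M0 vM; have [v0|v0] := eqVneq (nrm v) 0; first by rewrite v0.
have : mx_norm v != 0.
  apply: contra v0 => /eqP h; rewrite /nrm; have -> : `|v| = mx_norm v by [].
  by rewrite h.
move=> /mx_norm_neq0 [[i j] h].
have -> : nrm v = nrm (v i j) by rewrite /nrm -[`|v i j|]h.
by rewrite (ord1 i).
Qed.

Lemma compact_nrm_ball n (M : R) : compact [set v : 'rV[R[i]]_n | nrm v <= M].
Proof.
apply: (subclosed_compact _ (@rV_compact R[i] n (fun=> [set x | nrm x <= M]) _)).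
- by have := @closed_nrm_le 'rV[R[i]]_n 0 M; under eq_set do rewrite subr0.
- by move=> _; exact: compact_disk.
- by move=> v /= vM i; exact: le_trans (nrm_coord _ _) vM.
Qed.

End Compact.

(** * Pointwise continuity and the algebra of differentiable functions *)

Section ContAt.
Context {R : realType}.
Local Notation C := R[i].
Implicit Types U V W : normedModType C.

Definition cont_at V W (f : V -> W) (x : V) := forall e : R, 0 < e ->
  exists2 d : R, 0 < d & forall y, nrm (y - x) < d -> nrm (f y - f x) < e.

Lemma cont_atE V W (f : V -> W) x : cont_at f x <-> {for x, continuous f}.
Proof. exact: iff_sym (continuous_nrmP f x). Qed.

Lemma diff_cont_at V W (f : V -> W) x : differentiable f x -> cont_at f x.
Proof. exact: differentiable_nrm_cont. Qed.

Lemma cont_at_id V x : cont_at (fun y : V => y) x.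
Proof. by move=> e e0; exists e. Qed.

Lemma eq_cont_at V W (f g : V -> W) x (d : R) : 0 < d ->
  (forall y, nrm (y - x) < d -> f y = g y) -> cont_at f x -> cont_at g x.
Proof.
move=> d0 fg cf e /cf [r r0 rP]; exists (Num.min d r); first by rewrite lt_min d0.
move=> y; rewrite lt_min => /andP[yd yr].
by rewrite -!fg ?subrr ?nrm0 //; exact: rP.
Qed.

Lemma cont_atM V (f g : V -> C) x :
  cont_at f x -> cont_at g x -> cont_at (fun y => f y * g y) x.
Proof.
move=> cf cg e e0.
pose M := nrm (f x) + nrm (g x) + 1.
have f0 := nrm_ge0 (f x); have g0 := nrm_ge0 (g x).
have M0 : 0 < M by rewrite /M; lra.
have eM : 0 < Num.min 1 (e / (2 * M)) by rewrite lt_min ltr01 divr_gt0 ?mulr_gt0.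
have [d1 d10 d1P] := cf _ eM; have [d2 d20 d2P] := cg _ eM.
exists (Num.min d1 d2); first by rewrite lt_min d10.
move=> y; rewrite lt_min => /andP[/d1P h1 /d2P h2].
move: h1 h2; rewrite !lt_min !ltr_pdivlMr ?mulr_gt0 // => /andP[u1 u2] /andP[v1 v2].
have -> : f y * g y - f x * g x = (f y - f x) * g y + f x * (g y - g x) by ring.
apply: le_lt_trans (nrmD _ _) _; rewrite !nrmM.
have gy : nrm (g y) <= nrm (g x) + 1.
  by have := nrmD (g y - g x) (g x); rewrite subrK; lra.
have k1 : nrm (f y - f x) * nrm (g y) <= nrm (f y - f x) * M.
  by rewrite ler_wpM2l ?nrm_ge0 // /M; lra.
have k2 : nrm (f x) * nrm (g y - g x) <= nrm (g y - g x) * M.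
  by rewrite mulrC ler_wpM2l ?nrm_ge0 // /M; lra.
by lra.
Qed.

Lemma cont_at_comp U V W (f : U -> V) (g : V -> W) x :
  cont_at f x -> cont_at g (f x) -> cont_at (fun y => g (f y)) x.
Proof.
move=> cf cg e /cg [d /cf [d' d'0 h] k]; exists d' => // y /h; exact: k.
Qed.

Lemma diffM V (f g : V -> C) x : differentiable f x -> differentiable g x ->
  differentiable (fun y => f y * g y) x.
Proof. exact: (@differentiableM C V f g x). Qed.

Lemma diffV V (f : V -> C) x : differentiable f x -> f x != 0 ->
  differentiable (fun y => (f y)^-1) x.
Proof. exact: (@differentiableV C V f x). Qed.

Lemma diffD V W (f g : V -> W) x : differentiable f x -> differentiable g x ->
  differentiable (fun y => f y + g y) x.
Proof. exact: (@differentiableD C V W f g x). Qed.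

Lemma diffB V W (f g : V -> W) x : differentiable f x -> differentiable g x ->
  differentiable (fun y => f y - g y) x.
Proof. exact: (@differentiableB C V W f g x). Qed.

Lemma diffC V W (c : W) (x : V) : differentiable (fun=> c) x.
Proof. exact: (@differentiable_cst C V W c x). Qed.

Lemma diffI V (x : V) : differentiable (fun y => y) x.
Proof. by have [] := @is_diff_id C V x. Qed.

Lemma diff_compf U V W (f : U -> V) (g : V -> W) x :
  differentiable f x -> differentiable g (f x) ->
  differentiable (fun y => g (f y)) x.
Proof. exact: (@differentiable_comp C U V W f g x). Qed.

Lemma diffX V (f : V -> C) x k : differentiable f x ->
  differentiable (fun y => f y ^+ k) x.
Proof.
move=> df; elim: k => [|k IH]; first exact: diffC.
rewrite (_ : (fun _ => _) = fun y => f y * f y ^+ k); first exact: diffM.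
by apply/funext => y; rewrite exprS.
Qed.

End ContAt.

(** * Goursat's theorem and means over circles *)

Section RiemannSums.
Context {R : realType}.
Local Notation C := R[i].

(** Left-endpoint Riemann sum with [2 ^ m] equal steps on the segment from [x] to [x + a]. Recursion
    on halves makes additivity under bisection hold by definition. *)
Fixpoint dyadic_sum m (u : R -> C) (x a : R) : C :=
  if m is m'.+1 then
    dyadic_sum m' u x (a / 2) + dyadic_sum m' u (x + a / 2) (a / 2)
  else a%:C%C * u x.

Lemma dyadic_sumD m u v x a : dyadic_sum m (fun t => u t + v t) x a =
  dyadic_sum m u x a + dyadic_sum m v x a.
Proof.
by elim: m x a => [|m IH] x a /=; rewrite ?mulrDr // !IH addrACA.
Qed.

Lemma dyadic_sumZ m c u x a : dyadic_sum m (fun t => c * u t) x a =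
  c * dyadic_sum m u x a.
Proof.
elim: m x a => [|m IH] x a /=; first exact: mulrCA.
by rewrite IH IH -mulrDr.
Qed.

Lemma eq_dyadic_sum m u v x a : 0 <= a ->
  (forall t, x <= t <= x + a -> u t = v t) ->
  dyadic_sum m u x a = dyadic_sum m v x a.
Proof.
elim: m x a => [|m IH] x a a0 uv /=; first by rewrite uv // lexx lerDl.
by rewrite !IH ?divr_ge0 // => t /andP[h1 h2]; apply: uv; lra.
Qed.

Lemma dyadic_sum_const m c x a : dyadic_sum m (fun=> c) x a = a%:C%C * c.
Proof.
elim: m x a => [|m IH] x a //=; rewrite !IH -mulrDl -rmorphD /=.
by congr (_%:C%C * _); lra.
Qed.

Lemma nrm_dyadic_sum m u x a M : 0 <= a ->
  (forall t, x <= t <= x + a -> nrm (u t) <= M) ->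
  nrm (dyadic_sum m u x a) <= a * M.
Proof.
elim: m x a => [|m IH] x a a0 uM /=.
  by rewrite nrmM nrm_real ger0_norm // ler_wpM2l // uM // lexx lerDl.
have h1 : nrm (dyadic_sum m u x (a / 2)) <= a / 2 * M.
  by apply: IH => [|t /andP[? ?]]; [|apply: uM]; lra.
have h2 : nrm (dyadic_sum m u (x + a / 2) (a / 2)) <= a / 2 * M.
  by apply: IH => [|t /andP[? ?]]; [|apply: uM]; lra.
by apply: le_trans (nrmD _ _) _; lra.
Qed.

End RiemannSums.

(** * Sums along the boundary of a rectangle *)

Section Goursat.
Context {R : realType}.
Local Notation C := R[i].
Implicit Types h : R -> R -> C.

(* Dyadic Riemann sums of the integral of [h] along the boundary of a rectangle. They
   are exactly additive under quartering, which is all that Goursat's bisection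
   argument needs. *)
Definition loop_sum h m (x y a b : R) : C :=
  dyadic_sum m (h^~ y) x a - dyadic_sum m (h^~ (y + b)) x a
  + 'i%C * (dyadic_sum m (h (x + a)) y b - dyadic_sum m (h x) y b).

Lemma loop_sumS h m x y a b : loop_sum h m.+1 x y a b =
  loop_sum h m x y (a / 2) (b / 2) + loop_sum h m (x + a / 2) y (a / 2) (b / 2)
  + (loop_sum h m x (y + b / 2) (a / 2) (b / 2)
     + loop_sum h m (x + a / 2) (y + b / 2) (a / 2) (b / 2)).
Proof.
rewrite /loop_sum /=.
have -> : y + b / 2 + b / 2 = y + b by lra.
have -> : x + a / 2 + a / 2 = x + a by lra.
by ring.
Qed.

Lemma loop_sumD h k m x y a b :
  loop_sum (fun s t => h s t + k s t) m x y a b =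
  loop_sum h m x y a b + loop_sum k m x y a b.
Proof. by rewrite /loop_sum !dyadic_sumD; ring. Qed.

(** On one cell the horizontal sides contribute [- d * 'i * a * b] and the vertical ones the
    opposite. The cancellation is exact at every level, so the first order part of [h] drops out of
    Goursat's argument without any limit. *)
Lemma loop_sum_affine (c d : C) m x y a b :
  loop_sum (fun s t => c + d * (s +i* t)%C) m x y a b = 0.
Proof.
elim: m x y a b => [|m IH] x y a b; last by rewrite loop_sumS !IH !addr0.
rewrite /loop_sum /=; case: c d => [c1 c2] [d1 d2].
by apply/eqP; rewrite eq_complex; simpc => /=; apply/andP; split; apply/eqP; ring.
Qed.

Lemma nrm_loop_sum h m x y a b M : 0 <= a -> 0 <= b ->
  (forall s t, x <= s <= x + a -> y <= t <= y + b -> nrm (h s t) <= M) ->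
  nrm (loop_sum h m x y a b) <= 2 * (a + b) * M.
Proof.
move=> a0 b0 hM; rewrite /loop_sum.
have i1 : nrm ('i%C : C) = 1 by rewrite /nrm /= expr0n /= add0r expr1n sqrtr1.
apply: le_trans (nrmD _ _) _; rewrite nrmM i1 mul1r.
have := nrmD (dyadic_sum m (h^~ y) x a) (- dyadic_sum m (h^~ (y + b)) x a).
have := nrmD (dyadic_sum m (h (x + a)) y b) (- dyadic_sum m (h x) y b).
rewrite !nrmN.
have := @nrm_dyadic_sum _ m (h^~ y) x a M a0.
have := @nrm_dyadic_sum _ m (h^~ (y + b)) x a M a0.
have := @nrm_dyadic_sum _ m (h (x + a)) y b M b0.
have := @nrm_dyadic_sum _ m (h x) y b M b0.
move=> /(_ _)/wrap[]; first by move=> t tb; apply: hM => //; lra.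
move=> h1 /(_ _)/wrap[]; first by move=> t tb; apply: hM => //; lra.
move=> h2 /(_ _)/wrap[]; first by move=> t tb; apply: hM => //; lra.
move=> h3 /(_ _)/wrap[]; first by move=> t tb; apply: hM => //; lra.
by move=> h4; lra.
Qed.

End Goursat.

Section GoursatTheorem.
Context {R : realType}.
Local Notation C := R[i].
Variable h : R -> R -> C.

(** The negation of the conclusion of Goursat's theorem. Arbitrarily fine meshes are required
    because each quartering lowers the level of the sum by one. *)
Let big (x y a b c : R) := forall m0, exists2 m, (m0 <= m)%N &
  c < nrm (loop_sum h m x y a b).

Let big_quadrant x y a b c : big x y a b c ->
  exists x' y', [/\ x' = x \/ x' = x + a / 2, y' = y \/ y' = y + b / 2 &
                    big x' y' (a / 2) (b / 2) (c / 4)].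
Proof.
move=> xb; apply: contrapT => nq.
have nb x' y' : x' = x \/ x' = x + a / 2 -> y' = y \/ y' = y + b / 2 ->
    exists m0, forall m, (m0 <= m)%N ->
      nrm (loop_sum h m x' y' (a / 2) (b / 2)) <= c / 4.
  move=> hx hy; apply: contrapT => nb; apply: nq; exists x', y'; split => // m0.
  apply: contrapT => nm; apply: nb; exists m0 => m m0m.
  by rewrite leNgt; apply/negP => h1; apply: nm; exists m.
have [m1 h1] := nb x y (or_introl erefl) (or_introl erefl).
have [m2 h2] := nb (x + a / 2) y (or_intror erefl) (or_introl erefl).
have [m3 h3] := nb x (y + b / 2) (or_introl erefl) (or_intror erefl).
have [m4 h4] := nb (x + a / 2) (y + b / 2) (or_intror erefl) (or_intror erefl).
have [[//|m] mm] := xb (m1 + m2 + m3 + m4).+1.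
rewrite ltnS in mm; rewrite loop_sumS => hc.
have l1 : (m1 <= m)%N by lia.
have l2 : (m2 <= m)%N by lia.
have l3 : (m3 <= m)%N by lia.
have l4 : (m4 <= m)%N by lia.
have := nrmD (loop_sum h m x y (a / 2) (b / 2))
  (loop_sum h m (x + a / 2) y (a / 2) (b / 2)).
have := nrmD (loop_sum h m x (y + b / 2) (a / 2) (b / 2))
  (loop_sum h m (x + a / 2) (y + b / 2) (a / 2) (b / 2)).
have := le_lt_trans (nrmD _ _) ; move=> /(_ _ _ _ _ _) h5.
move: (h1 m l1) (h2 m l2) (h3 m l3) (h4 m l4).
have := nrmD (loop_sum h m x y (a / 2) (b / 2) +
     loop_sum h m (x + a / 2) y (a / 2) (b / 2))
     (loop_sum h m x (y + b / 2) (a / 2) (b / 2) +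
     loop_sum h m (x + a / 2) (y + b / 2) (a / 2) (b / 2)).
by move: hc; clear; lra.
Qed.

(** If the sums do not fall below [c], some quarter keeps sums above [c / 4], and so on; the
    rectangles shrink to a point [(x, y)]. There [h] is an affine function, whose sums vanish, plus
    a remainder small compared with the side length, so the sums are small compared with
    [4 ^- k]. *)
Theorem goursat (x0 y0 a b : R) : 0 <= a -> 0 <= b ->
  (forall x y, x0 <= x <= x0 + a -> y0 <= y <= y0 + b ->
    exists d : C, forall e : R, 0 < e -> exists2 r : R, 0 < r &
    forall u v, `|u| < r -> `|v| < r ->
      nrm (h (x + u) (y + v) - h x y - d * (u +i* v)%C) <=
        e * (`|u| + `|v|)) ->
  forall c : R, 0 < c -> exists m0, forall m, (m0 <= m)%N ->
    nrm (loop_sum h m x0 y0 a b) <= c.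
Proof.
move=> a0 b0 hd c c0; apply: contrapT => nbig.
have big0 : big x0 y0 a b c.
  move=> m0; apply: contrapT => nm; apply: nbig; exists m0 => m m0m.
  by rewrite leNgt; apply/negP => h1; apply: nm; exists m.
pose A k : R := a / 2 ^+ k; pose B k : R := b / 2 ^+ k.
have AS k : A k.+1 = A k / 2 by rewrite /A exprSr invfM mulrA.
have BS k : B k.+1 = B k / 2 by rewrite /B exprSr invfM mulrA.
pose Q k (p : R * R) := big p.1 p.2 (A k) (B k) (c / 4 ^+ k).
have step (kp : nat * (R * R)) : exists q : R * R, Q kp.1 kp.2 ->
    [/\ q.1 = kp.2.1 \/ q.1 = kp.2.1 + A kp.1 / 2,
        q.2 = kp.2.2 \/ q.2 = kp.2.2 + B kp.1 / 2 & Q kp.1.+1 q].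
  have [Qp|] := pselect (Q kp.1 kp.2); last by exists (0, 0).
  have [x [y [hx hy xy]]] := big_quadrant Qp.
  exists (x, y) => _; split => //=.
  by rewrite /Q AS BS exprSr invfM mulrA.
have [f fP] := choice step.
pose p := fix p k := if k is k'.+1 then f (k', p k') else (x0, y0).
have Qp k : Q k (p k).
  elim: k => [|k IH]; first by rewrite /Q /A /B !expr0 !divr1.
  by have [] := fP (k, p k) IH.
have p1 k : (p k).1 <= (p k.+1).1 <= (p k).1 + A k / 2.
  have A0 : 0 <= A k by rewrite /A divr_ge0 // exprn_ge0.
  have [/= hx _ _] := fP (k, p k) (Qp k).
  by case: hx => ->; lra.
have p2 k : (p k).2 <= (p k.+1).2 <= (p k).2 + B k / 2.
  have B0 : 0 <= B k by rewrite /B divr_ge0 // exprn_ge0.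
  have [/= _ hy _] := fP (k, p k) (Qp k).
  by case: hy => ->; lra.
(* Nested intervals: the supremum of the left endpoints lies in all of them. *)
have nest (u : nat -> R) (D : R) : 0 <= D ->
    (forall k, u k <= u k.+1 <= u k + D / 2 ^+ k / 2) ->
    exists s, forall k, u k <= s <= u k + D / 2 ^+ k.
  move=> D0 uP.
  have umono i j : u i <= u (i + j)%N <= u i + D / 2 ^+ i - D / 2 ^+ (i + j).
    elim: j => [|j IH]; first by rewrite addn0 addrK lexx.
    rewrite addnS; have := uP (i + j)%N; rewrite exprSr invfM.
    by move: IH; rewrite !mulrA; lra.
  have uu i j : u j <= u i + D / 2 ^+ i.
    have D2 k : 0 <= D / 2 ^+ k by rewrite divr_ge0 // exprn_ge0.
    have [ij|/ltnW ji] := leqP i j.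
      by have := umono i (j - i)%N; rewrite subnKC //; have := D2 j; lra.
    by have := umono j (i - j)%N; rewrite subnKC //; have := D2 i; lra.
  exists (sup (range u)) => k; apply/andP; split.
    apply: ub_le_sup; last by exists k.
    by exists (u 0 + D / 2 ^+ 0) => _ [j _ <-]; exact: uu.
  apply: ge_sup; first by exists (u 0), 0.
  by move=> _ [j _ <-]; exact: uu.
have [x xP] := nest (fun k => (p k).1) a a0 p1.
have [y yP] := nest (fun k => (p k).2) b b0 p2.
have [||d dP] := hd x y.
- by have := xP 0; rewrite /= expr0 divr1.
- by have := yP 0; rewrite /= expr0 divr1.
(* The [k]-th rectangle has half perimeter [(a + b) / 2 ^+ k], so its sum is at most
   [2 * e * (a + b) ^+ 2 / 4 ^+ k], which must not exceed [c / 4 ^+ k]. The [+ 1] covers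
   [a = b = 0]. *)
pose e := c / (4 * (a + b + 1) ^+ 2).
have ab1 : 0 < a + b + 1 by lra.
have e0 : 0 < e by rewrite divr_gt0 // mulr_gt0 // exprn_gt0.
have [r r0 rP] := dP e e0.
have [k kr] : exists k, (a + b + 1) / 2 ^+ k < r.
  have : (fun k => (a + b + 1) * (2^-1 : R) ^+ k) @ \oo --> (0 : R).
    rewrite -(mulr0 (a + b + 1)); apply: cvgMr; apply: cvg_expr.
    by rewrite ger0_norm ?invr_ge0 // invf_lt1 // ltr1n.
  move=> /cvgrPdist_lt /(_ r r0) [k _ /(_ k (leqnn _)) /=].
  rewrite sub0r normrN ger0_norm ?mulr_ge0 ?(ltW ab1) ?exprn_ge0 ?invr_ge0 //.
  by rewrite exprVn; exists k.
have k2 : 0 < 2 ^- k :> R by rewrite invr_gt0 exprn_gt0.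
have [m _] := Qp k 0%N.
have -> : h = (fun s t => (h x y - d * (x +i* y)%C + d * (s +i* t)%C) +
     (h s t - h x y - d * ((s - x) +i* (t - y))%C)).
  apply/funext => s; apply/funext => t.
  have -> : ((s - x) +i* (t - y))%C = (s +i* t)%C - (x +i* y)%C by [].
  by ring.
rewrite loop_sumD loop_sum_affine add0r ltNge => /negP; apply.
have A0 : 0 <= A k by rewrite /A mulr_ge0 // ltW.
have B0 : 0 <= B k by rewrite /B mulr_ge0 // ltW.
have AB : A k + B k < r.
  by apply: le_lt_trans kr; rewrite /A /B -mulrDl ler_wpM2r // ?ltW //; lra.
apply: le_trans (@nrm_loop_sum _ _ m _ _ _ _ (e * (A k + B k)) A0 B0 _) _.
  move=> s t hs ht.
  have xk := xP k; have yk := yP k.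
  have sx : `|s - x| <= A k by rewrite ler_norml; rewrite -/(A k) in xk; lra.
  have ty : `|t - y| <= B k by rewrite ler_norml; rewrite -/(B k) in yk; lra.
  have := rP (s - x) (t - y); rewrite ![_ + (_ - _)]addrC !subrK => h1.
  apply: le_trans (h1 _ _) _; [lra|lra|].
  by rewrite ler_wpM2l ?(ltW e0) // lerD.
have -> : A k + B k = (a + b) / 2 ^+ k by rewrite /A /B mulrDl.
rewrite -(exprVn (4 : R)); have -> : (4 : R)^-1 ^+ k = (2 ^- k) ^+ 2.
  by rewrite -exprVn -exprM mulnC exprM; congr (_ ^+ _); lra.
move: k2; set t : R := 2 ^- k => t0.
have e1 : 2 * e * (a + b) ^+ 2 <= c.
  rewrite /e; set S := (a + b + 1) ^+ 2; set w := (a + b) ^+ 2.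
  have w1 : w <= S by rewrite /w /S; nra.
  have S0 : 0 < S by rewrite exprn_gt0.
  have -> : 2 * (c / (4 * S)) * w = (c * w / 2) / S by field; rewrite gt_eqF.
  rewrite ler_pdivrMr //.
  have cw : c * w <= c * S by rewrite ler_wpM2l // ltW.
  have cS : 0 < c * S by rewrite mulr_gt0.
  by lra.
have -> : 2 * ((a + b) * t) * (e * ((a + b) * t)) =
   2 * e * (a + b) ^+ 2 * t ^+ 2 by ring.
by rewrite ler_wpM2r // sqr_ge0.
Qed.

End GoursatTheorem.

(** * The complex exponential *)

Section ComplexExp.
Context {R : realType}.
Local Notation C := R[i].

Lemma is_derive_nrmP (f : R -> R) (x d : R) : is_derive x 1 f d ->
  forall e : R, 0 < e -> exists2 r : R, 0 < r &
    forall u, `|u| < r -> `|f (x + u) - f x - d * u| <= e * `|u|.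
Proof.
move=> [dfx dE] e e0; have dif : differentiable f x by apply/derivable1_diffP.
have /eqaddoP /(_ e e0) /nbhs_ballP [r r0 rP] := diff_locally dif.
exists r => // u ur.
have := rP u; rewrite -ball_normE /ball_ /= sub0r normrN => /(_ ur).
have -> : (f \o shift x - (cst (f x) + 'd f x)) u =
          f (x + u) - f x - 'd f x u by rewrite /= !fctE /= [u + x]addrC opprD addrA.
suff -> : 'd f x u = d * u by [].
rewrite -[u in LHS]mulr1 -[u * 1]/(u *: (1 : R)) linearZ /= -[LHS]/(u * _) mulrC.
by rewrite -dE deriveE.
Qed.

Definition cis (t : R) : C := (cos t +i* sin t)%C.

Lemma nrm_cis t : nrm (cis t) = 1.
Proof. by rewrite /nrm /= cos2Dsin2 sqrtr1. Qed.

Definition cexp (z : C) : C := (expR (complex.Re z))%:C%C * cis (complex.Im z).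

Lemma cexpD z w : cexp (z + w) = cexp z * cexp w.
Proof.
case: z w => [a b] [c d]; rewrite /cexp /cis /=; simpc => /=.
rewrite expRD cosD sinD; apply/eqP; rewrite eq_complex /=.
by apply/andP; split; apply/eqP; ring.
Qed.

Lemma cexp_diff0 (e : R) : 0 < e -> exists2 r : R, 0 < r &
  forall w, nrm w < r -> nrm (cexp w - 1 - w) <= e * nrm w.
Proof.
(* The four products estimated below ([a1] to [a4]) add up to at most [8 * e' * nrm w]; the last of
   them also uses [nrm w < e']. *)
move=> e0; have [e' [e'0 e'1 e'e]] : exists e' : R, [/\ 0 < e', e' <= 1 & e' <= e / 10].
  exists (Num.min (e / 10) 1); rewrite lt_min !ge_min !lexx orbT.
  by rewrite ltr01 divr_gt0.
have [r1 r10 h1] := is_derive_nrmP (is_derive_expR 0) e'0.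
have [r2 r20 h2] := is_derive_nrmP (is_derive_sin 0) e'0.
have [r3 r30 h3] := is_derive_nrmP (is_derive_cos 0) e'0.
exists (Num.min (Num.min r1 r2) (Num.min r3 e')).
  by rewrite !lt_min r10 r20 r30 e'0.
case=> u v; rewrite !lt_min => /andP[/andP[w1 w2] /andP[w3 w4]].
have un := Re_le_nrm (u +i* v)%C; have vn := Im_le_nrm (u +i* v)%C.
rewrite /= in un vn.
move: (h1 u (le_lt_trans un w1)) (h2 v (le_lt_trans vn w2))
  (h3 v (le_lt_trans vn w3)).
rewrite !add0r expR0 sin0 cos0 mul1r !subr0 oppr0 mul0r subr0 mul1r => k1 k2 k3.
apply: le_trans (nrm_le_ReIm _) _; rewrite /cexp /cis /=; simpc => /=.
set N := nrm _ in un vn w1 w2 w3 w4 *.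
have N0 : 0 <= N by exact: nrm_ge0.
have c1 : `|cos v| <= 1 by rewrite ler_norml cos_geN1 cos_le1.
have -> : expR u * cos v - 1 - u = (expR u - 1 - u) * cos v + (1 + u) * (cos v - 1).
  by ring.
have -> : expR u * sin v - v = (1 + u + (expR u - 1 - u)) * (sin v - v)
   + (u + (expR u - 1 - u)) * v by ring.
move: k1 k2 k3; set E := expR u - 1 - u; set S := sin v - v; set K := cos v - 1.
move=> k1 k2 k3.
have E1 : `|E| <= e' * N by apply: le_trans k1 _; rewrite ler_wpM2l // ltW.
have S1 : `|S| <= e' * N by apply: le_trans k2 _; rewrite ler_wpM2l // ltW.
have K1 : `|K| <= e' * N by apply: le_trans k3 _; rewrite ler_wpM2l // ltW.
have a1 : `|E * cos v| <= e' * N.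
  by rewrite normrM -[leRHS]mulr1 ler_pM.
have a2 : `|(1 + u) * K| <= 2 * (e' * N).
  rewrite normrM ler_pM //; apply: le_trans (ler_normD _ _) _.
  by rewrite normr1; lra.
have e'N : e' * N <= N by rewrite -[leRHS]mul1r ler_wpM2r.
have uE : `|u + E| <= 2 * N by apply: le_trans (ler_normD _ _) _; lra.
have a3 : `|(1 + u + E) * S| <= 3 * (e' * N).
  rewrite normrM ler_pM // -addrA; apply: le_trans (ler_normD _ _) _.
  by rewrite normr1; lra.
have a4 : `|(u + E) * v| <= 2 * (e' * N).
  rewrite normrM mulrA; apply: ler_pM => //.
  by apply: le_trans uE _; lra.
have := ler_normD (E * cos v) ((1 + u) * K).
have := ler_normD ((1 + u + E) * S) ((u + E) * v).
have : 10 * (e' * N) <= e * N by rewrite mulrA ler_wpM2r //; lra.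
have : 0 <= e' * N by rewrite mulr_ge0 // ltW.
by lra.
Qed.

Lemma differentiable_cexp z : differentiable cexp z.
Proof.
suff : is_diff z cexp ( *:%R (cexp z)) by case.
apply: (@nrm_diff _ _ _ _ _ _ (nrm (cexp z))) => [v|e e0].
  by rewrite nrmZ.
have n1 : 0 < nrm (cexp z) + 1 by rewrite ltr_wpDl // nrm_ge0.
have [r r0 rP] := cexp_diff0 (divr_gt0 e0 n1).
exists r => // v /rP h.
have -> : cexp (z + v) - cexp z - cexp z *: v = cexp z * (cexp v - 1 - v).
  by rewrite cexpD !mulrBr mulr1.
rewrite nrmM; apply: le_trans (ler_wpM2l (nrm_ge0 _) h) _.
rewrite mulrA ler_wpM2r ?nrm_ge0 // mulrA ler_pdivrMr //.
by rewrite mulrC ler_wpM2l ?(ltW e0) // lerDl.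
Qed.

End ComplexExp.

(** * Means over the unit circle *)

Section CircleMean.
Context {R : realType}.
Local Notation C := R[i].

(* An ultrafilter limit of Riemann sums over the dyadic roots of unity: it is
   defined for every function bounded on the circle, with no continuity needed. *)
Definition mean_filter : set_system nat :=
  projT1 (cid (ultraFilterLemma eventually_filter)).

Lemma mean_filterP : UltraFilter mean_filter /\ \oo `<=` mean_filter.
Proof. exact: projT2 (cid (ultraFilterLemma eventually_filter)). Qed.

Definition circle_sum (u : C -> C) m : C :=
  dyadic_sum m (fun t => u (cis (2 * pi * t))) 0 1.

Definition mean (u : C -> C) : C := lim (circle_sum u @ mean_filter).

Definition circle_bound (u : C -> C) (B : R) := forall w, nrm w = 1 -> nrm (u w) <= B.

Lemma nrm_circle_sum u B m : circle_bound u B -> nrm (circle_sum u m) <= B.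
Proof.
move=> uB; rewrite -[leRHS]mul1r; apply: nrm_dyadic_sum => // t _.
by apply: uB; exact: nrm_cis.
Qed.

(** The image of an ultrafilter is an ultrafilter, and the sums stay in a compact disk; hence they
    converge along [mean_filter], whatever the regularity of [u]. *)
Lemma mean_cvg u B : circle_bound u B -> circle_sum u @ mean_filter --> mean u.
Proof.
move=> uB; have [UF _] := mean_filterP.
have := @compact_disk R B; rewrite compact_ultra.
have UI : UltraFilter (circle_sum u @ mean_filter).
  split=> [|G PG sub]; first exact: fmap_proper_filter.
  apply/seteqP; split=> A; last exact: sub.
  move=> GA; have [//|nA] := in_ultra_setVsetC (circle_sum u @^-1` A) UF.
  have GnA : G (~` A) by apply: sub.
  by have /filter_ex [x []] : G (A `&` ~` A) by exact: filterI.
have h : (circle_sum u @ mean_filter) [set x | nrm x <= B].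
  suff : mean_filter [set m | nrm (circle_sum u m) <= B] by [].
  by apply: filterE => m; exact: nrm_circle_sum.
move=> /(_ _ UI h) [p [_ up]].
exact: (cvgP p up).
Qed.

Lemma mean_lim u B l : circle_bound u B ->
  circle_sum u @ mean_filter --> l -> mean u = l.
Proof.
move=> uB ul; have [UF _] := mean_filterP.
by apply: cvg_unique (mean_cvg uB) ul; exact: norm_hausdorff.
Qed.

Lemma meanD u v B B' : circle_bound u B -> circle_bound v B' ->
  mean (fun w => u w + v w) = mean u + mean v.
Proof.
move=> uB vB; have [UF _] := mean_filterP.
apply: (@mean_lim _ (B + B')).
  by move=> w w1; apply: le_trans (nrmD _ _) _; rewrite lerD ?uB ?vB.
have -> : circle_sum (fun w => u w + v w) = circle_sum u \+ circle_sum v.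
  by apply/funext => m; rewrite /circle_sum dyadic_sumD.
by apply: cvgD; [exact: mean_cvg uB|exact: mean_cvg vB].
Qed.

Lemma meanZ c u B : circle_bound u B -> mean (fun w => c * u w) = c * mean u.
Proof.
move=> uB; have [UF _] := mean_filterP.
apply: (@mean_lim _ (nrm c * B)).
  by move=> w w1; rewrite nrmM ler_wpM2l ?nrm_ge0 ?uB.
have -> : circle_sum (fun w => c * u w) = (fun m => c *: circle_sum u m).
  by apply/funext => m; rewrite /circle_sum dyadic_sumZ.
by apply: cvgZr; exact: mean_cvg uB.
Qed.

Lemma eq_mean u v : (forall w, nrm w = 1 -> u w = v w) -> mean u = mean v.
Proof.
move=> uv; rewrite /mean (_ : circle_sum u = circle_sum v) //.
by apply/funext => m; apply: eq_dyadic_sum => // t _; apply: uv; exact: nrm_cis.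
Qed.

Lemma mean_cst c : mean (fun=> c) = c.
Proof.
have [UF _] := mean_filterP; apply: (@mean_lim _ (nrm c)) => //.
have -> : circle_sum (fun=> c) = fun=> c.
  by apply/funext => m; rewrite /circle_sum dyadic_sum_const mul1r.
exact: cvg_cst.
Qed.

Lemma nrm_mean u B : circle_bound u B -> nrm (mean u) <= B.
Proof.
move=> uB; have [UF _] := mean_filterP.
suff : [set v | nrm (v - 0) <= B] (mean u) by rewrite /= subr0.
apply: (closed_cvg _ (@closed_nrm_le R C 0 B) _ _ (mean_cvg uB)).
by apply: filterE => m; rewrite /= subr0; exact: nrm_circle_sum.
Qed.

Lemma meanB u v B B' : circle_bound u B -> circle_bound v B' ->
  mean (fun w => u w - v w) = mean u - mean v.
Proof.
move=> uB vB; rewrite (@eq_mean _ (fun w => u w + -1 * v w)); last first.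
  by move=> w _; rewrite mulN1r.
rewrite (@meanD _ _ B B') //; last by move=> w w1; rewrite mulN1r nrmN vB.
by rewrite (@meanZ _ _ B') // mulN1r.
Qed.

(** The bridge from Goursat's theorem, a statement about all large [m], to means: [mean_filter]
    refines the filter of large integers. *)
Lemma mean_eq_small u v B B' : circle_bound u B -> circle_bound v B' ->
  (forall c : R, 0 < c -> exists m0, forall m, (m0 <= m)%N ->
    nrm (circle_sum u m - circle_sum v m) <= c) -> mean u = mean v.
Proof.
move=> uB vB uv; have [UF sub] := mean_filterP.
apply/eqP; rewrite -subr_eq0 -(meanB uB vB); apply/eqP.
have bB : circle_bound (fun w => u w - v w) (B + B').
  by move=> w w1; apply: le_trans (nrmD _ _) _; rewrite nrmN lerD ?uB ?vB.
apply: (mean_lim bB) => A /nbhs_nrmP [e e0 eA].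
have [m0 mP] := uv (e / 2) (divr_gt0 e0 (ltr0Sn _ _)).
apply: sub; exists m0 => // m /mP h; apply: eA; rewrite subr0.
rewrite (_ : circle_sum _ m = circle_sum u m - circle_sum v m); first lra.
rewrite /circle_sum -[- dyadic_sum _ _ _ _]mulN1r -dyadic_sumZ -dyadic_sumD.
by apply: eq_dyadic_sum => // t _; rewrite mulN1r.
Qed.

End CircleMean.

Section Lines.
Context {R : realType}.
Local Notation C := R[i].

Lemma differentiable_line (V W : normedModType C) (f : V -> W) (z v : V) (t : C) :
  differentiable f (z + t *: v) -> differentiable (fun s : C => f (z + s *: v)) t.
Proof.
by move=> df; apply: (@differentiable_comp C C V W (fun s : C => z + s *: v) f).
Qed.

Lemma differentiable_polar (f : C -> C) (x : R) (z : C) :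
  differentiable f (x%:C%C * z) -> differentiable (fun s : C => f (x%:C%C * s)) z.
Proof.
move=> df; rewrite (_ : (fun _ => _) = fun s : C => f (0 + s *: x%:C%C)).
  by apply: differentiable_line; rewrite add0r -[_ *: _]/(z * x%:C%C) mulrC.
by apply/funext => s; rewrite add0r -[_ *: _]/(s * x%:C%C) mulrC.
Qed.

End Lines.

(** * Independence of the mean from the radius *)

Section Annulus.
Context {R : realType}.
Local Notation C := R[i].
Implicit Types (g q : C -> C) (r : R).

Lemma nrm_polar r (w : C) : 0 <= r -> nrm w = 1 -> nrm (r%:C%C * w) = r.
Proof. by move=> r0 w1; rewrite nrmM w1 mulr1 nrm_real ger0_norm. Qed.

Lemma compact_circle r : compact [set z : C | nrm z = r].
Proof.
apply: subclosed_compact (@compact_disk R r) _ => [|z /= -> //].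
rewrite (_ : [set _ | _] =
    [set z : C | nrm (z - 0) <= r] `&` ~` [set z : C | nrm (z - 0) < r]).
  apply: closedI; first exact: closed_nrm_le.
  exact/open_closedC/open_nrm_lt.
apply/seteqP; split => z /=; rewrite subr0; first by move=> ->; rewrite ltxx.
by move=> [h /negP]; rewrite -leNgt => h'; apply/eqP; rewrite eq_le h.
Qed.

Lemma circle_unif_cont q r : 0 <= r ->
  (forall z, nrm z = r -> cont_at q z) ->
  forall e : R, 0 < e -> exists2 d : R, 0 < d & forall s, `|s - r| < d ->
    forall w, nrm w = 1 -> nrm (q (s%:C%C * w) - q (r%:C%C * w)) <= e.
Proof.
move=> r0 cq e e0.
pose P (w : C) (d : R) := forall s, `|s - r| < d ->
  nrm (q (s%:C%C * w) - q (r%:C%C * w)) <= e.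
have [||d d0 dP] := @compact_uniform R C [set w | nrm w = 1] P.
- exact: compact_circle.
- move=> w /= w1; have cqw := cq _ (nrm_polar r0 w1).
  have [d d0 dP] := cqw _ (divr_gt0 e0 (ltr0Sn _ 1)).
  (* [x * y - r * w = (x - r) * y + r * (y - w)] with [nrm y <= 2]: deviations below [d / (r + 2)]
     give a distance below [d]. *)
  pose d' := Num.min 1 (d / (r + 2)).
  have d'0 : 0 < d' by rewrite lt_min ltr01 divr_gt0 // ltr_wpDl.
  have dd : forall x : R, x < d' -> x < 1 /\ x * (r + 2) < d.
    by move=> x; rewrite lt_min ltr_pdivlMr ?ltr_wpDl // => /andP[].
  exists d' => // y h /dd [y1 yd] /andP[h0 /dd [h1 hd]] s sr.
  have yn : nrm y <= 2.
    by have := nrmD (y - w) w; rewrite subrK w1; lra.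
  have sy (x : R) : `|x - r| < h -> nrm (q (x%:C%C * y) - q (r%:C%C * w)) < e / 2.
    move=> xr; apply: dP.
    have -> : x%:C%C * y - r%:C%C * w = (x - r)%:C%C * y + r%:C%C * (y - w).
      by rewrite rmorphB /=; ring.
    apply: le_lt_trans (nrmD _ _) _; rewrite !nrmM !nrm_real (ger0_norm r0).
    have x0 := normr_ge0 (x - r).
    have t0 := nrm_ge0 (y - w).
    have r2 : 0 < r + 2 by rewrite ltr_wpDl.
    have xd : `|x - r| * (r + 2) < d by apply: lt_trans hd; rewrite ltr_pM2r.
    have m1 : `|x - r| * nrm y <= `|x - r| * 2 by rewrite ler_wpM2l.
    have m2 : r * (nrm (y - w) * (r + 2)) <= r * d by rewrite ler_wpM2l // ltW.
    rewrite -(ltr_pM2r r2); apply: le_lt_trans (_ : (`|x - r| * 2 +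
      r * nrm (y - w)) * (r + 2) < _); first by rewrite ler_pM2r // lerD2r.
    by lra.
  have := sy s sr; have := sy r; rewrite subrr normr0 => /(_ h0) e2 e1.
  apply: le_trans (_ : nrm ((q (s%:C%C * y) - q (r%:C%C * w)) -
     (q (r%:C%C * y) - q (r%:C%C * w))) <= _).
    by rewrite opprB addrA subrK.
  by apply: le_trans (nrmD _ _) _; rewrite nrmN; lra.
- by exists d => // s sd w w1; apply: dP.
Qed.

Lemma circle_bounded q r : 0 <= r ->
  (forall z, nrm z = r -> cont_at q z) ->
  exists B, circle_bound (fun w => q (r%:C%C * w)) B.
Proof.
move=> r0 cq.
have [|||c _ cP] := @compact_argmax R C [set z | nrm z = r] (fun z => nrm (q z)).
- by exists r%:C%C; rewrite /= nrm_real ger0_norm.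
- exact: compact_circle.
- move=> x /= /cq h e /h [d d0 dP].
  exists d => // y _ /dP; apply: le_lt_trans.
  by rewrite ler_norml; have := nrmB_ge (q x) (q y); have := nrmB_ge (q y) (q x);
    rewrite (nrm_distC (q x)); lra.
- by exists (nrm (q c)) => w w1; apply: cP; exact: nrm_polar.
Qed.

Lemma mean_cont q r : 0 <= r ->
  (forall z, nrm z = r -> cont_at q z) ->
  forall e : R, 0 < e -> exists2 d : R, 0 < d & forall s, `|s - r| < d ->
    forall B, circle_bound (fun w => q (s%:C%C * w)) B ->
    nrm (mean (fun w => q (s%:C%C * w)) - mean (fun w => q (r%:C%C * w))) <= e.
Proof.
move=> r0 cq e e0; have [d d0 dP] := circle_unif_cont r0 cq e0.
have [B0 B0P] := circle_bounded r0 cq.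
exists d => // s sd B BP; rewrite -(meanB BP B0P).
by apply: nrm_mean => w w1; exact: dP.
Qed.

(** The map [exp (2 pi (s + i t))] sends the rectangle [[s1, s2] x [0, 1]] to the annulus. Along its
    vertical sides the dyadic sums are the circle sums for [r1] and [r2]; along the horizontal sides
    they cancel by periodicity. Goursat's theorem makes the difference small. *)
Lemma mean_annulus g (r1 r2 : R) : 0 < r1 -> r1 <= r2 ->
  (forall z, r1 <= nrm z <= r2 -> differentiable g z) ->
  mean (fun w => g (r1%:C%C * w)) = mean (fun w => g (r2%:C%C * w)).
Proof.
move=> r10 r12 dg; have r20 : 0 < r2 by exact: lt_le_trans r12.
have cg z : r1 <= nrm z <= r2 -> cont_at g z.
  by move=> h; apply: diff_cont_at; exact: dg.
have [B1 B1P] : exists B, circle_bound (fun w => g (r1%:C%C * w)) B.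
  by apply: circle_bounded => [|z zr]; [exact: ltW|apply: cg; rewrite zr lexx].
have [B2 B2P] : exists B, circle_bound (fun w => g (r2%:C%C * w)) B.
  by apply: circle_bounded => [|z zr]; [exact: ltW|apply: cg; rewrite zr r12 lexx].
pose k : R := 2 * pi; have k0 : 0 < k by rewrite mulr_gt0 // pi_gt0.
pose h (s t : R) := g (cexp (k%:C%C * (s +i* t)%C)).
pose s1 := ln r1 / k; pose s2 := ln r2 / k.
have cexpE s t : cexp (k%:C%C * (s +i* t)%C) = (expR (k * s))%:C%C * cis (k * t).
  by rewrite /cexp /=; simpc.
have s12 : s1 <= s2 by rewrite /s1 /s2 ler_pM2r ?invr_gt0 // ler_ln.
have ks (r : R) : 0 < r -> expR (k * (ln r / k)) = r.
  by move=> r0; rewrite mulrC divfK ?gt_eqF // lnK.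
apply: (mean_eq_small B1P B2P) => c c0.
have [|||m0 m0P] := @goursat _ h s1 0 (s2 - s1) 1 _ _ _ c c0.
- by rewrite subr_ge0.
- by [].
- move=> x y xb _.
  pose H (z : C) := g (cexp (k%:C%C * z)).
  have dH : differentiable H (x +i* y)%C.
    apply: (@differentiable_comp C C C C (fun z => cexp (k%:C%C * z)) g).
      by apply: differentiable_polar; exact: differentiable_cexp.
    apply: dg; rewrite cexpE nrmM nrm_cis mulr1 nrm_real ger0_norm ?expR_ge0 //.
    have E1 : r1 = expR (k * s1) by rewrite ks.
    have E2 : r2 = expR (k * s2) by rewrite ks.
    by rewrite E1 E2 !ler_expR !ler_pM2l //; lra.
  exists ('d H (x +i* y)%C 1) => e e0.
  have [r r0 rP] := diff_nrmP dH e0.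
  exists (r / 2); first by rewrite divr_gt0.
  move=> u v ur vr.
  have uv := nrm_le_ReIm (u +i* v)%C.
  have := rP (u +i* v)%C _; rewrite /= in uv => /(_ _)/wrap[]; first by lra.
  rewrite -[X in 'd H _ X]mulr1 -[X in 'd H _ X]/((u +i* v)%C *: (1 : C)).
  rewrite linearZ /= -[_ *: _]/(_ * _) mulrC => hh.
  apply: le_trans hh _; rewrite ler_wpM2l // ltW //.
- exists m0 => m /m0P; rewrite /loop_sum add0r (addrC s1) subrK.
  rewrite (_ : h^~ 1 = h^~ 0); last first.
    apply/funext => s; rewrite /h !cexpE mulr1 mulr0 /cis.
    by rewrite /k mulr_natl cos2pi sin2pi cos0 sin0.
  rewrite subrr add0r nrmM.
  have -> : nrm ('i%C : C) = 1 by rewrite /nrm /= expr0n /= add0r expr1n sqrtr1.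
  rewrite mul1r nrm_distC; congr (nrm (_ - _) <= _).
    apply: eq_dyadic_sum => // t _; rewrite /h cexpE ks //.
  apply: eq_dyadic_sum => // t _; rewrite /h cexpE ks //.
Qed.

End Annulus.

(** * Cauchy's formula, the maximum principle and the identity theorem *)

Section Cauchy.
Context {R : realType}.
Local Notation C := R[i].
Implicit Types (g q : C -> C) (r : R) (a : C).

Lemma nrm_small (W : normedModType C) (x : W) :
  (forall e : R, 0 < e -> nrm x <= e) -> x = 0.
Proof.
by move=> h; apply/nrm_le0/ler_addgt0Pr => e e0; rewrite add0r h.
Qed.

Lemma holo_circle_bounded g r : 0 <= r ->
  (forall z, nrm z <= r -> differentiable g z) ->
  exists B, circle_bound (fun w => g (r%:C%C * w)) B.
Proof.
move=> r0 dg; apply: circle_bounded => // z zr.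
by apply: diff_cont_at; apply: dg; rewrite zr.
Qed.

(** The mean equals that over a circle of small radius [s], and tends to [g 0] with [s] by
    continuity. *)
Lemma mean_value g r : 0 < r -> (forall z, nrm z <= r -> differentiable g z) ->
  mean (fun w => g (r%:C%C * w)) = g 0.
Proof.
move=> r0 dg; apply/eqP; rewrite -subr_eq0; apply/eqP/nrm_small => e e0.
have [|z z0|d d0 dP] := @mean_cont _ g 0 _ _ e e0 => //.
  by apply: diff_cont_at; apply: dg; rewrite z0 ltW.
pose s := Num.min (d / 2) r.
have s0 : 0 < s by rewrite lt_min r0 divr_gt0.
have sr : s <= r by rewrite ge_min lexx orbT.
have sd : s < d by rewrite gt_min ltr_pdivrMr // ltr_pMr // ltr1n.
have [B BP] : exists B, circle_bound (fun w => g (s%:C%C * w)) B.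
  apply: holo_circle_bounded; first exact: ltW.
  by move=> z zs; apply: dg; exact: le_trans sr.
rewrite -(@mean_annulus _ g s r) // => [|z /andP[_ zr]]; last exact: dg.
have := dP s _ B BP; rewrite subr0 gtr0_norm // => /(_ sd).
rewrite (@eq_mean _ (fun w => g (0%:C%C * w)) (fun=> g 0)) ?mean_cst // => w _.
by rewrite mul0r.
Qed.

(** The mean is the same over all larger circles, where the kernel is [1 + a / (z - a)], and this
    tends to 1 as the radius grows. *)
Lemma cauchy_kernel r a : nrm a < r ->
  mean (fun w => r%:C%C * w / (r%:C%C * w - a)) = 1.
Proof.
move=> ar; have r0 : 0 < r by apply: le_lt_trans ar; exact: nrm_ge0.
have na (z : C) : nrm a < nrm z -> z - a != 0.
  by move=> h; rewrite subr_eq0; apply: contraL h => /eqP ->; rewrite ltxx.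
apply/eqP; rewrite -subr_eq0; apply/eqP/nrm_small => e e0.
pose k (z : C) := z / (z - a).
have dk z : nrm a < nrm z -> differentiable k z.
  move=> h; apply: diffM; first exact: diffI.
  by apply: diffV; [apply: diffB; [exact: diffI|exact: diffC]|exact: na].
pose s := Num.max r (nrm a + nrm a / e).
have rs : r <= s by rewrite le_max lexx.
have s0 : 0 < s by exact: lt_le_trans rs.
rewrite -[fun w => _]/(fun w => k (r%:C%C * w)).
rewrite (@mean_annulus _ k r s) // => [|z /andP[rz _]]; last first.
  by apply: dk; exact: lt_le_trans rz.
have kb : forall w : C, nrm w = 1 -> nrm (k (s%:C%C * w) - 1) <= e.
  move=> w w1; have sw := nrm_polar (ltW s0) w1.
  have as' : nrm a < nrm (s%:C%C * w) by rewrite sw; exact: lt_le_trans rs.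
  have -> : k (s%:C%C * w) - 1 = a / (s%:C%C * w - a).
    by rewrite /k; move: (na _ as'); move: (s%:C%C * w) => z za; field.
  rewrite nrmM nrmV ler_pdivrMr ?nrm_gt0 ?na //.
  have := nrmB_ge (s%:C%C * w) a; rewrite sw.
  have : nrm a + nrm a / e <= s by rewrite le_max lexx orbT.
  move=> h1 h2; have : nrm a / e <= nrm (s%:C%C * w - a) by lra.
  by rewrite ler_pdivrMr // mulrC.
have [B BP] : exists B, circle_bound (fun w => k (s%:C%C * w)) B.
  apply: circle_bounded => [|z zs]; first exact: ltW.
  apply: diff_cont_at; apply: dk.
  by rewrite zs; exact: lt_le_trans rs.
rewrite -[X in _ - X](@mean_cst R 1) -(@meanB _ _ _ B 1) //.
  exact: nrm_mean.
by move=> w _; rewrite nrm1.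
Qed.

(** With [p] the difference quotient of [g] at [a], the function [q z = z * p z] is continuous, and
    holomorphic off [a]. Its mean over the circle of radius [r] is 0, and on that circle [q] is
    [g - g a] times the Cauchy kernel. *)
Lemma cauchy_formula g r a : nrm a < r ->
  (forall z, nrm z <= r -> differentiable g z) ->
  mean (fun w => g (r%:C%C * w) * (r%:C%C * w / (r%:C%C * w - a))) = g a.
Proof.
move=> ar dg; have r0 : 0 < r by apply: le_lt_trans ar; exact: nrm_ge0.
pose d : C := 'd g a 1.
pose p (z : C) : C := if z == a then d else (g z - g a) / (z - a).
pose q (z : C) := z * p z.
have cpa : cont_at p a.
  move=> e e0.
  have [s s0 sP] := diff_nrmP (dg a (ltW ar)) (divr_gt0 e0 (ltr0Sn _ 1)).
  exists s => // z zs; rewrite /p eqxx; case: eqP => [_|/eqP za].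
    by rewrite subrr nrm0.
  have za0 : z - a != 0 by rewrite subr_eq0.
  have -> : (g z - g a) / (z - a) - d = (g z - g a - d * (z - a)) / (z - a).
    by field.
  rewrite nrmM nrmV ltr_pdivrMr ?nrm_gt0 //.
  have := sP _ zs; rewrite (addrC a) subrK.
  rewrite -[X in 'd g a X]mulr1 -[X in 'd g a X]/((z - a) *: (1 : C)) linearZ /=.
  rewrite -[_ *: _]/((z - a) * d) [(z - a) * d]mulrC => h.
  apply: le_lt_trans h _; rewrite ltr_pM2r ?nrm_gt0 //.
  by rewrite ltr_pdivrMr // ltr_pMr // ltr1n.
have dp z : nrm z <= r -> z != a -> differentiable p z.
  move=> zr za; apply: (@eq_near_differentiable R C C
    (fun z => (g z - g a) / (z - a)) p z (nrm (z - a))).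
  - by rewrite nrm_gt0 subr_eq0.
  - move=> y; rewrite /p; case: eqP => // ->.
    by rewrite nrm_distC ltxx.
  - apply: diffM; first by apply: diffB; [exact: dg|exact: diffC].
    apply: diffV; last by rewrite subr_eq0.
    by apply: diffB; [exact: diffI|exact: diffC].
have cq z : nrm z <= r -> cont_at q z.
  move=> zr; have cp : cont_at p z.
    by have [->//|za] := eqVneq z a; apply/diff_cont_at/dp.
  by apply: cont_atM => //; exact: cont_at_id.
have dq z : nrm z <= r -> z != a -> differentiable q z.
  by move=> zr za; apply: diffM; [exact: diffI|exact: dp].
have cqb s : 0 <= s <= r -> exists B, circle_bound (fun w => q (s%:C%C * w)) B.
  by case/andP => s0 sr; apply: circle_bounded => // z zs; apply: cq; rewrite zs.
pose F s := mean (fun w => q (s%:C%C * w)).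
have a0 := nrm_ge0 a.
have near_a e : 0 < e -> exists2 t : R, 0 < t & forall s, 0 <= s <= r ->
    `|s - nrm a| < t -> nrm (F s - F (nrm a)) <= e.
  move=> e0; have [|t t0 tP] := mean_cont a0 _ e0 (q := q).
    by move=> z za; apply: cq; rewrite za ltW.
  by exists t => // s /cqb [B BP] st; apply: tP BP.
(* Inside the circle through [a] the mean value property gives [q 0 = 0]; continuity of the mean in
   the radius reaches that circle. *)
have Fa : F (nrm a) = 0.
  have [an|an] := eqVneq (nrm a) 0.
    rewrite /F (@eq_mean _ _ (fun=> 0)) ?mean_cst // => w _.
    by rewrite an mul0r /q mul0r.
  have {}an : 0 < nrm a by rewrite lt_neqAle eq_sym an.
  apply: nrm_small => e e0; have [t t0 tP] := near_a e e0.
  pose s := Num.max (nrm a / 2) (nrm a - t / 2).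
  have s1 : nrm a / 2 <= s by rewrite le_max lexx.
  have s2 : nrm a - t / 2 <= s by rewrite le_max lexx orbT.
  have s3 : s < nrm a by rewrite gt_max; apply/andP; split; lra.
  have : F s = 0.
    rewrite /F mean_value; first by rewrite /q mul0r.
      by lra.
    move=> z zs; apply: dq; first by lra.
    by apply/eqP => za; move: zs; rewrite za; lra.
  move=> Fs; have := tP s; rewrite Fs sub0r nrmN; apply; first lra.
  by rewrite ltr_norml; lra.
(* The same crossing from outside: beyond the circle through [a] the mean does not depend on the
   radius. *)
have Fr : F r = 0.
  apply: nrm_small => e e0; have [t t0 tP] := near_a e e0.
  pose s := Num.min r (nrm a + t / 2).
  have s1 : s <= r by rewrite ge_min lexx.
  have s2 : s <= nrm a + t / 2 by rewrite ge_min lexx orbT.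
  have s3 : nrm a < s by rewrite lt_min ar; lra.
  have := tP s; rewrite Fa subr0 /F (@mean_annulus _ q s r) //; last first.
    move=> z /andP[sz zr]; apply: dq => //; apply/eqP => za.
    by move: sz; rewrite za; lra.
  - by lra.
  - by apply; [lra|rewrite ltr_norml; lra].
have na (w : C) : nrm w = 1 -> r%:C%C * w - a != 0.
  move=> w1; rewrite subr_eq0; apply: contraL ar => /eqP <-.
  by rewrite nrm_polar ?ltxx // ltW.
have [B BP] := holo_circle_bounded (ltW r0) dg.
have kB : circle_bound (fun w => r%:C%C * w / (r%:C%C * w - a)) (r / (r - nrm a)).
  move=> w w1; rewrite nrmM nrmV (nrm_polar (ltW r0) w1) ler_pM2l //.
  rewrite lef_pV2 ?posrE ?nrm_gt0 ?na ?subr_gt0 //.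
  by have := nrmB_ge (r%:C%C * w) a; rewrite nrm_polar // ltW.
have B0 : 0 <= B by apply: le_trans (BP 1 nrm1); exact: nrm_ge0.
have gkB : circle_bound (fun w => g (r%:C%C * w) * (r%:C%C * w / (r%:C%C * w - a)))
    (B * (r / (r - nrm a))).
  by move=> w w1; rewrite nrmM ler_pM ?nrm_ge0 ?BP ?kB.
move: Fr; rewrite /F (@eq_mean _ _ (fun w =>
   g (r%:C%C * w) * (r%:C%C * w / (r%:C%C * w - a))
   - g a * (r%:C%C * w / (r%:C%C * w - a)))); last first.
  move=> w w1; rewrite /q /p -subr_eq0 (negbTE (na w w1)).
  by move: (na w w1); move: (r%:C%C * w) => z za; field.
rewrite (meanB gkB (B' := nrm (g a) * (r / (r - nrm a)))); last first.
  by move=> w w1; rewrite nrmM ler_wpM2l ?nrm_ge0 ?kB.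
rewrite (meanZ _ kB) cauchy_kernel // mulr1 => /eqP.
by rewrite subr_eq0 => /eqP.
Qed.

End Cauchy.

(** * The maximum principle on a disk *)

Section MaxPrinciple.
Context {R : realType}.
Local Notation C := R[i].
Implicit Types (V W : normedModType C) (r : R).

Lemma cont_at_nrm V W (f : V -> W) x : cont_at f x ->
  cont_at (fun y => (nrm (f y))%:C%C) x.
Proof.
move=> cf e /cf [d d0 dP]; exists d => // y /dP; apply: le_lt_trans.
rewrite -rmorphB nrm_real ler_norml.
have := nrmB_ge (f x) (f y); have := nrmB_ge (f y) (f x).
by rewrite (nrm_distC (f x)); lra.
Qed.

Lemma cont_atD V W (f g : V -> W) x : cont_at f x -> cont_at g x ->
  cont_at (fun y => f y + g y) x.
Proof.
move=> cf cg e e0.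
have [d1 d10 h1] := cf _ (divr_gt0 e0 (ltr0Sn _ 1)).
have [d2 d20 h2] := cg _ (divr_gt0 e0 (ltr0Sn _ 1)).
exists (Num.min d1 d2); first by rewrite lt_min d10.
move=> y; rewrite lt_min => /andP[/h1 k1 /h2 k2].
rewrite opprD addrACA; apply: le_lt_trans (nrmD _ _) _; lra.
Qed.

Lemma cont_at_cst V W (c : W) (x : V) : cont_at (fun=> c) x.
Proof. by move=> e e0; exists 1 => // y _; rewrite subrr nrm0. Qed.

Lemma compact_argmax_cont V (K : set V) (f : V -> R) : K !=set0 -> compact K ->
  (forall x, K x -> cont_at (fun y => (f y)%:C%C) x) ->
  exists2 c, K c & forall y, K y -> f y <= f c.
Proof.
move=> K0 cK cf; apply: compact_argmax => // x /cf cfx e /cfx [d d0 dP].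
by exists d => // y _ /dP; rewrite -rmorphB nrm_real.
Qed.

Lemma Re_mean (u : C -> C) (B b : R) : circle_bound u B ->
  (forall w, nrm w = 1 -> complex.Re (u w) <= b) -> complex.Re (mean u) <= b.
Proof.
move=> uB ub; have [UF _] := mean_filterP.
have ReD (x y : C) : complex.Re (x + y) = complex.Re x + complex.Re y.
  by case: x y => [? ?] [? ?].
have cl : closed [set v : C | complex.Re v <= b].
  rewrite (_ : [set _ | _] = ~` [set v : C | b < complex.Re v]).
    apply/open_closedC/open_nrmP => x /= xb.
    exists (complex.Re x - b); first by rewrite subr_gt0.
    move=> y yx; have := Re_le_nrm (y - x); rewrite ler_norml.
    by have := ReD (y - x) x; rewrite subrK; lra.
  by apply/seteqP; split => x /=; rewrite leNgt => /negP.
suff : [set v : C | complex.Re v <= b] (mean u) by [].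
apply: (closed_cvg _ cl _ _ (mean_cvg uB)).
suff H m (x a : R) : 0 <= a ->
    complex.Re (dyadic_sum m (fun t => u (cis (2 * pi * t))) x a) <= a * b.
  by apply: filterE => m; have := H m 0 1 ler01; rewrite mul1r.
elim: m x a => [|m IH] x a a0 /=.
  rewrite (_ : complex.Re _ = a * complex.Re (u (cis (2 * pi * x)))).
    by rewrite ler_wpM2l // ub // nrm_cis.
  by case: (u _) => ? ? /=; rewrite mul0r subr0.
rewrite ReD; have a2 : 0 <= a / 2 by rewrite divr_ge0.
by have := IH x _ a2; have := IH (x + a / 2) _ a2; lra.
Qed.

Lemma mean_id : mean (fun w : C => w) = 0.
Proof.
have := @mean_value R (fun z => z) 1 ltr01 (fun z _ => diffI z).
by rewrite -[RHS]/(0 : C) => <-; apply: eq_mean => w _; rewrite mul1r.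
Qed.

(** The inequality expressing a maximum of [|psi|^2 + e |z|^2] at [p], made linear by
    [2 Re (conj P * Q) <= |P|^2 + |Q|^2]. The left side is now linear in [Q] and [w], so its mean
    over [w] follows from the mean value property. *)
Lemma Re_parallelogram (P Q p w : C) (e s : R) : nrm w = 1 ->
  nrm Q ^+ 2 + e * nrm (p + s%:C%C * w) ^+ 2 <= nrm P ^+ 2 + e * nrm p ^+ 2 ->
  complex.Re (conjc P * Q + (e * s)%:C%C * conjc p * w) <=
    nrm P ^+ 2 - e * s ^+ 2 / 2.
Proof.
move=> w1; have := nrm_sqr w; rewrite w1 expr1n !nrm_sqr.
case: P Q p w {w1} => [x1 y1] [x2 y2] [p1 p2] [w1 w2] /= ww.
have -> : e * s ^+ 2 / 2 = e * s ^+ 2 / 2 * (w1 ^+ 2 + w2 ^+ 2) by rewrite -ww mulr1.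
have : 0 <= (x1 - x2) ^+ 2 + (y1 - y2) ^+ 2 by rewrite addr_ge0 // sqr_ge0.
by clear; lra.
Qed.

(* An interior maximum of [|psi|^2 + e |z|^2] lies either on a zero of [psi], where the
   value is at most [e r^2], or at a point where the mean value property of [psi] is
   contradicted, since [e |z|^2] is strictly subharmonic. *)
Theorem max_disk (psi : C -> C) r (M : R) : 0 < r ->
  (forall z, nrm z <= r -> cont_at psi z) ->
  (forall z, nrm z < r -> psi z != 0 -> differentiable psi z) ->
  (forall z, nrm z = r -> nrm (psi z) <= M) ->
  forall a, nrm a <= r -> nrm (psi a) <= M.
Proof.
move=> r0 cpsi dpsi Mpsi a ar.
have M0 : 0 <= M.
  apply: le_trans (Mpsi r%:C%C _); first exact: nrm_ge0.
  by rewrite nrm_real ger0_norm ?ltW.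
suff sq : nrm (psi a) ^+ 2 <= M ^+ 2.
  by rewrite -(@ler_pXn2r _ 2) ?nnegrE ?nrm_ge0.
apply/ler_addgt0Pr => e' e'0; pose e := e' / r ^+ 2.
have r20 : 0 < r ^+ 2 by rewrite exprn_gt0.
have e0 : 0 < e by rewrite divr_gt0.
have er : e * r ^+ 2 = e' by rewrite divfK ?gt_eqF.
pose u (z : C) := nrm (psi z) ^+ 2 + e * nrm z ^+ 2.
have [|||p pr pP] := @compact_argmax_cont C [set z : C | nrm z <= r] u.
- by exists 0; rewrite /= nrm0 ltW.
- exact: compact_disk.
- move=> x /= /cpsi cx; rewrite (_ : (fun _ => _) = fun y =>
    (nrm (psi y))%:C%C * (nrm (psi y))%:C%C +
    e%:C%C * ((nrm y)%:C%C * (nrm y)%:C%C)); last first.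
    by apply/funext => y; rewrite /u !expr2 rmorphD !rmorphM.
  have := cont_at_nrm cx; have := @cont_at_nrm _ _ (fun y => y) x (@cont_at_id R C x).
  move=> h1 h2; apply: cont_atD; first exact: cont_atM.
  by apply: cont_atM; [exact: cont_at_cst|exact: cont_atM].
rewrite /= in pr; have := pP a ar; rewrite /u => ua.
have a20 : 0 <= e * nrm a ^+ 2 by rewrite mulr_ge0 ?(ltW e0) ?sqr_ge0.
have p2r : e * nrm p ^+ 2 <= e'.
  by rewrite -er ler_pM2l // ler_pXn2r // nnegrE ?nrm_ge0 // ltW.
have [prE|prN] := eqVneq (nrm p) r.
  have : nrm (psi p) ^+ 2 <= M ^+ 2.
    by rewrite ler_pXn2r ?nnegrE ?nrm_ge0 // Mpsi.
  by lra.
have {}pr : nrm p < r by rewrite lt_neqAle prN.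
have [psip|psip] := eqVneq (psi p) 0.
  have : nrm (psi p) ^+ 2 = 0 by rewrite psip nrm0 expr0n.
  by have := sqr_ge0 M; lra.
exfalso.
have np : 0 < nrm (psi p) by rewrite nrm_gt0.
have [d d0 dP] := cpsi p (ltW pr) _ np.
(* On the disk of radius [s] around [p] the function [psi] has no zero, so it is holomorphic there
   and has the mean value property. *)
pose s := Num.min (d / 2) ((r - nrm p) / 2).
have s0 : 0 < s by rewrite lt_min !divr_gt0 // subr_gt0.
have sd : s < d by rewrite gt_min; apply/orP; left; lra.
have sr : s < r - nrm p by rewrite gt_min; apply/orP; right; lra.
have inr z : nrm z <= s -> nrm (p + z) < r.
  by move=> zs; have := nrmD p z; lra.
have nz z : nrm z <= s -> psi (p + z) != 0.
  move=> zs; apply/eqP => h; have := dP (p + z).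
  by rewrite addrC addKr h sub0r nrmN ltxx; apply/implyP; lra.
pose g z := psi (p + z).
have dg z : nrm z <= s -> differentiable g z.
  move=> zs; apply: (@diff_compf _ _ _ _ (fun z => p + z) psi).
    by apply: diffD; [exact: diffC|exact: diffI].
  by apply: dpsi; [exact: inr|exact: nz].
have mg := mean_value s0 dg.
have [B BP] := holo_circle_bounded (ltW s0) dg.
pose c1 : C := conjc (psi p); pose c2 : C := (e * s)%:C%C * conjc p.
have b1 : circle_bound (fun w => c1 * g (s%:C%C * w)) (nrm c1 * B).
  by move=> w w1; rewrite nrmM ler_wpM2l ?nrm_ge0 // BP.
have b2 : circle_bound (fun w => c2 * w) (nrm c2 * 1).
  by move=> w w1; rewrite nrmM w1.
have := Re_mean (u := fun w => c1 * g (s%:C%C * w) + c2 * w)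
  (B := nrm c1 * B + nrm c2 * 1) (b := nrm (psi p) ^+ 2 - e * s ^+ 2 / 2).
rewrite (meanD b1 b2) (meanZ c1 BP) mg (@meanZ _ _ _ 1); last by move=> w ->.
rewrite mean_id mulr0 addr0 /g addr0.
have -> : complex.Re (c1 * psi p) = nrm (psi p) ^+ 2.
  by rewrite nrm_sqr /c1; case: (psi p) => x y /=; ring.
have es : 0 < e * s ^+ 2 by rewrite mulr_gt0 // exprn_gt0.
move=> h; have {h} := h _ _; case/(_ _ _)/wrap.
- by move=> w w1; apply: le_trans (nrmD _ _) _; rewrite lerD ?b1 ?b2.
- move=> w w1.
  have sw : nrm (s%:C%C * w) <= s by rewrite nrm_polar // ltW.
  by apply: Re_parallelogram => //; exact: pP _ (ltW (inr _ sw)).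
- by lra.
Qed.

End MaxPrinciple.

(** * Uniqueness and Schwarz's lemma on a disk *)

Section DiskEstimates.
Context {R : realType}.
Local Notation C := R[i].
Implicit Types (V W : normedModType C).

(** The end of every argument by powers: an estimate for all exponents, with ratio below 1, forces
    vanishing. *)
Lemma geometric_le0 (x q B : R) : 0 <= q -> q < 1 ->
  (forall N, x <= B * q ^+ N) -> x <= 0.
Proof.
move=> q0 q1 h; apply/ler_addgt0Pr => e e0; rewrite add0r.
have : (fun k => `|B| * q ^+ k) @ \oo --> (0 : R).
  by rewrite -(mulr0 `|B|); apply: cvgMr; apply: cvg_expr; rewrite ger0_norm.
move=> /cvgrPdist_lt /(_ e e0) [N _ /(_ N (leqnn _)) /=].
rewrite sub0r normrN ger0_norm ?mulr_ge0 ?exprn_ge0 //.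
move=> hN; apply: le_trans (h N) _; apply: le_trans (ltW hN).
by rewrite ler_wpM2r ?exprn_ge0 // ler_norm.
Qed.

Lemma cont_atX V (f : V -> C) x k : cont_at f x -> cont_at (fun y => f y ^+ k) x.
Proof.
move=> cf; elim: k => [|k IH].
  by rewrite (_ : (fun _ => _) = fun=> 1); [exact: cont_at_cst|apply/funext].
rewrite (_ : (fun _ => _) = fun y => f y * f y ^+ k); first exact: cont_atM.
by apply/funext => y; rewrite exprS.
Qed.

Lemma cont_atV V (f : V -> C) x : cont_at f x -> f x != 0 ->
  cont_at (fun y => (f y)^-1) x.
Proof.
move=> cf fx0; apply: (@cont_at_comp _ _ _ _ f (fun z : C => z^-1)) => //.
by apply: diff_cont_at; apply: diffV => //; exact: diffI.
Qed.

Lemma circle_sup (q : C -> C) (r : R) : 0 <= r ->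
  (forall z, nrm z = r -> cont_at q z) ->
  exists2 B : R, 0 <= B & forall z, nrm z = r -> nrm (q z) <= B.
Proof.
move=> r0 cq; have [|||c _ cP] := @compact_argmax_cont R C
    [set z | nrm z = r] (fun z => nrm (q z)).
- by exists r%:C%C; rewrite /= nrm_real ger0_norm.
- exact: compact_circle.
- by move=> x /= /cq; exact: cont_at_nrm.
- by exists (nrm (q c)) => //; exact: nrm_ge0.
Qed.

(* Uniqueness also holds when [phi] is only known to be holomorphic off its
   zeros: divide by [z ^+ N] and use the maximum principle. *)
Lemma zero_disk (phi : C -> C) (r d : R) : 0 < d ->
  (forall z, nrm z <= r -> cont_at phi z) ->
  (forall z, nrm z < r -> phi z != 0 -> differentiable phi z) ->
  (forall z, nrm z < d -> phi z = 0) ->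
  forall a, nrm a < r -> phi a = 0.
Proof.
move=> d0 cphi dphi phi0 a ar.
have [->|a0] := eqVneq a 0; first by apply: phi0; rewrite nrm0.
have na : 0 < nrm a by rewrite nrm_gt0.
have r0 : 0 < r by exact: lt_trans ar.
have [B B0 BP] : exists2 B : R, 0 <= B & forall z, nrm z = r -> nrm (phi z) <= B.
  by apply: circle_sup => [|z zr]; [exact: ltW|apply: cphi; rewrite zr].
apply: nrm_le0; apply: (@geometric_le0 _ (nrm a / r) B).
- by rewrite divr_ge0 // ltW.
- by rewrite ltr_pdivrMr // mul1r.
move=> N; pose psi z := phi z * (z ^+ N)^-1.
have npsi z : nrm z = r -> nrm (psi z) <= B * (r ^+ N)^-1.
  by move=> zr; rewrite nrmM nrmV nrmX zr ler_wpM2r ?BP // invr_ge0 exprn_ge0 ?ltW.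
have := max_disk r0 _ _ npsi (ltW ar); rewrite nrmM nrmV nrmX => h.
have aN : 0 < nrm a ^+ N by rewrite exprn_gt0.
rewrite expr_div_n mulrA mulrAC -ler_pdivrMr //; apply: h => z zr.
  have [->|z0] := eqVneq z 0.
    apply: (@eq_cont_at _ _ _ (fun=> 0) _ _ d) => //; last exact: cont_at_cst.
    by move=> y; rewrite subr0 => /phi0; rewrite /psi => ->; rewrite mul0r.
  apply: cont_atM; first exact: cphi.
  by apply: cont_atV; [exact/cont_atX/cont_at_id|rewrite expf_neq0].
rewrite /psi mulf_eq0 negb_or invr_eq0 => /andP[pz zN].
apply: diffM; first exact: dphi.
by apply: diffV => //; exact/diffX/diffI.
Qed.

(** The maximum principle is applied to [g z * (g z / z) ^+ N], which is continuous at 0 because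
    [g z / z] is bounded there. On the circle of radius [r] it is at most [r ^- N]. If
    [x = nrm (g a)] exceeded [nrm a], then for [r] close to 1 this would give
    [x <= (nrm a / (r * x)) ^+ N] with ratio below 1. *)
Lemma schwarz_disk (g : C -> C) :
  (forall z, nrm z < 1 -> differentiable g z) ->
  (forall z, nrm z < 1 -> nrm (g z) <= 1) -> g 0 = 0 ->
  forall a, nrm a < 1 -> nrm (g a) <= nrm a.
Proof.
move=> dg g1 g0 a a1; rewrite leNgt; apply/negP => ag.
have [a0|a0] := eqVneq a 0; first by move: ag; rewrite a0 g0 ltxx.
have na : 0 < nrm a by rewrite nrm_gt0.
set x := nrm (g a) in ag.
have x0 : 0 < x by exact: lt_trans ag.
have [r [ar r1 rx]] : exists r : R, [/\ nrm a < r, r < 1 & nrm a < r * x].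
  have x1 : x <= 1 by exact: g1.
  have h : nrm a / x < 1 by rewrite ltr_pdivrMr // mul1r.
  exists ((nrm a / x + 1) / 2); split; last 2 first.
  - by lra.
  - by rewrite -ltr_pdivrMr //; lra.
  - have : nrm a <= nrm a / x by rewrite ler_pdivlMr // ger_pMr.
    by lra.
have r0 : 0 < r by exact: lt_trans ar.
suff : x <= 0 by lra.
apply: (@geometric_le0 _ (nrm a / (r * x)) 1).
- by rewrite divr_ge0 // ltW // mulr_gt0.
- by rewrite ltr_pdivrMr ?mulr_gt0 // mul1r.
move=> N; pose psi z := g z * (g z / z) ^+ N.
have npsi z : nrm z = r -> nrm (psi z) <= (r ^+ N)^-1.
  move=> zr; rewrite nrmM nrmX nrmM nrmV zr -[leRHS]mul1r.
  have gz : nrm (g z) <= 1 by apply: g1; rewrite zr.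
  apply: ler_pM => //; first exact: nrm_ge0.
    by rewrite exprn_ge0 // divr_ge0 ?nrm_ge0 // ltW.
  rewrite -exprVn; apply: lerXn2r; rewrite ?nnegrE ?divr_ge0 ?invr_ge0 ?nrm_ge0 ?(ltW r0) //.
  by rewrite -[leRHS]mul1r ler_wpM2r // invr_ge0 ltW.
have := max_disk r0 _ _ npsi (ltW ar); rewrite nrmM nrmX nrmM nrmV -/x => h.
have e1 : (nrm a / (r * x)) ^+ N = (r ^+ N)^-1 * ((x / nrm a) ^+ N)^-1.
  by rewrite -!exprVn -exprMn; congr (_ ^+ _); rewrite invf_div invfM; ring.
rewrite mul1r e1 ler_pdivlMr ?exprn_gt0 ?divr_gt0 //.
have dd z : nrm z < 1 -> z != 0 -> differentiable psi z.
  move=> z1 z0; apply: diffM; first exact: dg.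
  apply: diffX; apply: diffM; first exact: dg.
  by apply: diffV => //; exact: diffI.
apply: h => z zr; last first.
  move=> pz; have [z0|z0] := eqVneq z 0; last by apply: dd => //; exact: lt_trans r1.
  by move: pz; rewrite /psi z0 g0 mul0r eqxx.
have z1 : nrm z < 1 by exact: le_lt_trans r1.
have [->|z0] := eqVneq z 0; last exact/diff_cont_at/dd.
have dg0 := dg 0 _; rewrite nrm0 in dg0; have {}dg0 := dg0 ltr01.
have [k k0 kP] := diff_lipschitz dg0.
have [s s0 sP] := diff_nrmP dg0 ltr01.
have gl y : nrm y < s -> nrm (g y) <= (k + 1) * nrm y.
  move=> ys; have := sP y ys; rewrite add0r g0 subr0 mul1r => h1.
  have := nrmD (g y - 'd g 0 y) ('d g 0 y); rewrite subrK; have := kP y.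
  by lra.
have k1 : 0 < (k + 1) ^+ N by rewrite exprn_gt0 // addr_gt0.
move=> e e0; have [t t0 tP] := diff_cont_at dg0 (divr_gt0 e0 k1).
exists (Num.min s t); first by rewrite lt_min s0.
move=> y; rewrite subr0 lt_min => /andP[ys yt].
have := tP y; rewrite subr0 g0 subr0 => /(_ yt) gy.
rewrite /psi g0 !mul0r subr0 nrmM nrmX.
have q1 : nrm (g y / y) <= k + 1.
  have [->|y0] := eqVneq y 0; first by rewrite g0 mul0r nrm0; lra.
  by rewrite nrmM nrmV ler_pdivrMr ?nrm_gt0 ?gl.
apply: le_lt_trans (_ : nrm (g y) * (k + 1) ^+ N < _).
  apply: ler_wpM2l; first exact: nrm_ge0.
  by apply: lerXn2r; rewrite ?nnegrE ?nrm_ge0 //; lra.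
by rewrite -ltr_pdivlMr.
Qed.

End DiskEstimates.

(** * Cauchy estimates and second order remainders *)

Section SeveralVariables.
Context {R : realType}.
Local Notation C := R[i].
Implicit Types (V W : normedModType C).

Lemma eq_ler (x y : R) : x = y -> x <= y.
Proof. by move=> ->. Qed.

Lemma diff_dir_uniq V W (f : V -> W) x v w : differentiable f x ->
  (forall e : R, 0 < e -> exists2 d : R, 0 < d & forall t : R, 0 < t < d ->
     nrm (f (x + t%:C%C *: v) - f x - t%:C%C *: w) <= e * t) ->
  'd f x v = w.
Proof.
move=> df h; apply/eqP; rewrite -subr_eq0; apply/eqP/nrm_small => e e0.
have v1 : 0 < nrm v + 1 by rewrite ltr_wpDl ?nrm_ge0.
have [d1 d10 h1] := h _ (divr_gt0 e0 (ltr0Sn _ 1)).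
have [d2 d20 h2] := diff_nrmP df (divr_gt0 (divr_gt0 e0 (ltr0Sn _ 1)) v1).
pose t := Num.min (d1 / 2) (d2 / (nrm v + 1) / 2).
have t0 : 0 < t by rewrite lt_min !divr_gt0.
have t1 : t < d1 by rewrite gt_min ltr_pdivrMr // ltr_pMr // ltr1n.
have t2 : t * (nrm v + 1) < d2.
  rewrite -ltr_pdivlMr // gt_min [X in _ || X]ltr_pdivrMr // ltr_pMr ?divr_gt0 //.
  by rewrite ltr1n orbT.
have nt : nrm (t%:C%C : C) = t by rewrite nrm_real gtr0_norm.
have := h1 t; rewrite t0 t1 => /(_ isT) k1.
have := h2 (t%:C%C *: v); rewrite nrmZ nt linearZ.
have tv : t * nrm v <= t * (nrm v + 1) by rewrite ler_wpM2l ?lerDl ?(ltW t0).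
move=> /(_ (le_lt_trans tv t2)) k2.
rewrite -(ler_pM2l t0) -[X in X * _]nt -nrmZ.
rewrite (_ : _ *: _ = (f (x + t%:C%C *: v) - f x - t%:C%C *: w) -
   (f (x + t%:C%C *: v) - f x - t%:C%C *: 'd f x v)); last first.
  by rewrite scalerBr opprB addrACA [RHS]addrC addrA subrK addrC.
apply: le_trans (nrmD _ _) _; rewrite nrmN.
have : e / 2 / (nrm v + 1) * (t * nrm v) <= e / 2 * t.
  by rewrite mulrAC ler_pdivrMr // -[leRHS]mulrA ler_wpM2l ?divr_ge0 ?(ltW e0).
by lra.
Qed.

Lemma diff_line_at V W (f : V -> W) z v (a : C) : differentiable f (z + a *: v) ->
  'd (fun s : C => f (z + s *: v)) a 1 = 'd f (z + a *: v) v.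
Proof.
move=> df; apply: diff_dir_uniq; first exact: differentiable_line.
move=> e e0; have v1 : 0 < nrm v + 1 by rewrite ltr_wpDl ?nrm_ge0.
have [d d0 dP] := diff_nrmP df (divr_gt0 e0 v1).
exists (d / (nrm v + 1)); first by rewrite divr_gt0.
move=> t /andP[t0]; rewrite ltr_pdivlMr // => td.
have nt : nrm (t%:C%C : C) = t by rewrite nrm_real gtr0_norm.
rewrite -[t%:C%C *: 1]/(t%:C%C * 1) mulr1 -linearZ scalerDl addrA.
have := dP (t%:C%C *: v); rewrite nrmZ nt.
have tv : t * nrm v <= t * (nrm v + 1) by rewrite ler_wpM2l ?lerDl ?(ltW t0).
move=> /(_ (le_lt_trans tv td)) h; apply: le_trans h _.
by rewrite mulrAC ler_pdivrMr // -[leRHS]mulrA ler_wpM2l // ltW.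
Qed.

Lemma diff_line V W (f : V -> W) z v : differentiable f z ->
  'd (fun s : C => f (z + s *: v)) 0 1 = 'd f z v.
Proof.
have := @diff_line_at V W f z v 0; rewrite scale0r addr0; exact.
Qed.

(** Removing the first two terms of the Cauchy kernel leaves [a ^+ 2 / (z * (z - a))], and
    [nrm (z - a) >= r / 2] gives the factor [2 / r ^+ 2]. The mean of [g z / z] is thereby
    recognised as the derivative at 0. *)
Lemma taylor_disk (g : C -> C) (r M : R) : 0 < r ->
  (forall z, nrm z <= r -> differentiable g z) ->
  (forall z, nrm z = r -> nrm (g z) <= M) ->
  [/\ 'd g 0 1 = mean (fun w => g (r%:C%C * w) * (r%:C%C * w)^-1),
      nrm ('d g 0 1) <= M / r
    & forall a, nrm a <= r / 2 ->
      nrm (g a - g 0 - a * 'd g 0 1) <= 2 * M / r ^+ 2 * nrm a ^+ 2].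
Proof.
move=> r0 dg gM; set c1 := mean _.
have M0 : 0 <= M.
  by apply: le_trans (gM r%:C%C _); rewrite ?nrm_ge0 // nrm_real gtr0_norm.
have n0 (w : C) : nrm w = 1 -> r%:C%C * w != 0.
  by move=> w1; rewrite -nrm_gt0 nrm_polar // ltW.
have gb : circle_bound (fun w => g (r%:C%C * w)) M.
  by move=> w w1; rewrite gM // nrm_polar // ltW.
have cb : circle_bound (fun w => g (r%:C%C * w) * (r%:C%C * w)^-1) (M / r).
  move=> w w1; rewrite nrmM nrmV (nrm_polar (ltW r0) w1).
  by rewrite ler_wpM2r ?invr_ge0 ?(ltW r0) ?gb.
have rem a : nrm a <= r / 2 ->
    nrm (g a - g 0 - a * c1) <= 2 * M / r ^+ 2 * nrm a ^+ 2.
  move=> ar; have ar' : nrm a < r by lra.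
  rewrite -(cauchy_formula ar' dg) -(mean_value r0 dg).
  have na (w : C) : nrm w = 1 -> r / 2 <= nrm (r%:C%C * w - a).
    by move=> w1; have := nrmB_ge (r%:C%C * w) a; rewrite (nrm_polar (ltW r0) w1); lra.
  have na0 (w : C) : nrm w = 1 -> r%:C%C * w - a != 0.
    by move=> w1; rewrite -nrm_gt0; have := na w w1; lra.
  have kb : circle_bound (fun w => g (r%:C%C * w) *
      (r%:C%C * w / (r%:C%C * w - a))) (M * (r / (r / 2))).
    move=> w w1; rewrite nrmM [X in _ * X]nrmM nrmV (nrm_polar (ltW r0) w1).
    have w0 := na w w1; have r2 : 0 < r / 2 by lra.
    apply: ler_pM; rewrite ?gb ?nrm_ge0 //.
      by rewrite divr_ge0 ?nrm_ge0 // ltW.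
    by rewrite ler_pM2l // lef_pV2 ?posrE //; lra.
  have acb : circle_bound (fun w => a * (g (r%:C%C * w) * (r%:C%C * w)^-1))
      (nrm a * (M / r)).
    by move=> w w1; rewrite nrmM ler_wpM2l ?nrm_ge0 ?cb.
  rewrite -(meanB kb gb) -(meanZ a cb) -(@meanB _ _ _ (M * (r / (r / 2)) + M) _ _ acb).
    apply: nrm_mean => w w1.
    rewrite (_ : _ - _ = g (r%:C%C * w) * (a ^+ 2 /
       (r%:C%C * w * (r%:C%C * w - a)))); last first.
      have := n0 w w1; have := na0 w w1; move: (r%:C%C * w) => z h1 h2; field.
      by rewrite h1 h2.
    rewrite nrmM [X in _ * X]nrmM nrmV [X in X^-1]nrmM nrmX (nrm_polar (ltW r0) w1).
    have w0 := na w w1; have r2 : 0 < r / 2 by lra.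
    apply: le_trans (_ : M * (nrm a ^+ 2 / (r * (r / 2))) <= _).
      apply: ler_pM; rewrite ?gb ?nrm_ge0 //.
        by rewrite divr_ge0 ?sqr_ge0 // mulr_ge0 ?(ltW r0) ?nrm_ge0.
      rewrite ler_wpM2l ?sqr_ge0 // lef_pV2 ?posrE ?mulr_gt0 //; last by lra.
      by rewrite ler_pM2l.
    by apply: eq_ler; field; rewrite gt_eqF.
  by move=> w w1; apply: le_trans (nrmD _ _) _; rewrite nrmN lerD ?kb ?gb.
have dc : 'd g 0 1 = c1.
  apply: diff_dir_uniq; first by apply: dg; rewrite nrm0 ltW.
  move=> e e0; pose k := 2 * M / r ^+ 2.
  have k0 : 0 <= k by apply: divr_ge0; [exact: mulr_ge0|exact: sqr_ge0].
  have k1 : 0 < k + 1 by lra.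
  exists (Num.min (r / 2) (e / (k + 1))); first by rewrite lt_min !divr_gt0.
  move=> t; rewrite lt_min => /andP[t0 /andP[t1]]; rewrite ltr_pdivlMr // => t2.
  have nt : nrm (t%:C%C : C) = t by rewrite nrm_real gtr0_norm.
  rewrite add0r -[_ *: 1]/(t%:C%C * 1) mulr1 -[_ *: c1]/(t%:C%C * c1).
  apply: le_trans (rem _ _) _; first by rewrite nt ltW.
  rewrite nt -/k expr2 mulrA ler_pM2r //.
  by apply: le_trans (ltW t2); rewrite mulrC ler_pM2l // lerDl.
by rewrite dc; split => //; exact: nrm_mean.
Qed.

(** [taylor_disk] with radius [s / 2] along the unit vector of direction [v]. The constants depend
    on [s] and [M] only, which is what allows differentiation under the mean. *)
Lemma taylor_ball V (f : V -> C) z (s M : R) : 0 < s ->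
  (forall y, nrm (y - z) < s -> differentiable f y) ->
  (forall y, nrm (y - z) < s -> nrm (f y) <= M) ->
  (forall v, nrm ('d f z v) <= 2 * M / s * nrm v) /\
  (forall v, nrm v <= s / 4 ->
     nrm (f (z + v) - f z - 'd f z v) <= 8 * M / s ^+ 2 * nrm v ^+ 2).
Proof.
move=> s0 df fM; have dfz : differentiable f z by apply: df; rewrite subrr nrm0.
pose r := s / 2; have r0 : 0 < r by rewrite /r; lra.
suff H v : v != 0 -> nrm ('d f z v) <= 2 * M / s * nrm v /\ (nrm v <= s / 4 ->
    nrm (f (z + v) - f z - 'd f z v) <= 8 * M / s ^+ 2 * nrm v ^+ 2).
  split=> v; have [->|/H [] //] := eqVneq v 0; first by rewrite linear0 !nrm0 mulr0.
  by move=> _; rewrite addr0 subrr linear0 subr0 !nrm0 expr0n mulr0.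
move=> v0; have nv : 0 < nrm v by rewrite nrm_gt0.
have nvn : nrm ((nrm v)%:C%C : C) = nrm v by rewrite nrm_real gtr0_norm.
have nv0 : (nrm v)%:C%C != 0 :> C by rewrite -nrm_gt0 nvn.
pose u := (nrm v)%:C%C^-1 *: v.
have nu : nrm u = 1 by rewrite nrmZ nrmV nvn mulVf // gt_eqF.
have vE : v = (nrm v)%:C%C *: u by rewrite scalerA mulfV ?scale1r.
pose g (t : C) := f (z + t *: u).
have inb (t : C) : nrm t <= r -> nrm (z + t *: u - z) < s.
  by move=> tr; rewrite addrC addKr nrmZ nu mulr1; rewrite /r in tr r0; lra.
have dg (t : C) : nrm t <= r -> differentiable g t.
  by move=> tr; apply: differentiable_line; apply: df; exact: inb.
have gM (t : C) : nrm t = r -> nrm (g t) <= M.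
  by move=> tr; apply: fM; apply: inb; rewrite tr.
have [_ h1 h2] := taylor_disk r0 dg gM.
have dE : 'd g 0 1 = 'd f z u by exact: diff_line.
have dv : 'd f z v = (nrm v)%:C%C * 'd f z u by rewrite {1}vE linearZ.
rewrite dE in h1 h2; split.
  rewrite dv nrmM nvn mulrC ler_wpM2r ?nrm_ge0 //.
  apply: le_trans h1 _; apply: eq_ler; rewrite /r; field.
  by rewrite gt_eqF.
move=> vs; have := h2 (nrm v)%:C%C; rewrite nvn /g -vE scale0r addr0 -dv.
move=> h; apply: le_trans (h _) _; first by rewrite /r; lra.
by apply: eq_ler; rewrite /r; field; rewrite gt_eqF.
Qed.

End SeveralVariables.

(** * Means depending on a parameter and the identity theorem *)

Section Holomorphy.
Context {R : realType}.
Local Notation C := R[i].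
Implicit Types (V W : normedModType C).

(** Differentiation under the mean: the second order remainder of [taylor_ball] is uniform in [w],
    so the mean of the derivatives is the derivative of the mean. *)
Lemma mean_holo V (h : V -> C -> C) z (s M : R) : 0 < s ->
  (forall w, nrm w = 1 -> forall y, nrm (y - z) < s ->
     differentiable (fun y => h y w) y) ->
  (forall w, nrm w = 1 -> forall y, nrm (y - z) < s -> nrm (h y w) <= M) ->
  differentiable (fun y => mean (h y)) z.
Proof.
move=> s0 dh hM.
have M0 : 0 <= M.
  by apply: le_trans (hM 1 nrm1 z _); rewrite ?nrm_ge0 // subrr nrm0.
pose D v w := 'd (fun y => h y w) z v.
have T w : nrm w = 1 -> _ := fun w1 => taylor_ball s0 (dh w w1) (hM w w1).
have Db v : circle_bound (D v) (2 * M / s * nrm v).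
  by move=> w w1; have [h1 _] := T w w1; exact: h1.
pose df v := mean (D v).
have dfl : linear df.
  move=> a u v; have au : circle_bound (fun w => a * D u w) (nrm a * (2 * M / s * nrm u)).
    by move=> w w1; rewrite nrmM ler_wpM2l ?nrm_ge0 ?Db.
  rewrite /df -[a *: mean _]/(a * mean (D u)) -(meanZ a (Db u)) -(meanD au (Db v)).
  by apply: eq_mean => w _; rewrite /D linearP.
pose L : {linear V -> C} := HB.pack df (GRing.isLinear.Build _ _ _ _ df dfl).
suff : is_diff z (fun y => mean (h y)) L by case.
apply: (@nrm_diff _ _ _ _ _ _ (2 * M / s)) => [v|e e0].
  exact: nrm_mean.
pose k := 8 * M / s ^+ 2.
have k0 : 0 <= k by apply: divr_ge0; [exact: mulr_ge0|exact: sqr_ge0].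
have k1 : 0 < k + 1 by lra.
exists (Num.min (s / 4) (e / (k + 1))); first by rewrite lt_min !divr_gt0.
move=> v; rewrite lt_min => /andP[v1]; rewrite ltr_pdivlMr // => v2.
have hb y : nrm (y - z) < s -> circle_bound (h y) M.
  by move=> ys w w1; exact: hM.
have b1 : circle_bound (h (z + v)) M by apply: hb; rewrite addrC addKr; lra.
have b2 : circle_bound (h z) M by apply: hb; rewrite subrr nrm0.
have b12 : circle_bound (fun w => h (z + v) w - h z w) (M + M).
  by move=> w w1; apply: le_trans (nrmD _ _) _; rewrite nrmN lerD ?b1 ?b2.
rewrite -[L v]/(mean (D v)) -(meanB b1 b2) -(meanB b12 (Db v)).
apply: nrm_mean => w w1; have [_ h2] := T w w1.
apply: le_trans (h2 v (ltW v1)) _.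
rewrite expr2 mulrA ler_wpM2r ?nrm_ge0 //; apply: le_trans (ltW v2).
by rewrite mulrC ler_wpM2l ?nrm_ge0 // lerDl.
Qed.

(** Cauchy's formula writes the derivative along [v] as a mean of functions holomorphic in the base
    point. *)
Lemma deriv_holo V (f : V -> C) z v (s M : R) : 0 < s ->
  (forall y, nrm (y - z) < s -> differentiable f y) ->
  (forall y, nrm (y - z) < s -> nrm (f y) <= M) ->
  differentiable (fun y => 'd f y v) z.
Proof.
move=> s0 df fM; have v1 : 0 < nrm v + 1 by rewrite ltr_wpDl ?nrm_ge0.
pose r := s / 2 / (nrm v + 1).
have r0 : 0 < r by rewrite !divr_gt0.
have rv : r * nrm v < s / 2.
  by rewrite mulrAC ltr_pdivrMr // ltr_pM2l ?divr_gt0 // ltrDl.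
have inb (y : V) (t : C) : nrm (y - z) < s / 2 -> nrm t <= r ->
    nrm (y + t *: v - z) < s.
  move=> ys tr; rewrite addrAC; apply: le_lt_trans (nrmD _ _) _; rewrite nrmZ.
  have : nrm t * nrm v <= r * nrm v by rewrite ler_wpM2r ?nrm_ge0.
  by lra.
have wr (w : C) : nrm w = 1 -> nrm (r%:C%C * w) <= r.
  by move=> w1; rewrite nrm_polar // ltW.
pose h (y : V) (w : C) := f (y + (r%:C%C * w) *: v) * (r%:C%C * w)^-1.
apply: (@eq_near_differentiable _ _ _ (fun y => mean (h y)) _ _ (s / 2)).
- by lra.
- move=> y ys; pose g (t : C) := f (y + t *: v).
  have dg t : nrm t <= r -> differentiable g t.
    by move=> tr; apply: differentiable_line; apply: df; exact: inb.
  have gM t : nrm t = r -> nrm (g t) <= M.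
    by move=> tr; apply: fM; apply: inb => //; rewrite tr.
  have [<- _ _] := taylor_disk r0 dg gM.
  by apply: diff_line; apply: df; lra.
apply: (@mean_holo _ _ _ (s / 2) (M / r)); first by lra.
- move=> w w1 y ys; apply: diffM; last exact: diffC.
  apply: (@diff_compf _ _ _ _ (fun y => y + _) f).
    by apply: diffD; [exact: diffI|exact: diffC].
  by apply: df; apply: inb => //; exact: wr.
- move=> w w1 y ys; rewrite nrmM nrmV (nrm_polar (ltW r0) w1).
  by rewrite ler_wpM2r ?invr_ge0 ?(ltW r0) // fM // inb // wr.
Qed.

Lemma zero_line V (phi : V -> C) p q (r d : R) : 1 < r -> 0 < d ->
  (forall t : C, nrm t <= r -> cont_at phi (p + t *: (q - p))) ->
  (forall t : C, nrm t < r -> phi (p + t *: (q - p)) != 0 ->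
     differentiable phi (p + t *: (q - p))) ->
  (forall y, nrm (y - p) < d -> phi y = 0) -> phi q = 0.
Proof.
move=> r1 d0 cphi dphi phi0; pose g (t : C) := phi (p + t *: (q - p)).
have q1 : 0 < nrm (q - p) + 1 by rewrite ltr_wpDl ?nrm_ge0.
have <- : g 1 = phi q by rewrite /g scale1r addrC subrK.
apply: (@zero_disk R g r _ (divr_gt0 d0 q1)); last by rewrite nrm1.
- move=> t tr; apply: (@cont_at_comp _ _ _ _ (fun t : C => p + t *: (q - p)) phi).
    by apply: diff_cont_at; apply: (differentiable_line (f := fun y => y)); exact: diffI.
  exact: cphi.
- by move=> t tr pt; apply: differentiable_line; exact: dphi.
- move=> t; rewrite ltr_pdivlMr // => td; apply: phi0.
  rewrite addrC addKr nrmZ; apply: le_lt_trans td.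
  by rewrite ler_wpM2l ?nrm_ge0 // lerDl.
Qed.

(** The interior [Z] of the zero set is open, and relatively closed because a point near [Z] is
    joined to [Z] by a complex line on which [zero_line] applies. *)
Theorem identity_theorem V (U : set V) (phi : V -> C) p (d : R) :
  open U -> connected U -> (forall z, U z -> differentiable phi z) ->
  U p -> 0 < d -> (forall y, nrm (y - p) < d -> phi y = 0) ->
  forall z, U z -> phi z = 0.
Proof.
move=> oU cU dphi Up d0 phi0.
pose Z := [set x | exists2 e : R, 0 < e & forall y, nrm (y - x) < e -> phi y = 0].
have oZ : open Z.
  apply/open_nrmP => x [e e0 eP]; exists (e / 2); first by rewrite divr_gt0.
  move=> y yx; exists (e / 2); first by rewrite divr_gt0.
  move=> y' y'y; apply: eP; have := nrmD (y' - y) (y - x).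
  by rewrite addrA subrK; lra.
suff UZ : U `&` Z = U.
  by move=> z; rewrite -UZ => -[_ [e e0]]; apply; rewrite subrr nrm0.
apply: cU; first by exists p; split => //; exists d.
  by exists Z.
exists (closure Z); first exact: closed_closure.
apply/seteqP; split => x [Ux]; first by move=> Zx; split => //; exact: subset_closure.
move=> clx; split => //.
move/open_nrmP: oU => /(_ x Ux) [s s0 sU].
(* [q] is within [t] of [x] and [y] within [2 t] of [q], so the disc of radius [3 / 2] on the line
   from [q] to [y] stays within [4 t = s] of [x]. *)
pose t := s / 4; have t0 : 0 < t by rewrite /t; lra.
have [q [[e e0 eP]]] : Z `&` [set y | nrm (y - x) < t] !=set0.
  by apply: clx; apply/nbhs_nrmP; exists t.
rewrite /= => qx; exists t => // y yx.
have yq : nrm (y - q) < 2 * t.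
  by have := nrmD (y - x) (x - q); rewrite addrA subrK (nrm_distC x); lra.
have inU (a : C) : nrm a <= 3 / 2 -> U (q + a *: (y - q)).
  move=> a32; apply: sU; rewrite addrAC; apply: le_lt_trans (nrmD _ _) _.
  rewrite nrmZ; have : nrm a * nrm (y - q) <= 3 / 2 * nrm (y - q).
    by rewrite ler_wpM2r ?nrm_ge0.
  by rewrite /t in qx yq *; lra.
apply: (@zero_line _ _ q y (3 / 2) e) => //; first by lra.
  by move=> a a32; apply/diff_cont_at/dphi/inU.
by move=> a a32 _; apply/dphi/inU/ltW.
Qed.

End Holomorphy.

(** * Injective holomorphic maps *)

Section Jacobian.
Context {R : realType} {n : nat}.
Local Notation C := R[i].
Local Notation V := 'rV[C]_n.
Implicit Types (f : V -> V) (U : set V) (A : 'M[C]_n).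

Lemma nrm_mulmx A : exists2 k : R, 0 < k & forall v : V, nrm (v *m A) <= k * nrm v.
Proof.
pose k := \sum_i \sum_j nrm (A i j).
have k0 : 0 <= k by apply: sumr_ge0 => i _; apply: sumr_ge0 => j _; exact: nrm_ge0.
exists (k + 1) => [|v]; first by lra.
apply: nrm_rowle => [|j]; first by rewrite mulr_ge0 ?nrm_ge0 //; lra.
rewrite mxE; apply: le_trans (nrm_sum _ _ _) _.
apply: le_trans (_ : \sum_i nrm v * nrm (A i j) <= _).
  by apply: ler_sum => i _; rewrite nrmM ler_wpM2r ?nrm_ge0 ?nrm_coord.
rewrite -mulr_sumr mulrC ler_wpM2r ?nrm_ge0 //.
apply: le_trans (_ : k <= _); last by lra.
apply: ler_sum => i _; rewrite (bigD1 j) //= lerDl.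
by apply: sumr_ge0 => j' _; exact: nrm_ge0.
Qed.

Lemma diff_coord (W : normedModType C) (f : W -> V) x i : differentiable f x ->
  differentiable (fun y => f y ord0 i) x.
Proof.
move=> df; apply: (@diff_compf _ _ _ _ f (fun v : V => v ord0 i)) => //.
exact: differentiable_coord.
Qed.

Lemma diff_coordE (W : normedModType C) (f : W -> V) x i v : differentiable f x ->
  'd (fun y => f y ord0 i) x v = 'd f x v ord0 i.
Proof.
move=> df; apply: diff_dir_uniq; first exact: diff_coord.
move=> e e0; have v1 : 0 < nrm v + 1 by rewrite ltr_wpDl ?nrm_ge0.
have [d d0 dP] := diff_nrmP df (divr_gt0 e0 v1).
exists (d / (nrm v + 1)); first by rewrite divr_gt0.
move=> t /andP[t0]; rewrite ltr_pdivlMr // => td.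
have nt : nrm (t%:C%C : C) = t by rewrite nrm_real gtr0_norm.
have := dP (t%:C%C *: v); rewrite nrmZ nt.
have tv : t * nrm v <= t * (nrm v + 1) by rewrite ler_wpM2l ?lerDl ?(ltW t0).
move=> /(_ (le_lt_trans tv td)) h.
have := le_trans (nrm_coord _ i) h; rewrite linearZ !mxE => h1.
apply: le_trans h1 _.
by rewrite mulrAC ler_pdivrMr // -[leRHS]mulrA ler_wpM2l // ltW.
Qed.

Lemma linear_is_diff (W W' : normedModType C) (L : {linear W -> W'}) (k : R) x :
  (forall v, nrm (L v) <= k * nrm v) -> is_diff x L L.
Proof.
move=> Lk; apply: (nrm_diff Lk) => e e0; exists 1 => // v _.
by rewrite linearD [L x + _]addrC addrK subrr nrm0 mulr_ge0 ?nrm_ge0 // ltW.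
Qed.

Lemma diff_bounded (W W' : normedModType C) (f : W -> W') x : cont_at f x ->
  exists2 d : R, 0 < d & forall y, nrm (y - x) < d -> nrm (f y) <= nrm (f x) + 1.
Proof.
move=> /(_ 1 ltr01) [d d0 dP]; exists d => // y /dP h.
by have := nrmD (f y - f x) (f x); rewrite subrK; lra.
Qed.

Lemma open_ball U x : open U -> U x -> exists2 d : R, 0 < d &
  forall y, nrm (y - x) < d -> U y.
Proof. by move=> /open_nrmP; apply. Qed.

Lemma deriv_holo_open U (f : V -> C) z v : open U ->
  (forall y, U y -> differentiable f y) -> U z ->
  differentiable (fun y => 'd f y v) z.
Proof.
move=> oU df Uz; have [d d0 dU] := open_ball oU Uz.
have [d' d'0 fM] := diff_bounded (diff_cont_at (df z Uz)).
apply: (@deriv_holo _ _ f z v (Num.min d d') (nrm (f z) + 1)).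
- by rewrite lt_min d0.
- by move=> y; rewrite lt_min => /andP[/dU Uy _]; exact: df.
- by move=> y; rewrite lt_min => /andP[_ /fM].
Qed.

(** The transpose of the usual Jacobian matrix: vectors are rows, and linear maps act by
    multiplication on the right. *)
Definition jac f x : 'M[C]_n := \matrix_(i, j) 'd f x (delta_mx ord0 i) ord0 j.

Lemma jacE f x (v : V) : 'd f x v = v *m jac f x.
Proof.
rewrite {1}[v]row_sum_delta linear_sum; apply/rowP => j.
rewrite summxE [RHS]mxE; apply: eq_bigr => i _.
by rewrite linearZ [RHS]/= !mxE.
Qed.

Lemma diff_bigsum I (r : seq I) (P : pred I) (W : normedModType C)
    (F : I -> W -> C) x : (forall i, P i -> differentiable (F i) x) ->
  differentiable (fun y => \sum_(i <- r | P i) F i y) x.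
Proof.
move=> dF; elim: r => [|i r IH].
  rewrite (_ : (fun _ => _) = fun=> 0); first exact: diffC.
  by apply/funext => y; rewrite big_nil.
case Pi : (P i).
  rewrite (_ : (fun _ => _) = fun y => F i y + \sum_(j <- r | P j) F j y).
    by apply: diffD => //; exact: dF.
  by apply/funext => y; rewrite big_cons Pi.
by rewrite (_ : (fun _ => _) = fun y => \sum_(j <- r | P j) F j y) //;
  apply/funext => y; rewrite big_cons Pi.
Qed.

Lemma diff_bigprod I (r : seq I) (P : pred I) (W : normedModType C)
    (F : I -> W -> C) x : (forall i, P i -> differentiable (F i) x) ->
  differentiable (fun y => \prod_(i <- r | P i) F i y) x.
Proof.
move=> dF; elim: r => [|i r IH].
  rewrite (_ : (fun _ => _) = fun=> 1); first exact: diffC.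
  by apply/funext => y; rewrite big_nil.
case Pi : (P i).
  rewrite (_ : (fun _ => _) = fun y => F i y * \prod_(j <- r | P j) F j y).
    by apply: diffM => //; exact: dF.
  by apply/funext => y; rewrite big_cons Pi.
by rewrite (_ : (fun _ => _) = fun y => \prod_(j <- r | P j) F j y) //;
  apply/funext => y; rewrite big_cons Pi.
Qed.

Lemma det_jac_holo U f z : open U -> (forall y, U y -> differentiable f y) -> U z ->
  differentiable (fun y => \det (jac f y)) z.
Proof.
move=> oU df Uz; apply: diff_bigsum => s _; apply: diffM; first exact: diffC.
apply: diff_bigprod => i _.
have [d d0 dU] := open_ball oU Uz.
apply: (@eq_near_differentiable R V C
  (fun y : V => ('d (fun y : V => f y ord0 (s i)) y : V -> C) (delta_mx ord0 i))
  (fun y : V => jac f y i (s i)) z d d0).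
  by move=> y /dU Uy; rewrite mxE diff_coordE //; exact: df.
by apply: (deriv_holo_open _ oU) => // y Uy; apply: diff_coord; exact: df.
Qed.

(** The remainder [g] is [O(t ^ 2)] on a ball of radius [2 t]; Cauchy's estimate on balls of radius
    [t] bounds its derivative by [O(t)], so [g] has a small Lipschitz constant. The order of the
    quantifiers gives one [d] for all coordinates of a map. *)
Lemma strict_diff_coord (s M e : R) : 0 < s -> 0 <= M -> 0 < e ->
  exists2 d : R, 0 < d & d < s /\ forall (f : V -> C) z,
    (forall y, nrm (y - z) < s -> differentiable f y) ->
    (forall y, nrm (y - z) < s -> nrm (f y) <= M) ->
    forall x y, nrm (x - z) < d -> nrm (y - z) < d ->
      nrm (f x - f y - 'd f z (x - y)) <= e * nrm (x - y).
Proof.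
move=> s0 M0 e0; pose K := 8 * M / s ^+ 2.
have K0 : 0 <= K by apply: divr_ge0; [exact: mulr_ge0|exact: sqr_ge0].
have K1 : 0 < 16 * (K + 1) by lra.
pose t := Num.min (s / 16) (e / (16 * (K + 1))).
have t0 : 0 < t by rewrite lt_min !divr_gt0.
have t1 : t <= s / 16 by rewrite ge_min lexx.
have t2 : t * (16 * (K + 1)) <= e.
  by rewrite -ler_pdivlMr // ge_min lexx orbT.
exists (t / 8); first by lra.
split=> [|f z df fM x y xz yz]; first by lra.
pose g y := f y - f z - 'd f z (y - z).
have dz : differentiable f z by apply: df; rewrite subrr nrm0.
have dLin u : differentiable ('d f z : V -> C) u.
  by have [k _ kP] := diff_lipschitz dz; have [] := linear_is_diff u kP.
have dg u : nrm (u - z) < s -> differentiable g u.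
  move=> us; apply: diffB; first by apply: diffB; [exact: df|exact: diffC].
  apply: (@diff_compf _ V V C (fun y => y - z) ('d f z : V -> C)).
    by apply: diffB; [exact: diffI|exact: diffC].
  exact: dLin.
have [_ Kq] := taylor_ball s0 df fM.
have gb u : nrm (u - z) < 2 * t -> nrm (g u) <= 4 * K * t ^+ 2.
  move=> us; have := Kq (u - z); rewrite (addrC z) subrK => h.
  apply: le_trans (h _) _; first by lra.
  rewrite -/K; have : nrm (u - z) ^+ 2 <= (2 * t) ^+ 2.
    by apply: lerXn2r; rewrite ?nnegrE ?nrm_ge0 //; lra.
  by move=> h2; have := ler_wpM2l K0 h2; lra.
have by_ u : nrm (u - y) < t -> nrm (u - z) < 2 * t.
  by move=> ut; have := nrmD (u - y) (y - z); rewrite addrA subrK; lra.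
have ts : 2 * t < s by lra.
have [h1 h2] := @taylor_ball _ _ g y t _ t0
  (fun u ut => dg u (lt_trans (by_ u ut) ts))
  (fun u ut => gb u (by_ u ut)).
have xy : nrm (x - y) <= t / 4.
  by have := nrmD (x - z) (z - y); rewrite addrA subrK (nrm_distC z); lra.
have := h2 (x - y) xy; have := h1 (x - y); rewrite (addrC y) subrK.
have -> : f x - f y - 'd f z (x - y) = g x - g y.
  have l1 u v : 'd f z (u - v) = 'd f z u - 'd f z v by exact: linearB.
  rewrite /g !l1; move: (f x) (f y) (f z) ('d f z x) ('d f z y) ('d f z z).
  by move=> a b c p q r; ring.
move=> k1 k2.
have := nrmD (g x - g y - 'd g y (x - y)) ('d g y (x - y)); rewrite subrK => k3.
have N0 := nrm_ge0 (x - y).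
have E1 : 2 * (4 * K * t ^+ 2) / t = 8 * K * t by field; rewrite gt_eqF.
have E2 : 8 * (4 * K * t ^+ 2) / t ^+ 2 = 32 * K by field; rewrite gt_eqF.
rewrite E1 in k1; rewrite E2 in k2.
have k4 : 32 * K * nrm (x - y) ^+ 2 <= 8 * K * t * nrm (x - y).
  rewrite expr2 mulrA ler_wpM2r //.
  by have := ler_wpM2l K0 xy; lra.
have k5 : 16 * K * t * nrm (x - y) <= e * nrm (x - y).
  by rewrite ler_wpM2r //; lra.
by lra.
Qed.

Lemma strict_diff U f z : open U -> (forall y, U y -> differentiable f y) -> U z ->
  forall e : R, 0 < e -> exists2 d : R, 0 < d & forall x y,
    nrm (x - z) < d -> nrm (y - z) < d ->
    nrm (f x - f y - (x - y) *m jac f z) <= e * nrm (x - y).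
Proof.
move=> oU df Uz e e0; have [d1 d10 dU] := open_ball oU Uz.
have [d2 d20 fM] := diff_bounded (diff_cont_at (df z Uz)).
pose s := Num.min d1 d2.
have s0 : 0 < s by rewrite lt_min d10.
have M0 : 0 <= nrm (f z) + 1 by have := nrm_ge0 (f z); lra.
have [d d0 [_ dP]] := strict_diff_coord s0 M0 e0.
exists d => // x y xz yz; apply: nrm_rowle.
  by rewrite mulr_ge0 ?nrm_ge0 // ltW.
move=> i; have := dP (fun y => f y ord0 i) z _ _ x y xz yz.
rewrite diff_coordE; last exact: df.
rewrite jacE !mxE => h; apply: h => u; rewrite lt_min => /andP[h1 h2].
  by apply: diff_coord; apply: df; exact: dU.
by apply: le_trans (nrm_coord _ _) _; exact: fM.
Qed.

End Jacobian.

(** * Inverse function theorem *)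

Section LocalInverse.
Context {R : realType} {n : nat}.
Local Notation C := R[i].
Local Notation V := 'rV[C]_n.
Implicit Types (f g : V -> V) (U : set V).

Lemma compact_cball (p : V) (d : R) : compact [set x | nrm (x - p) <= d].
Proof.
apply: subclosed_compact (@compact_nrm_ball R n (d + nrm p)) _.
  exact: closed_nrm_le.
by move=> x /= xp; have := nrmD (x - p) p; rewrite subrK; lra.
Qed.

Lemma cont_at_sub (W W' : normedModType C) (f : W -> W') x c :
  cont_at f x -> cont_at (fun y => f y - c) x.
Proof. by move=> cf; apply: cont_atD => //; exact: cont_at_cst. Qed.

(* At an interior minimum of [nrm (f x - y)] either [f x = y] or the Jacobian matrix is
   singular. *)
Lemma almost_onto U f p (d : R) : (forall y, U y -> differentiable f y) -> 0 < d ->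
  (forall x, nrm (x - p) <= d -> U x) ->
  (forall x, nrm (x - p) = d -> f x != f p) ->
  exists2 m : R, 0 < m & (forall x, nrm (x - p) = d -> 2 * m <= nrm (f x - f p)) /\
    forall y, nrm (y - f p) < m ->
      exists2 x, nrm (x - p) < d & f x = y \/ \det (jac f x) = 0.
Proof.
move=> df d0 dU fS.
have cf x c : nrm (x - p) <= d -> cont_at (fun y => (nrm (f y - c))%:C%C) x.
  by move=> xd; apply/cont_at_nrm/cont_at_sub/diff_cont_at/df/dU.
have [m m0 mP] : exists2 m : R, 0 < m &
    forall x, nrm (x - p) = d -> 2 * m <= nrm (f x - f p).
  have [[x0 x0S]|nS] := pselect ([set x | nrm (x - p) = d] !=set0); last first.
    by exists 1 => // x xS; exfalso; apply: nS; exists x.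
  have cS : compact [set x | nrm (x - p) = d].
    apply: subclosed_compact (@compact_cball p d) _ => [|x /= -> //].
    rewrite (_ : [set _ | _] =
        [set x | nrm (x - p) <= d] `&` ~` [set x | nrm (x - p) < d]).
      apply: closedI; first exact: closed_nrm_le.
      exact/open_closedC/open_nrm_lt.
    apply/seteqP; split => z /=; first by move=> ->; rewrite ltxx.
    by move=> [h /negP]; rewrite -leNgt => h'; apply/eqP; rewrite eq_le h.
  have [||x xS xP] := @compact_argmin _ _ _ (fun x => nrm (f x - f p)) _ cS.
  - by exists x0.
  - move=> x xS e e0; have [|r r0 rP] := cf x (f p) _ e e0; first by rewrite xS.
    by exists r => // y _ /rP; rewrite -rmorphB nrm_real.
  exists (nrm (f x - f p) / 2) => [|y yS].
    by rewrite divr_gt0 // nrm_gt0 subr_eq0 fS.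
  by rewrite mulrC divfK ?pnatr_eq0 //; exact: xP.
exists m => //; split => // y ym.
have [|||x xd xP] := @compact_argmin _ _ [set x | nrm (x - p) <= d]
   (fun x => nrm (f x - y)).
- by exists p; rewrite /= subrr nrm0 ltW.
- exact: compact_cball.
- move=> x xd e e0; have [r r0 rP] := cf x y xd e e0.
  by exists r => // u _ /rP; rewrite -rmorphB nrm_real.
have xp : nrm (f x - y) < m.
  apply: le_lt_trans (xP p _) _; first by rewrite /= subrr nrm0 ltW.
  by rewrite nrm_distC.
have {}xd : nrm (x - p) < d.
  rewrite lt_neqAle xd andbT; apply/eqP => /mP.
  by have := nrmD (f x - y) (y - f p); rewrite addrA subrK; lra.
exists x => //; have [|fxy] := eqVneq (f x) y; first by left.
right; apply/eqP/negPn/negP => detJ; set J := jac f x in detJ.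
have Ju : J \in unitmx by rewrite unitmxE unitfE.
have fxy0 : 0 < nrm (f x - y) by rewrite nrm_gt0 subr_eq0.
(* The Newton direction: moving by [t *: v] multiplies [f x - y] by [1 - t] up to an error
   [e * t * nrm v], and [e] is chosen so that this is less than the gain [t * nrm (f x - y)]. This
   contradicts minimality. *)
pose v := - ((f x - y) *m invmx J).
have vJ : 'd f x v = - (f x - y) by rewrite jacE -/J mulNmx mulmxKV.
have v1 : 0 < nrm v + 1 by rewrite ltr_wpDl ?nrm_ge0.
pose e := nrm (f x - y) / (2 * (nrm v + 1)).
have e0 : 0 < e by rewrite divr_gt0 // mulr_gt0.
have [r r0 rP] := diff_nrmP (df x (dU x (ltW xd))) e0.
have xd0 : 0 < d - nrm (x - p) by rewrite subr_gt0.
have [t [t0 t1 tr td]] : exists t : R, [/\ 0 < t, t <= 1, t * (nrm v + 1) < r &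
    t * (nrm v + 1) < d - nrm (x - p)].
  exists (Num.min 1 (Num.min (r / (nrm v + 1) / 2) ((d - nrm (x - p)) / (nrm v + 1) / 2))).
  split.
  - by rewrite !lt_min ltr01 !divr_gt0.
  - by rewrite ge_min lexx.
  - rewrite -ltr_pdivlMr // !gt_min; apply/orP; right; apply/orP; left.
    by rewrite ltr_pdivrMr // ltr_pMr ?divr_gt0 // ltr1n.
  - rewrite -ltr_pdivlMr // !gt_min; apply/orP; right; apply/orP; right.
    by rewrite ltr_pdivrMr // ltr_pMr ?divr_gt0 // ltr1n.
have nt : nrm (t%:C%C : C) = t by rewrite nrm_real gtr0_norm.
have tv : t * nrm v <= t * (nrm v + 1) by rewrite ler_wpM2l ?lerDl ?(ltW t0).
have := rP (t%:C%C *: v); rewrite nrmZ nt linearZ /= vJ => /(_ (le_lt_trans tv tr)) h1.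
have : nrm (f x - y) <= nrm (f (x + t%:C%C *: v) - y).
  apply: xP; rewrite /= addrAC; apply: le_trans (nrmD _ _) _.
  by rewrite nrmZ nt; lra.
apply/negP; rewrite -ltNge.
have -> : f (x + t%:C%C *: v) - y =
    (f (x + t%:C%C *: v) - f x - t%:C%C *: - (f x - y)) + (1 - t)%:C%C *: (f x - y).
  by apply/rowP => i; rewrite rmorphB rmorph1 !mxE; ring.
apply: le_lt_trans (nrmD _ _) _; rewrite nrmZ nrm_real ger0_norm ?subr_ge0 //.
have : e * (t * nrm v) < t * nrm (f x - y).
  rewrite mulrCA ltr_pM2l // /e mulrAC ltr_pdivrMr ?mulr_gt0 //.
  by rewrite ltr_pM2l //; have := nrm_ge0 v; lra.
by lra.
Qed.

(** If [k] bounds the inverse of the Jacobian matrix, the linear part expands by at least [1 / k];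
    strict differentiability with error [1 / (2 k)] leaves half of it. *)
Lemma regular_lower U f z : open U -> (forall y, U y -> differentiable f y) -> U z ->
  \det (jac f z) != 0 -> exists2 c : R, 0 < c & exists2 d : R, 0 < d &
    forall x y, nrm (x - z) < d -> nrm (y - z) < d ->
      c * nrm (x - y) <= nrm (f x - f y).
Proof.
move=> oU df Uz detJ; set J := jac f z in detJ.
have Ju : J \in unitmx by rewrite unitmxE unitfE.
have [k k0 kP] := nrm_mulmx (invmx J).
have e0 : 0 < (2 * k)^-1 by rewrite invr_gt0 mulr_gt0.
have [d d0 dP] := strict_diff oU df Uz e0.
exists (2 * k)^-1 => //; exists d => // x y xz yz.
have := kP ((x - y) *m J); rewrite mulmxK // => h1.
have := dP x y xz yz; rewrite -/J => h2.
have := nrmD ((x - y) *m J - (f x - f y)) (f x - f y); rewrite subrK nrm_distC => h3.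
have h4 : nrm (x - y) / (2 * k) * 2 <= nrm ((x - y) *m J).
  rewrite [leLHS](_ : _ = nrm (x - y) / k); last by field; rewrite gt_eqF.
  by rewrite ler_pdivrMr // mulrC.
by rewrite mulrC in h2 *; lra.
Qed.

(** Put [u = g (f x + v) - x], which is small by continuity. The expansion of [f] at [x] gives
    [u = v *m invmx J] up to a small multiple of [nrm u], whence [nrm u <= 2 * k * nrm v] and the
    error is small compared with [v]. *)
Lemma inverse_diff f g x (r : R) : differentiable f x -> \det (jac f x) != 0 ->
  g (f x) = x -> 0 < r -> (forall y, nrm (y - f x) < r -> f (g y) = y) ->
  cont_at g (f x) -> differentiable g (f x) /\
  forall v, 'd g (f x) v = v *m invmx (jac f x).
Proof.
move=> df detJ gf r0 fg cg; set J := jac f x in detJ *.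
have Ju : J \in unitmx by rewrite unitmxE unitfE.
have [k k0 kP] := nrm_mulmx (invmx J).
have H : is_diff (f x) g (mulmxr (invmx J) : V -> V).
  apply: (@nrm_diff _ _ _ _ _ (mulmxr (invmx J)) k) => [v|e e0]; first exact: kP.
  have [e1 [e10 e11 e12]] : exists e1 : R,
      [/\ 0 < e1, k * e1 <= 1 / 2 & 2 * k ^+ 2 * e1 <= e].
    have k20 : 0 < 2 * k ^+ 2 by rewrite mulr_gt0 ?exprn_gt0.
    exists (Num.min (1 / 2 / k) (e / (2 * k ^+ 2))); split.
    - by rewrite lt_min !divr_gt0.
    - by rewrite mulrC -ler_pdivlMr // ge_min lexx.
    - by rewrite mulrC -ler_pdivlMr // ge_min lexx orbT.
  have [d d0 dP] := diff_nrmP df e10.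
  have [s s0 sP] := cg d d0.
  exists (Num.min r s); first by rewrite lt_min r0.
  move=> v; rewrite lt_min => /andP[vr vs].
  have fgv : f (g (f x + v)) = f x + v by apply: fg; rewrite addrC addKr.
  have := sP (f x + v); rewrite addrC addKr => /(_ vs); rewrite gf => us.
  rewrite ?gf /=; set u := g (f x + v) - x in us *.
  have xu : x + u = g (f x + v) by rewrite /u addrC subrK.
  have := dP u us; rewrite xu fgv jacE -/J [f x + v]addrC addrK => h1.
  have h2 : nrm (u - v *m invmx J) <= k * (e1 * nrm u).
    rewrite -[u in leLHS](mulmxK Ju) -mulmxBl; apply: le_trans (kP _) _.
    by rewrite ler_pM2l // nrm_distC.
  have h3 : nrm u <= 2 * k * nrm v.
    have := nrmD (u - v *m invmx J) (v *m invmx J); rewrite subrK.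
    have := kP v; have := ler_wpM2r (nrm_ge0 u) e11; lra.
  apply: le_trans h2 _.
  have : k * e1 * nrm u <= k * e1 * (2 * k * nrm v).
    by rewrite ler_wpM2l // mulr_ge0 ?ltW.
  by have := ler_wpM2r (nrm_ge0 v) e12; lra.
split=> [|v]; first by case: H.
by have [_ ->] := H.
Qed.

(** On a small ball the determinant does not vanish, so [almost_onto] yields true preimages;
    [regular_lower] makes the choice of them continuous, and [inverse_diff] makes it
    differentiable. *)
Theorem local_inverse U f z : open U -> (forall y, U y -> differentiable f y) ->
  U z -> \det (jac f z) != 0 ->
  exists g : V -> V, exists2 r : R, 0 < r &
    forall y, nrm (y - f z) < r -> [/\ f (g y) = y, U (g y),
      \det (jac f (g y)) != 0, differentiable g y &
      forall v, 'd g y v = v *m invmx (jac f (g y))].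
Proof.
move=> oU df Uz detJ.
have [c c0 [d1 d10 lb]] := regular_lower oU df Uz detJ.
have [d2 d20 dU] := open_ball oU Uz.
have := diff_cont_at (det_jac_holo oU df Uz).
have np : 0 < nrm (\det (jac f z)) by rewrite nrm_gt0.
move=> /(_ _ np) [d3 d30 dP].
pose d := Num.min d1 (Num.min d2 d3) / 2.
have d0 : 0 < d by rewrite divr_gt0 // !lt_min d10 d20.
have [dd1 dd2 dd3] : [/\ d < d1, d < d2 & d < d3].
  have : d < Num.min d1 (Num.min d2 d3).
    by rewrite /d ltr_pdivrMr // ltr_pMr ?ltr1n // !lt_min d10 d20.
  by rewrite !lt_min => /andP[-> /andP[]].
have [||m m0 [_ mP]] := @almost_onto U f z d df d0.
- by move=> x xd; apply: dU; lra.
- move=> x xd; have := lb x z; rewrite subrr nrm0 xd => /(_ dd1 d10) h.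
  rewrite -subr_eq0 -nrm_gt0; apply: lt_le_trans h; exact: mulr_gt0.
have dreg x : nrm (x - z) < d -> \det (jac f x) != 0.
  move=> xd; apply/eqP => h; have h1 := dP x (lt_trans xd dd3).
  have : nrm (0 - \det (jac f z)) < nrm (\det (jac f z)) by rewrite -{1}h.
  by rewrite sub0r nrmN ltxx.
have gP y : exists x, nrm (y - f z) < m -> nrm (x - z) < d /\ f x = y.
  have [ym|] := pselect (nrm (y - f z) < m); last by exists z.
  have [x xd [fx|/eqP]] := mP y ym; first by exists x.
  by rewrite (negbTE (dreg x xd)).
have [g {}gP] := choice gP.
exists g; exists m; first exact: m0.
move=> y ym; have [gd fg] := gP y ym.
have gU : U (g y) by apply: dU; lra.
have fgn : forall u, nrm (u - f (g y)) < m - nrm (y - f z) -> f (g u) = u.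
  rewrite fg => u uy; have [] // := gP u.
  by have := nrmD (u - y) (y - f z); rewrite addrA subrK; lra.
have cg : cont_at g (f (g y)).
  move=> e e0; exists (Num.min (c * e) (m - nrm (y - f z))).
    by rewrite lt_min mulr_gt0 // subr_gt0.
  move=> u; rewrite fg lt_min => /andP[ue um].
  have [] := gP u; first by have := nrmD (u - y) (y - f z); rewrite addrA subrK; lra.
  move=> ud fu; have := lb (g u) (g y) (lt_trans ud dd1) (lt_trans gd dd1).
  by rewrite fu fg => h; rewrite -(ltr_pM2l c0); lra.
have [] := inverse_diff (df _ gU) (dreg _ gd) (congr1 g fg) _ fgn cg.
  by rewrite subr_gt0.
by rewrite fg => h1 h2; split; [exact: erefl|exact: gU|exact: dreg|exact: h1|exact: h2].
Qed.

End LocalInverse.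

(** * Regular points of an injective map *)

Section RegularPoints.
Context {R : realType} {n : nat}.
Local Notation C := R[i].
Local Notation V := 'rV[C]_n.
Implicit Types (f g : V -> V) (U : set V).

(** Cut the segment from 0 to [t] into [N] steps. With no first order term each increment is at most
    [K * (a / N) ^+ 2], so the total is at most [K * a ^+ 2 / N]. *)
Lemma deriv0_const (g : C -> C) (r : R) :
  (forall t, nrm t < r -> differentiable g t) ->
  (forall t, nrm t < r -> 'd g t 1 = 0) -> forall t, nrm t < r -> g t = g 0.
Proof.
move=> dg g'0 t tr; set a := nrm t in tr; have a0 : 0 <= a by exact: nrm_ge0.
pose s := (r - a) / 2; have s0 : 0 < s by rewrite /s; lra.
have as0 : 0 < a + s by lra.
have asr : a + s < r by rewrite /s; lra.
have [M M0 MS] : exists2 M : R, 0 <= M & forall z, nrm z = a + s -> nrm (g z) <= M.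
  apply: circle_sup => [|z zr]; first exact: ltW.
  by apply: diff_cont_at; apply: dg; rewrite zr.
have gM z : nrm z <= a + s -> nrm (g z) <= M.
  apply: max_disk => // x xs; first by apply: diff_cont_at; apply: dg; lra.
  by move=> _; apply: dg; lra.
pose K := 8 * M / s ^+ 2.
have K0 : 0 <= K by apply: divr_ge0; [exact: mulr_ge0|exact: sqr_ge0].
have step x v : nrm x <= a -> nrm v <= s / 4 -> nrm (g (x + v) - g x) <= K * nrm v ^+ 2.
  move=> xa vs; have inb y : nrm (y - x) < s -> nrm y < a + s.
    by move=> yx; have := nrmD (y - x) x; rewrite subrK; lra.
  have dgx y : nrm (y - x) < s -> differentiable g y.
    by move=> /inb ys; apply: dg; lra.
  have [_ h] := taylor_ball s0 dgx (fun y ys => gM y (ltW (inb y ys))).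
  have := h v vs; rewrite (_ : 'd g x v = 0) ?subr0 //.
  have {1}-> : v = v *: (1 : C) by rewrite -[_ *: _]/(v * 1) mulr1.
  by rewrite linearZ /= g'0 ?scaler0 //; lra.
apply/eqP; rewrite -subr_eq0; apply/eqP/nrm_small => e e0.
have s4 : 0 < s / 4 by lra.
have [N N0 [Ns Ne]] : exists2 N, (0 < N)%N & a / N%:R <= s / 4 /\ K * a ^+ 2 / N%:R <= e.
  have h1 := archi_boundP (divr_ge0 a0 (ltW (divr_gt0 s0 (ltr0Sn R 3)))).
  have h2 := archi_boundP (divr_ge0 (mulr_ge0 K0 (sqr_ge0 a)) (ltW e0)).
  set N1 := Num.bound _ in h1; set N2 := Num.bound _ in h2.
  exists (N1 + N2).+1 => //.
  have Nr : 0 < (N1 + N2).+1%:R :> R by rewrite ltr0n.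
  rewrite !ler_pdivrMr // [_ * _%:R]mulrC [e * _]mulrC -!ler_pdivrMr //.
  split; [apply: le_trans (ltW h1) _|apply: le_trans (ltW h2) _].
    by rewrite ler_nat -addnS leq_addr.
  by rewrite ler_nat -addSn leq_addl.
have NR : 0 < N%:R :> R by rewrite ltr0n.
have ind j : (j <= N)%N ->
    nrm (g ((j%:R / N%:R)%:C%C * t) - g 0) <= j%:R * (K * (a / N%:R) ^+ 2).
  elim: j => [_|j IH jN].
    by rewrite !mul0r subrr nrm0.
  have E : (j.+1%:R / N%:R)%:C%C * t = (j%:R / N%:R)%:C%C * t + (N%:R^-1)%:C%C * t.
    by rewrite -mulrDl -rmorphD -[j.+1]addn1 natrD mulrDl mul1r.
  have nN : nrm ((N%:R^-1)%:C%C * t) = a / N%:R.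
    by rewrite nrmM nrm_real gtr0_norm ?invr_gt0 // mulrC.
  have nj : nrm ((j%:R / N%:R)%:C%C * t) <= a.
    rewrite nrmM nrm_real ger0_norm ?divr_ge0 ?ler0n // -/a.
    rewrite -[leRHS]mul1r ler_wpM2r // ler_pdivrMr // mul1r ler_nat.
    exact: ltnW.
  have := step _ ((N%:R^-1)%:C%C * t) nj; rewrite nN -E => /(_ Ns) h1.
  have := IH (ltnW jN); set u := g _ in h1 *; set v := g _ in h1 * => h2.
  have := nrmD (u - v) (v - g 0); rewrite addrA subrK.
  by rewrite -[j.+1]addn1 natrD mulrDl mul1r; lra.
have := ind N (leqnn N); rewrite divff ?gt_eqF // mul1r => h.
apply: le_trans h _; apply: le_trans Ne; apply: eq_ler.
by field; rewrite gt_eqF.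
Qed.

Lemma jacP f x (A : 'M[C]_n) :
  (forall e : R, 0 < e -> exists2 d : R, 0 < d & forall v, nrm v < d ->
    nrm (f (x + v) - f x - v *m A) <= e * nrm v) ->
  differentiable f x /\ jac f x = A.
Proof.
move=> fA; have [k k0 kP] := nrm_mulmx A.
have [df dE] : is_diff x f (mulmxr A : V -> V).
  exact: (@nrm_diff R V V f x (mulmxr A) k kP fA).
split => //; apply/matrixP => i j; rewrite mxE dE /= -rowE.
by rewrite mxE.
Qed.

Lemma jac_affine f x (A B : 'M[C]_n) : differentiable f x ->
  differentiable (fun y => y *m A + f y *m B) x /\
  jac (fun y => y *m A + f y *m B) x = A + jac f x *m B.
Proof.
move=> df; apply: jacP => e e0.
have [k k0 kP] := nrm_mulmx B.
have [d d0 dP] := diff_nrmP df (divr_gt0 e0 k0).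
exists d => // v /dP h.
have -> : (x + v) *m A + f (x + v) *m B - (x *m A + f x *m B) -
    v *m (A + jac f x *m B) = (f (x + v) - f x - v *m jac f x) *m B.
  rewrite !mulmxBl mulmxDl mulmxDr mulmxA.
  move: (x *m A) (v *m A) (f (x + v) *m B) (f x *m B) (v *m jac f x *m B).
  by move=> a b c p q; apply/rowP => i; rewrite !mxE; ring.
rewrite -jacE; apply: le_trans (kP _) _; apply: le_trans (ler_wpM2l (ltW k0) h) _.
by rewrite mulrA mulrCA divff ?gt_eqF // mulr1.
Qed.

(* Near a point where the rank of the Jacobian is maximal and less than [n], [f] would
   be constant along a curve. *)
Theorem regular_exists U f p : open U -> (forall y, U y -> differentiable f y) ->
  set_inj U f -> U p -> exists2 x, U x & \det (jac f x) != 0.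
Proof.
move=> oU df injf Up; apply: contrapT => nreg.
have sing x : U x -> \det (jac f x) = 0.
  by move=> Ux; apply/eqP/negPn/negP => h; apply: nreg; exists x.
pose P k := `[< exists2 x, U x & \rank (jac f x) = k >].
have exP : exists k, P k by exists (\rank (jac f p)); apply/asboolP; exists p.
have ubP k : P k -> (k <= n)%N by move=> /asboolP[x _ <-]; exact: rank_leq_row.
have [k /asboolP[q Uq rq] kmax] := ex_maxnP exP ubP.
have rk x : U x -> (\rank (jac f x) <= k)%N.
  by move=> Ux; apply: kmax; apply/asboolP; exists x.
have kn : (k < n)%N.
  rewrite ltn_neqAle ubP ?andbT; last by apply/asboolP; exists q.
  apply/eqP => kn; have : row_free (jac f q) by rewrite /row_free rq kn.
  by rewrite row_free_unit unitmxE unitfE sing // eqxx.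
set M := jac f q in rq.
pose L := col_ebase M; pose Rm := row_ebase M.
(* Gaussian elimination gives [M = L *m pid_mx k *m Rm]. Hence [M *m A2 = L *m pid_mx k], and [A1]
   completes it to the invertible matrix [L]: [H] combines [k] independent components of [f] with
   [n - k] linear coordinates. *)
pose A1 := L *m copid_mx k; pose A2 := invmx Rm *m (pid_mx k : 'M[C]_n).
pose H (x : V) := x *m A1 + f x *m A2.
have dH x : U x -> differentiable H x by move=> /df /(jac_affine A1 A2)[].
have jH x : U x -> jac H x = A1 + jac f x *m A2.
  by move=> /df /(jac_affine A1 A2)[].
have pidk : (pid_mx k : 'M[C]_n) *m (pid_mx k : 'M[C]_n) = (pid_mx k : 'M[C]_n).
  have := @mul_pid_mx C n n n k k; rewrite minnn (minn_idPr _) ?(ltnW kn) //; exact.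
have jHq : jac H q = L.
  rewrite jH // /A1 /A2 -/M -[X in X *m (invmx _ *m _)](mulmx_ebase M) rq -/L -/Rm.
  rewrite !mulmxA mulmxK ?row_ebase_unit // -!mulmxA pidk -mulmxDr.
  by rewrite /copid_mx subrK mulmx1.
have Lu : \det (jac H q) != 0.
  by rewrite jHq -unitfE -unitmxE; exact: col_ebase_unit.
have [g [r r0 gP]] := local_inverse oU dH Uq Lu.
(* The first basis vector killed by [pid_mx k]; it exists because [k < n]. *)
pose e : V := delta_mx ord0 (Ordinal kn).
have epid : e *m (pid_mx k : 'M[C]_n) = 0.
  by rewrite /e -rowE; apply/rowP => j; rewrite !mxE ltnn andbF.
have e_neq0 : e != 0.
  apply/eqP => /rowP /(_ (Ordinal kn)); rewrite !mxE !eqxx /= => /eqP.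
  by rewrite oner_eq0.
have ne : 0 < nrm e by rewrite nrm_gt0.
have inr (t : C) : nrm t < r / nrm e -> nrm (H q + t *: e - H q) < r.
  by move=> tr; rewrite addrC addKr nrmZ -ltr_pdivlMr.
(* The curve along which [H] moves in direction [e]; [f] is constant on it. *)
pose X (t : C) := g (H q + t *: e).
(* From [w *m jac H x = e], multiplication by [pid_mx k] gives [w *m J *m A2 = 0]. Since [jac H x]
   is invertible, [J *m A2] has rank at least [k], the maximal rank of [J]; so both have the same
   left kernel and [w *m J = 0]. *)
have kerE x w : U x -> \det (jac H x) != 0 -> w *m jac H x = e -> w *m jac f x = 0.
  move=> Ux; set J := jac f x; rewrite (jH x Ux) -/J => detH we.
  have wJA : w *m (J *m A2) = 0.
    have A1p : A1 *m (pid_mx k : 'M[C]_n) = 0.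
      have c0 := @mul_copid_mx_pid C n n k (ltnW kn).
      by rewrite /A1 -mulmxA c0 mulmx0.
    have A2p : A2 *m (pid_mx k : 'M[C]_n) = A2 by rewrite /A2 -mulmxA pidk.
    have := congr1 (mulmx^~ (pid_mx k : 'M[C]_n)) we.
    by rewrite epid -mulmxA mulmxDl A1p add0r -mulmxA A2p.
  have JA : (kermx J <= kermx (J *m A2))%MS.
    by apply/sub_kermxP; rewrite mulmxA mulmx_ker mul0mx.
  have rJA : (k <= \rank (J *m A2))%N.
    have : \rank (A1 + J *m A2)%R = n.
      have : row_free (A1 + J *m A2) by rewrite row_free_unit unitmxE unitfE.
      by rewrite /row_free => /eqP.
    have := mxrank_add A1 (J *m A2) => h1 h2; rewrite h2 in h1.
    have : (\rank A1 <= n - k)%N.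
      apply: leq_trans (mxrankM_maxr _ _) _.
      by rewrite rank_copid_mx // ltnW.
    have kn' := ltnW kn; move: h1 kn'; move: (\rank A1) (\rank (J *m A2)) => a b.
    by clear; lia.
  have [_ eqk] := mxrank_leqif_sup JA.
  have : (kermx (J *m A2) <= kermx J)%MS.
    rewrite -eqk !mxrank_ker; have := rk x Ux; rewrite -/J => rJ.
    have := mxrankM_maxl J A2 => h.
    apply/eqP; congr (n - _)%N; apply/eqP; rewrite eqn_leq h andbT.
    exact: leq_trans rJ rJA.
  move=> kk; apply/sub_kermxP; apply: submx_trans kk.
  exact/sub_kermxP.
have dF t i : nrm t < r / nrm e ->
    differentiable (fun t : C => f (X t) ord0 i) t /\ 'd (fun t : C => f (X t) ord0 i) t 1 = 0.
  move=> /inr /gP [HX UX detX dgX dgE].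
  have dfg : differentiable (f \o g) (H q + t *: e).
    exact: (@differentiable_comp C V V V g f _ dgX (df _ UX)).
  have dl : differentiable (fun t : C => f (X t)) t by exact: (differentiable_line dfg).
  split; first exact: diff_coord.
  have E1 : 'd (fun t : C => f (X t)) t (1 : C) = 'd (f \o g) (H q + t *: e) e.
    exact: (diff_line_at dfg).
  have E2 := @derive.diff_comp C V V V g f _ dgX (df _ UX).
  have E3 : 'd (f \o g) (H q + t *: e) e = 'd f (X t) ('d g (H q + t *: e) e).
    exact: (congr1 (fun h : V -> V => h e) E2).
  have E4 : 'd f (X t) ('d g (H q + t *: e) e) = 0.
    rewrite jacE; apply: (kerE _ _ UX detX); rewrite dgE.
    by apply: mulmxKV; rewrite unitmxE unitfE.
  have := @diff_coordE R n C (fun t : C => f (X t)) t i 1 dl.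
  by move=> ->; rewrite E1 E3 E4 mxE.
have [t0 tr0] : exists2 t : C, t != 0 & nrm t < r / nrm e.
  exists (r / nrm e / 2)%:C%C.
    by rewrite -nrm_gt0 nrm_real normr_gt0 gt_eqF // !divr_gt0.
  rewrite nrm_real gtr0_norm ?divr_gt0 //.
  by rewrite ltr_pdivrMr // ltr_pMr ?ltr1n ?divr_gt0.
move=> tr.
have z0 : nrm (0 : C) < r / nrm e by rewrite nrm0 divr_gt0.
have ff : f (X t0) = f (X 0).
  apply/rowP => i; apply: (@deriv0_const (fun t : C => f (X t) ord0 i) (r / nrm e)) => //.
    by move=> t /dF - /(_ i)[].
  by move=> t /dF - /(_ i)[].
have [H1 U1 _ _ _] := gP _ (inr _ tr); have [H0 U0 _ _ _] := gP _ (inr _ z0).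
have XX : X t0 = X 0 by apply: injf; rewrite ?inE.
move: H1; rewrite -/(X t0) XX /X H0 => /addrI /eqP.
by rewrite scale0r eq_sym scaler_eq0 (negbTE tr0) (negbTE e_neq0).
Qed.

End RegularPoints.

(** * Openness and the inverse of an injective map *)

Section Openness.
Context {R : realType} {n : nat}.
Local Notation C := R[i].
Local Notation V := 'rV[C]_n.
Implicit Types (f g : V -> V) (U : set V).

Lemma closed_nrm_ge (p : V) (e : R) : closed [set x | e <= nrm (x - p)].
Proof.
rewrite (_ : [set _ | _] = ~` [set x | nrm (x - p) < e]).
  exact/open_closedC/open_nrm_lt.
by apply/seteqP; split => x /=; rewrite leNgt => /negP.
Qed.

(** On the compact part of [K] at distance at least [e] from [x], the distance from [f y] to [f x]
    has a positive minimum. *)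
Lemma compact_inverse_cont (K : set V) f x : compact K ->
  (forall y, K y -> cont_at f y) -> (forall y, K y -> f y = f x -> y = x) ->
  forall e : R, 0 < e -> exists2 d : R, 0 < d &
    forall y, K y -> nrm (f y - f x) < d -> nrm (y - x) < e.
Proof.
move=> cK cf fx e e0; pose K' := K `&` [set y | e <= nrm (y - x)].
have cK' : compact K' by apply: compact_closedI => //; exact: closed_nrm_ge.
have [[y0 y0K]|nK] := pselect (K' !=set0); last first.
  exists 1 => // y Ky _; rewrite ltNge; apply/negP => h.
  by apply: nK; exists y.
have [||c [Kc cx] cP] := @compact_argmin R V K' (fun y => nrm (f y - f x)) _ cK'.
- by exists y0.
- move=> y [Ky _] s s0.
  have cy : cont_at (fun y => (nrm (f y - f x))%:C%C) y.
    by apply/cont_at_nrm/cont_at_sub/cf.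
  have [r r0 rP] := cy s s0.
  by exists r => // u _ /rP; rewrite -rmorphB nrm_real.
exists (nrm (f c - f x)).
  rewrite nrm_gt0 subr_eq0; apply/eqP => /fx h.
  by move: cx; rewrite /= h // subrr nrm0; lra.
move=> y Ky h; rewrite ltNge; apply/negP => yx.
by have := cP y (conj Ky yx); lra.
Qed.

(* [Phi], the Jacobian determinant transported by the inverse and set to 0 off the
   image, is continuous, and holomorphic off its zeros. A value missed near [f p] makes
   it vanish on an open set, hence along all lines through that set; but there are
   regular points near [p]. *)
Theorem inj_open_at U f p (d : R) : open U -> (forall y, U y -> differentiable f y) ->
  set_inj U f -> 0 < d -> (forall x, nrm (x - p) <= d -> U x) ->
  exists2 r : R, 0 < r & forall y, nrm (y - f p) < r ->
    exists2 x, nrm (x - p) < d & f x = y.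
Proof.
move=> oU df injf d0 dU.
have inj x y : U x -> U y -> f x = f y -> x = y.
  by move=> Ux Uy; apply: injf; rewrite inE.
have Up : U p by apply: dU; rewrite subrr nrm0 ltW.
have Ub x : nrm (x - p) < d -> U x by move=> /ltW /dU.
have [|m m0 [mS mP]] := almost_onto df d0 dU.
  move=> x xd; have Ux : U x by apply: dU; rewrite xd.
  by apply/eqP => fx; move: xd; rewrite (inj x p Ux Up fx) subrr nrm0; lra.
pose Im y := exists2 x, nrm (x - p) < d & f x = y.
have gP y : exists x, Im y -> nrm (x - p) < d /\ f x = y.
  by have [[x xd fx]|h] := pselect (Im y); [exists x|exists p].
have [g {}gP] := choice gP.
have gf x : nrm (x - p) < d -> g (f x) = x.
  move=> xd; have [gd fg] := gP _ (ex_intro2 _ _ x xd erefl).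
  by apply: inj => //; exact: Ub.
pose Delta x := \det (jac f x).
pose Phi y := if `[< Im y >] then Delta (g y) else 0.
have PhiE x : nrm (x - p) < d -> Phi (f x) = Delta x.
  by move=> xd; rewrite /Phi asboolT ?gf //; exists x.
have cball := @compact_cball R n p d.
have dDelta x : nrm (x - p) < d -> differentiable Delta x.
  by move=> /Ub Ux; exact: (det_jac_holo oU df Ux).
(* The image of the closed ball is compact and misses [y]: the sphere is mapped too far away by
   [mS]. So a whole neighbourhood of [y] is missed. *)
have Phi_off y : ~ Im y -> nrm (y - f p) < m ->
    exists2 e : R, 0 < e & forall u, nrm (u - y) < e -> Phi u = 0.
  move=> nIm ym.
  have [|||c cd cP] := @compact_argmin R V [set x | nrm (x - p) <= d]
      (fun x => nrm (f x - y)).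
  - by exists p; rewrite /= subrr nrm0 ltW.
  - exact: cball.
  - move=> x xd e e0; have cx : cont_at (fun x => (nrm (f x - y))%:C%C) x.
      by apply/cont_at_nrm/cont_at_sub/diff_cont_at/df/dU.
    have [r r0 rP] := cx e e0.
    by exists r => // u _ /rP; rewrite -rmorphB nrm_real.
  exists (nrm (f c - y)).
    rewrite nrm_gt0 subr_eq0; apply/eqP => fc; apply: nIm; exists c => //.
    rewrite lt_neqAle cd andbT; apply/eqP => /mS; rewrite fc; lra.
  move=> u uy; rewrite /Phi asboolF // => -[x xd fx].
  by have := cP x (ltW xd); rewrite fx; lra.
have Phi_reg x : nrm (x - p) < d -> Delta x != 0 -> differentiable Phi (f x).
  move=> xd Dx.
  have ob : open [set x | nrm (x - p) < d] by exact: open_nrm_lt.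
  have [h [r r0 hP]] := local_inverse ob (fun y yd => df y (Ub y yd)) xd Dx.
  have fx0 : nrm (f x - f x) < r by rewrite subrr nrm0.
  have [fh hd Dh dh _] := hP _ fx0.
  apply: (@eq_near_differentiable R V C (fun y => Delta (h y)) Phi (f x) r r0).
    by move=> y /hP[fhy hyd _ _ _]; rewrite -[in RHS]fhy PhiE.
  apply: (@diff_compf R V V C h Delta _ dh); exact: dDelta.
(* The delicate points are the images of zeros of [Delta]: nearby values are either missed, where
   [Phi] is 0, or taken close to [x], where [Delta] is small. *)
have cPhi y : nrm (y - f p) < m -> cont_at Phi y.
  move=> ym; have [[x xd fx]|nIm] := pselect (Im y); last first.
    have [e e0 eP] := Phi_off y nIm ym.
    apply: (@eq_cont_at R V C (fun=> 0) Phi y e e0); last exact: cont_at_cst.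
    by move=> u /eP.
  rewrite -fx; have [Dx|Dx] := eqVneq (Delta x) 0; last exact/diff_cont_at/Phi_reg.
  move=> e e0; rewrite PhiE // Dx.
  have [s s0 sP] := diff_cont_at (dDelta x xd) e0.
  have [||r r0 rP] := @compact_inverse_cont [set x | nrm (x - p) <= d] f x cball _ _ s s0.
  - by move=> u ud; apply/diff_cont_at/df/dU.
  - by move=> u ud; apply: inj; [exact: dU|exact: Ub].
  exists r => // u ur; rewrite subr0 /Phi; case: asboolP; last by rewrite nrm0.
  move=> /gP[gd fg]; have := sP (g u); rewrite Dx subr0; apply.
  by apply: rP; [exact: ltW|rewrite fg].
have dPhi y : nrm (y - f p) < m -> Phi y != 0 -> differentiable Phi y.
  move=> ym; rewrite /Phi; case: asboolP; last by rewrite eqxx.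
  by move=> /gP[gd fg] Dg; rewrite -fg; exact: Phi_reg.
(* [y1] and [f x0] lie within [m / 8] of [f p], so the disc of radius [3 / 2] on the line joining
   them stays within [m / 8 + 3 / 2 * (m / 4) < m]. *)
have m8 : 0 < m / 8 by lra.
exists (m / 8) => // y1 y1m; apply: contrapT => nIm.
have [|e e0 eP] := Phi_off y1 nIm; first lra.
have [d' d'0 d'P] := diff_cont_at (df p Up) m8.
have [x0 x0d Dx0] : exists2 x, nrm (x - p) < Num.min d d' & Delta x != 0.
  apply: (@regular_exists R n [set x | nrm (x - p) < Num.min d d'] f p).
  - exact: open_nrm_lt.
  - by move=> x /=; rewrite lt_min => /andP[/Ub Ux _]; exact: df.
  - move=> x y; rewrite !inE /= !lt_min => /andP[xd _] /andP[yd _].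
    by apply: inj; exact: Ub.
  - by rewrite /= subrr nrm0 lt_min d0.
move: x0d; rewrite lt_min => /andP[x0d /d'P y0m].
move: Dx0; rewrite -PhiE // => /eqP; apply.
have inW (t : C) : nrm t <= 3 / 2 -> nrm (y1 + t *: (f x0 - y1) - f p) < m.
  move=> t32; rewrite addrAC; apply: le_lt_trans (nrmD _ _) _; rewrite nrmZ.
  have y01 : nrm (f x0 - y1) < m / 4.
    by have := nrmD (f x0 - f p) (f p - y1); rewrite addrA subrK (nrm_distC (f p)); lra.
  have : nrm t * nrm (f x0 - y1) <= 3 / 2 * nrm (f x0 - y1).
    by rewrite ler_wpM2r ?nrm_ge0.
  lra.
apply: (@zero_line R V Phi y1 (f x0) (3 / 2) e) => //; first by lra.
  by move=> t t32; apply: cPhi; exact: inW.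
by move=> t t32; apply: dPhi; apply: inW; exact: ltW.
Qed.

Lemma inj_open_image U f : open U -> (forall y, U y -> differentiable f y) ->
  set_inj U f -> open (f @` U).
Proof.
move=> oU df injf; apply/open_nrmP => _ [p Up <-].
have [d d0 dU] := open_ball oU Up; have d2 : 0 < d / 2 by lra.
have [|r r0 rP] := @inj_open_at U f p (d / 2) oU df injf d2.
  by move=> x xd; apply: dU; lra.
exists r => // y /rP[x xd <-]; exists x => //; apply: dU; lra.
Qed.

(* [Phi] is the Jacobian determinant transported by the inverse [g]; as in the
   proof of openness it stands in for the fact that it never vanishes. *)
Theorem inj_inverse U f : open U -> (forall y, U y -> differentiable f y) ->
  set_inj U f -> exists (g : V -> V) (Phi : V -> C),
  [/\ forall x, U x -> g (f x) = x,
      forall y, (f @` U) y -> cont_at g y,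
      forall y, (f @` U) y -> cont_at Phi y,
      forall y, (f @` U) y -> Phi y != 0 -> differentiable g y /\ differentiable Phi y
    & forall y, (f @` U) y -> forall e : R, 0 < e ->
        exists2 y', (f @` U) y' & nrm (y' - y) < e /\ Phi y' != 0].
Proof.
move=> oU df injf.
have inj x y : U x -> U y -> f x = f y -> x = y.
  by move=> Ux Uy; apply: injf; rewrite inE.
have gP y : exists x, (f @` U) y -> U x /\ f x = y.
  have [[x Ux fx]|h] := pselect ((f @` U) y); [by exists x|].
  by exists 0.
have [g {}gP] := choice gP.
have gf x : U x -> g (f x) = x.
  by move=> Ux; have [|Ug fg] := gP (f x); [exists x|exact: inj].
pose Delta x := \det (jac f x).
have dDelta x : U x -> differentiable Delta x by move=> Ux; exact: (det_jac_holo oU df Ux).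
have cg y : (f @` U) y -> cont_at g y.
  move=> [x Ux <-] e e0; have [d d0 dU] := open_ball oU Ux.
  pose s := Num.min (d / 2) (e / 2).
  have [s0 sd se] : [/\ 0 < s, s < d & s < e].
    split; first by rewrite lt_min !divr_gt0.
      by rewrite gt_min; apply/orP; left; lra.
    by rewrite gt_min; apply/orP; right; lra.
  have [|r r0 rP] := @inj_open_at U f x s oU df injf s0.
    by move=> u us; apply: dU; lra.
  exists r => // y' /rP[x' x's <-].
  by rewrite !gf //; [lra|apply: dU; lra].
exists g, (fun y => Delta (g y)); split => //.
- move=> y Uy; apply: (@cont_at_comp R V V C g Delta); first exact: cg.
  by have [Ug _] := gP y Uy; exact/diff_cont_at/dDelta.
- move=> y Uy Dg; have [Ug fg] := gP y Uy.
  have [r r0 rP] : exists2 r : R, 0 < r & forall u, nrm (u - f (g y)) < r -> f (g u) = u.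
    have /open_nrmP /(_ y Uy) [r r0 rP] := inj_open_image oU df injf.
    by exists r => // u; rewrite fg => /rP /gP[].
  have cgy : cont_at g (f (g y)) by rewrite fg; exact: cg.
  have [dg _] := inverse_diff (df _ Ug) Dg (congr1 g fg) r0 rP cgy.
  rewrite fg in dg; split; first exact: dg.
  by apply: (@diff_compf R V V C g Delta y dg); exact: dDelta.
- move=> _ [x Ux <-] e e0; have [d d0 dU] := open_ball oU Ux.
  have [d' d'0 d'P] := diff_cont_at (df x Ux) e0.
  have [x0 x0d Dx0] : exists2 u, nrm (u - x) < Num.min d d' & Delta u != 0.
    apply: (@regular_exists R n [set u | nrm (u - x) < Num.min d d'] f x).
    - exact: open_nrm_lt.
    - by move=> u /=; rewrite lt_min => /andP[/dU Uu _]; exact: df.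
    - move=> u v; rewrite !inE /= !lt_min => /andP[/dU ud _] /andP[/dU vd _].
      exact: inj.
    - by rewrite /= subrr nrm0 lt_min d0.
  move: x0d; rewrite lt_min => /andP[/dU Ux0 /d'P y0].
  by exists (f x0); [exists x0|rewrite gf].
Qed.

End Openness.

(** * Gauges *)

Section Gauge.
Context {R : realType} {n : nat}.
Local Notation C := R[i].
Local Notation V := 'rV[C]_n.
Implicit Types (N : V -> R) (Om : set V).

(** A complex norm kept as a plain real-valued function together with its equivalence to [nrm]. For
    the Minkowski function, [gauge_le] comes from openness of the domain and [gauge_ge] from
    boundedness. *)
Record gauge_norm N : Prop := GaugeNorm {
  gauge_ge0 : forall z, 0 <= N z;
  gaugeD : forall z w, N (z + w) <= N z + N w;
  gaugeZ : forall (a : C) z, N (a *: z) = nrm a * N z;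
  gauge_le : exists2 k : R, 0 < k & forall z, N z <= k * nrm z;
  gauge_ge : exists2 k : R, 0 < k & forall z, nrm z <= k * N z }.

Lemma gauge0 N : gauge_norm N -> N 0 = 0.
Proof. by move=> gN; rewrite -(scale0r (0 : V)) gaugeZ // nrm0 mul0r. Qed.

Lemma gaugeN N z : gauge_norm N -> N (- z) = N z.
Proof. by move=> gN; rewrite -scaleN1r gaugeZ // nrmN nrm1 mul1r. Qed.

Lemma gauge_eq0 N z : gauge_norm N -> N z = 0 -> z = 0.
Proof.
move=> gN Nz; have [k k0 kP] := gauge_ge gN; apply: nrm_le0.
by have := kP z; rewrite Nz mulr0.
Qed.

Lemma gaugeB_ge N z w : gauge_norm N -> N z - N w <= N (z - w).
Proof. by move=> gN; have := gaugeD gN (z - w) w; rewrite subrK; lra. Qed.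

Lemma gauge_real N (t : R) z : gauge_norm N -> 0 <= t -> N (t%:C%C *: z) = t * N z.
Proof. by move=> gN t0; rewrite gaugeZ // nrm_real ger0_norm. Qed.

Lemma gauge_cont N z : gauge_norm N -> cont_at (fun y => (N y)%:C%C) z.
Proof.
move=> gN e e0; have [k k0 kP] := gauge_le gN.
exists (e / k); first by rewrite divr_gt0.
move=> y; rewrite ltr_pdivlMr // mulrC => yz; rewrite -rmorphB nrm_real.
rewrite ltr_norml; have := gaugeB_ge y z gN; have := gaugeB_ge z y gN.
by have := kP (y - z); rewrite -(opprB y z) gaugeN //; lra.
Qed.

Lemma minkowski_nonempty Om z : is_domain Om -> balanced Om ->
  [set s : R | 0 < s /\ Om (s%:C%C^-1 *: z)] !=set0.
Proof.
move=> [oOm _ [w Omw]] bOm.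
have Om0 : Om 0 by rewrite -(scale0r w); apply: bOm => //; rewrite normr0.
have [e e0 eP] := open_ball oOm Om0.
have z1 : 0 < nrm z + 1 by rewrite ltr_wpDl ?nrm_ge0.
have s0 : 0 < (nrm z + 1) / e by rewrite divr_gt0.
exists ((nrm z + 1) / e); split => //; apply: eP.
rewrite subr0 nrmZ nrmV nrm_real gtr0_norm // invf_div mulrAC.
by rewrite ltr_pdivrMr // ltr_pM2l // ltrDl.
Qed.

Lemma minkowski_ge0 Om z : is_domain Om -> balanced Om -> 0 <= minkowski_fun Om z.
Proof.
move=> dOm bOm; apply: lb_le_inf; first exact: minkowski_nonempty.
by move=> s [/ltW].
Qed.

Lemma minkowski_ltP Om : is_domain Om -> balanced Om ->
  forall z (t : R), 0 < t -> (minkowski_fun Om z < t <-> Om (t%:C%C^-1 *: z)).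
Proof.
move=> dOm bOm z t t0; have [oOm _ _] := dOm.
pose A := [set s : R | 0 < s /\ Om (s%:C%C^-1 *: z)].
have scaleOm (s u : R) : 0 < s -> s <= u -> Om (s%:C%C^-1 *: z) -> Om (u%:C%C^-1 *: z).
  move=> s0 su Os; have u0 : 0 < u by lra.
  have -> : u%:C%C^-1 *: z = (s / u)%:C%C *: (s%:C%C^-1 *: z).
    rewrite scalerA rmorphM fmorphV mulrAC mulfV ?mul1r //.
    by rewrite -nrm_gt0 nrm_real gtr0_norm.
  apply: bOm => //; rewrite nrmE nrm_real -[1]/(1%:C%C) lecR.
  rewrite ger0_norm; last by rewrite divr_ge0 // ltW.
  by rewrite ler_pdivrMr // mul1r.
have A0 : A !=set0 by exact: minkowski_nonempty.
have Alb : lbound A 0 by move=> s [/ltW].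
split.
  move=> /(inf_lt A0)[s [s0 Os] st].
  exact: (scaleOm s t s0 (ltW st) Os).
move=> Ot; have [e e0 eP] := open_ball oOm Ot.
have z1 : 0 < nrm z + 1 by rewrite ltr_wpDl ?nrm_ge0.
(* Replacing [t] by [t / (1 + d)] moves the scaled point by [d / t * nrm z], which is less than the
   radius [e] of a ball contained in [Om]. *)
pose d := e * t / (nrm z + 1); have d0 : 0 < d by rewrite divr_gt0 // mulr_gt0.
pose s := t / (1 + d); have d1 : 0 < 1 + d by lra.
have s0 : 0 < s by rewrite divr_gt0.
have st : s < t by rewrite ltr_pdivrMr // ltr_pMr // ltrDl.
apply: le_lt_trans st; apply: ge_inf; first by exists 0.
split => //; apply: eP; rewrite -scalerBl nrmZ.
have -> : s%:C%C^-1 - t%:C%C^-1 = (d / t)%:C%C.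
  by rewrite -!fmorphV -rmorphB /s; congr (_%:C%C); field; rewrite !gt_eqF.
rewrite nrm_real gtr0_norm; last exact: divr_gt0.
have -> : d / t = e / (nrm z + 1) by rewrite /d; field; rewrite !gt_eqF.
by rewrite mulrAC ltr_pdivrMr // ltr_pM2l // ltrDl.
Qed.

Lemma bounded_nrm Om : bounded_set Om -> exists2 B : R, 0 < B & forall z, Om z -> nrm z <= B.
Proof.
move=> [M [Mr MB]]; exists (`|complex.Re M| + 1) => [|z Omz]; first by rewrite ltr_wpDl.
have ME : M = (complex.Re M)%:C%C.
  move: Mr; rewrite realE; case: M {MB} => a b; rewrite !lecE /=.
  by case/orP => /andP[/eqP h _]; [rewrite h|rewrite -h].
have MM : M < (`|complex.Re M| + 1)%:C%C.
  by rewrite {1}ME ltcR; have := ler_norm (complex.Re M); lra.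
have : `|z| <= (`|complex.Re M| + 1)%:C%C by exact: MB _ MM z Omz.
by rewrite nrmE lecR.
Qed.

Lemma convex_real Om : convex_set Om -> forall x y (t : R), 0 <= t -> t <= 1 ->
  Om x -> Om y -> Om (t%:C%C *: x + (1 - t)%:C%C *: y).
Proof.
move=> cOm x y t t0 t1 Ox Oy.
have t0' : 0 <= t%:C%C :> C by rewrite ler0c.
have t1' : t%:C%C <= 1 :> C by rewrite -[1]/(1%:C%C) lecR.
have := cOm x y (Itv01 t0' t1'); rewrite !inE => /(_ Ox Oy).
by rewrite rmorphB rmorph1.
Qed.

(** Balancedness gives homogeneity under complex scalars, and convexity gives the triangle
    inequality. Values are compared through their strict upper bounds, which [minkowski_ltP]
    describes by membership in [Om]. *)
Theorem minkowski_gauge Om : is_domain Om -> bounded_set Om -> balanced Om ->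
  convex_set Om -> gauge_norm (minkowski_fun Om).
Proof.
move=> dOm bdOm bOm cOm; set N := minkowski_fun Om.
have ltP z t : 0 < t -> (N z < t <-> Om (t%:C%C^-1 *: z)) by exact: minkowski_ltP.
have [oOm _ [w Omw]] := dOm.
have Om0 : Om 0 by rewrite -(scale0r w); apply: bOm => //; rewrite normr0.
have N0 z : 0 <= N z by exact: minkowski_ge0.
have eqN (x y : R) : 0 <= x -> 0 <= y ->
    (forall t : R, 0 < t -> (x < t <-> y < t)) -> x = y.
  move=> x0 y0 xy; apply/eqP; rewrite eq_le; apply/andP; split; rewrite leNgt.
    apply/negP => yx; have x0' : 0 < x by lra.
    by have [_ /(_ yx)] := xy x x0'; rewrite ltxx.
  apply/negP => yx; have y0' : 0 < y by lra.
  by have [/(_ yx)] := xy y y0'; rewrite ltxx.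
have NZ (a : C) z : N (a *: z) = nrm a * N z.
  have [->|a0] := eqVneq a 0.
    rewrite scale0r nrm0 mul0r; apply: eqN => // t t0; split=> // _.
    by apply/ltP => //; rewrite scaler0.
  have na : 0 < nrm a by rewrite nrm_gt0.
  have nac : (nrm a)%:C%C != 0 :> C by rewrite -nrm_gt0 nrm_real gtr0_norm.
  have uni (u : C) y : nrm u = 1 -> Om y -> Om (u *: y).
    by move=> u1; apply: bOm; rewrite nrmE u1.
  apply: eqN => // [|t t0]; first by rewrite mulr_ge0 ?nrm_ge0.
  have tn : 0 < t / nrm a by rewrite divr_gt0.
  have tc : t%:C%C != 0 :> C by rewrite -nrm_gt0 nrm_real gtr0_norm.
  have E : t%:C%C^-1 *: (a *: z) = (a / (nrm a)%:C%C) *: ((t / nrm a)%:C%C^-1 *: z).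
    rewrite !scalerA; congr (_ *: _); rewrite rmorphM fmorphV; field.
    by rewrite nac tc.
  have u1 : nrm (a / (nrm a)%:C%C) = 1.
    by rewrite nrmM nrmV nrm_real gtr0_norm // divff // gt_eqF.
  have E' : (t / nrm a)%:C%C^-1 *: z = (a / (nrm a)%:C%C)^-1 *: (t%:C%C^-1 *: (a *: z)).
    by rewrite E scalerA mulVf ?scale1r // -nrm_gt0 u1.
  have lt1 : N z < t / nrm a <-> nrm a * N z < t.
    by rewrite ltr_pdivlMr // mulrC.
  rewrite ltP // -lt1 ltP //; split => h; last by rewrite E; apply: uni.
  by rewrite E'; apply: uni => //; rewrite nrmV u1 invr1.
split => //.
- move=> z w'; apply/ler_addgt0Pr => e e0; apply: ltW.
  pose s := N z + e / 2; pose t := N w' + e / 2.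
  have s0 : 0 < s by rewrite /s; have := N0 z; lra.
  have t0 : 0 < t by rewrite /t; have := N0 w'; lra.
  have st0 : 0 < s + t by lra.
  have -> : N z + N w' + e = s + t by rewrite /s /t; lra.
  apply/ltP => //.
  have Oz : Om (s%:C%C^-1 *: z) by apply/ltP => //; rewrite /s; lra.
  have Ow : Om (t%:C%C^-1 *: w') by apply/ltP => //; rewrite /t; lra.
  have l0 : 0 <= s / (s + t) by rewrite divr_ge0 // ltW.
  have l1 : s / (s + t) <= 1 by rewrite ler_pdivrMr // mul1r; lra.
  have := convex_real cOm l0 l1 Oz Ow.
  have -> : 1 - s / (s + t) = t / (s + t) by field; rewrite gt_eqF.
  have E (u : R) : 0 < u -> (u / (s + t))%:C%C * u%:C%C^-1 = (s + t)%:C%C^-1 :> C.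
    move=> u0; rewrite -!fmorphV -rmorphM; congr (_%:C%C); field.
    by rewrite !gt_eqF.
  by rewrite !scalerA !E // -scalerDr.
- have [e e0 eP] := open_ball oOm Om0; exists (2 / e) => [|z]; first by rewrite divr_gt0.
  have [->|z0] := eqVneq z 0.
    by rewrite nrm0 mulr0 -[X in N X](scale0r (0 : V)) NZ nrm0 mul0r.
  have nz : 0 < nrm z by rewrite nrm_gt0.
  have t0 : 0 < 2 / e * nrm z by rewrite mulr_gt0 // divr_gt0.
  apply/ltW/ltP => //; apply: eP; rewrite subr0 nrmZ nrmV nrm_real gtr0_norm //.
  have -> : (2 / e * nrm z)^-1 * nrm z = e / 2 by field; rewrite !gt_eqF.
  by lra.
- have [B B0 BP] := bounded_nrm bdOm; exists B => // z.
  apply/ler_addgt0Pr => e e0; pose t := N z + e / B.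
  have eB : 0 < e / B by rewrite divr_gt0.
  have t0 : 0 < t by rewrite /t; have := N0 z; lra.
  have : Om (t%:C%C^-1 *: z) by apply/ltP => //; rewrite /t; lra.
  move=> /BP; rewrite nrmZ nrmV nrm_real gtr0_norm // mulrC ler_pdivrMr //.
  by rewrite /t mulrDr [B * (e / B)]mulrC divfK // gt_eqF.
Qed.

End Gauge.

(** * Norming functionals in finite dimension *)

Section HahnBanach.
Context {R : realType} {n : nat}.
Local Notation C := R[i].
Local Notation V := 'rV[C]_n.
Implicit Types (p q : V -> R).

Definition sublinear p := (forall x y, p (x + y) <= p x + p y) /\
  (forall (t : R) x, 0 <= t -> p (t%:C%C *: x) = t * p x).

(* The step of the Hahn-Banach theorem for the direction [u]: the result is a
   sublinear minorant of [p] that is linear along [u]. In finite dimension one step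
   for every real direction of a basis makes [p] linear. *)
Definition flatten_along p (u x : V) : R :=
  inf [set p (x + t%:C%C *: u) - t * p u | t in [set t : R | 0 <= t]].

Lemma flatten_has_inf p u x : sublinear p ->
  lbound [set p (x + t%:C%C *: u) - t * p u | t in [set t : R | 0 <= t]] (- p (- x)).
Proof.
move=> [pD pZ] _ [t /= t0 <-]; rewrite -pZ //.
by have := pD (x + t%:C%C *: u) (- x); rewrite addrC addrA addNr add0r; lra.
Qed.

Lemma flatten_le p u x (t : R) : sublinear p -> 0 <= t ->
  flatten_along p u x <= p (x + t%:C%C *: u) - t * p u.
Proof.
move=> sp t0; apply: ge_inf; last by exists t.
by exists (- p (- x)); exact: flatten_has_inf.
Qed.

Lemma flatten_ge p u x (b : R) : sublinear p ->
  (forall t : R, 0 <= t -> b <= p (x + t%:C%C *: u) - t * p u) ->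
  b <= flatten_along p u x.
Proof.
move=> sp h; apply: lb_le_inf; last by move=> _ [t t0 <-]; exact: h.
by exists (p (x + (0 : R)%:C%C *: u) - 0 * p u); exists 0 => //=.
Qed.

Lemma flatten_sublinear p u : sublinear p -> sublinear (flatten_along p u).
Proof.
move=> sp; have [pD pZ] := sp; split.
  move=> x y.
  have H (s : R) : 0 <= s ->
      flatten_along p u (x + y) - (p (y + s%:C%C *: u) - s * p u) <= flatten_along p u x.
    move=> s0; apply: flatten_ge => // t t0.
    have := @flatten_le p u (x + y) (t + s) sp (addr_ge0 t0 s0).
    have := pD (x + t%:C%C *: u) (y + s%:C%C *: u).
    by rewrite addrACA -scalerDl -rmorphD mulrDl; lra.
  have : flatten_along p u (x + y) - flatten_along p u x <= flatten_along p u y.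
    by apply: flatten_ge => // s s0; have := H s s0; lra.
  by lra.
have p0 : p 0 = 0 by have := pZ 0 0 (lexx 0); rewrite scaler0 mul0r.
have H (t : R) x : 0 < t -> t * flatten_along p u x <= flatten_along p u (t%:C%C *: x).
  move=> t0; apply: flatten_ge => // s s0.
  have st : 0 <= s / t by rewrite divr_ge0 // ltW.
  have := ler_wpM2l (ltW t0) (@flatten_le p u x (s / t) sp st).
  rewrite mulrBr -(pZ t (x + _) (ltW t0)) scalerDr scalerA -rmorphM /=.
  have ts : t * (s / t) = s by rewrite mulrC divfK ?gt_eqF.
  by rewrite ts mulrA ts.
move=> t x; rewrite le_eqVlt => /orP[/eqP <-|t0].
  rewrite scale0r mul0r; apply/eqP; rewrite eq_le; apply/andP; split.
    have := @flatten_le p u 0 0 sp (lexx 0).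
    by rewrite scale0r addr0 mul0r subr0 p0.
  by apply: flatten_ge => // s s0; rewrite add0r pZ // subrr.
apply/eqP; rewrite eq_le H // andbT.
have t1 : 0 < t^-1 by rewrite invr_gt0.
have tc : t%:C%C != 0 :> C by rewrite -nrm_gt0 nrm_real gtr0_norm.
have := H _ (t%:C%C *: x) t1.
rewrite scalerA -rmorphM mulVf ?gt_eqF // scale1r => h.
by rewrite -ler_pdivrMl.
Qed.

Lemma flatten_le0 p u x : sublinear p -> flatten_along p u x <= p x.
Proof.
by move=> sp; have := flatten_le u x sp (lexx 0); rewrite scale0r addr0 mul0r subr0.
Qed.

Lemma flatten_opp p u : sublinear p -> flatten_along p u (- u) <= - p u.
Proof.
move=> sp; have := flatten_le u (- u) sp (@ler01 R); have [_ pZ] := sp.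
have := pZ 0 0 (lexx 0); rewrite scaler0 mul0r => p0.
by rewrite scale1r addNr p0 mul1r sub0r.
Qed.

Lemma flatten_list p (us : seq V) : sublinear p ->
  exists q, [/\ sublinear q, forall x, q x <= p x &
    forall u, u \in us -> q u + q (- u) <= 0].
Proof.
elim: us p => [|u us IH] p sp; first by exists p.
have [q [sq qp qu]] := IH _ (flatten_sublinear u sp).
exists q; split => // [x|v].
  by apply: le_trans (qp x) _; exact: flatten_le0.
rewrite inE => /orP[/eqP ->|]; last exact: qu.
have := qp (- u); have := flatten_opp u sp; have := qp u; have := flatten_le0 u u sp.
by lra.
Qed.

Theorem hahn_banach N (w : V) : gauge_norm N ->
  exists2 L : {linear V -> C}, (forall z, nrm (L z) <= N z) & L w = (N w)%:C%C.
Proof.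
move=> gN; have sN : sublinear N.
  by split=> [x y|t x t0]; [exact: gaugeD|exact: gauge_real].
pose us := codom (fun b : bool * 'I_n =>
  (if b.1 then 'i%C else 1 : C) *: (delta_mx ord0 b.2 : V)).
(* Flattening along [w] comes first: it forces [q (- w) <= - N w], hence [q w = N w] once [q] is
   linear. The directions in [us] then make [q] real linear. *)
have [q [[qD qZ] qN0 qu]] := flatten_list us (flatten_sublinear w sN).
have qN x : q x <= N x by apply: le_trans (qN0 x) (flatten_le0 _ _ sN).
have q0 : q 0 = 0 by have := qZ 0 0 (lexx 0); rewrite scaler0 mul0r.
have qge x : - q (- x) <= q x by have := qD x (- x); rewrite subrr q0; lra.
have linD x y : q x + q (- x) <= 0 -> q y + q (- y) <= 0 ->
    q (x + y) + q (- (x + y)) <= 0.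
  by have := qD x y; rewrite opprD; have := qD (- x) (- y); lra.
have linZ (t : R) x : q x + q (- x) <= 0 -> q (t%:C%C *: x) + q (- (t%:C%C *: x)) <= 0.
  move=> h; have [t0|t0] := leP 0 t.
    by rewrite -scalerN !qZ // -mulrDr mulr_ge0_le0.
  have -> : t%:C%C *: x = (- t)%:C%C *: (- x) by rewrite rmorphN scalerN scaleNr opprK.
  rewrite -scalerN opprK !qZ; [|lra|lra]; rewrite -mulrDr mulr_ge0_le0 //; lra.
have qlin x : q x + q (- x) <= 0.
  rewrite [x]row_sum_delta; apply: (big_ind (fun x => q x + q (- x) <= 0)).
  - by rewrite oppr0 q0 addr0.
  - exact: linD.
  - move=> j _; have -> : x ord0 j *: delta_mx ord0 j =
        (complex.Re (x ord0 j))%:C%C *: (1 *: delta_mx ord0 j) +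
        (complex.Im (x ord0 j))%:C%C *: ('i%C *: delta_mx ord0 j) :> V.
      rewrite scale1r scalerA -scalerDl; congr (_ *: _).
      by rewrite [LHS]complexE [_ * 'i%C]mulrC.
    apply: linD; apply: linZ; apply: qu.
      by apply/codomP; exists (false, j).
    by apply/codomP; exists (true, j).
have qNn x : q (- x) = - q x by have := qlin x; have := qge x; lra.
have qDe x y : q (x + y) = q x + q y.
  apply/eqP; rewrite eq_le qD /=; have := qD (- x) (- y).
  by rewrite -opprD !qNn; lra.
have qZe (t : R) x : q (t%:C%C *: x) = t * q x.
  have [t0|t0] := leP 0 t; first exact: qZ.
  have -> : t%:C%C *: x = - ((- t)%:C%C *: x) by rewrite rmorphN scaleNr opprK.
  by rewrite qNn qZ; lra.
(* The complex linear functional with real part [q]; its modulus is bounded by rotating [z] until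
   the value is real and nonnegative. *)
pose Lf (z : V) : C := (q z +i* - q ('i%C *: z))%C.
have Ll : linear Lf.
  move=> a x y; have aE : a = (complex.Re a)%:C%C + 'i%C * (complex.Im a)%:C%C by exact: complexE.
  have E1 z : q (a *: z) = complex.Re a * q z + complex.Im a * q ('i%C *: z).
    by rewrite {1}aE scalerDl qDe qZe ['i%C * _]mulrC -scalerA qZe.
  have i2 z : 'i%C *: ('i%C *: z) = - z :> V.
    by rewrite scalerA -expr2 sqr_i scaleN1r.
  have E2 z : q ('i%C *: (a *: z)) = complex.Re a * q ('i%C *: z) - complex.Im a * q z.
    by rewrite scalerA ['i%C * a]mulrC -scalerA E1 i2 qNn mulrN.
  change (Lf (a *: x + y) = a * Lf x + Lf y).
  rewrite /Lf scalerDr !qDe E1 E2; case: (a) => c d /=.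
  simpc => /=.
  by apply/eqP; rewrite eq_complex /=; apply/andP; split; apply/eqP; ring.
pose L : {linear V -> C} := HB.pack Lf (GRing.isLinear.Build _ _ _ _ Lf Ll).
have qw : q w = N w.
  have := qN0 (- w); have := flatten_opp w sN; rewrite qNn.
  by have := qN w; lra.
have LN z : nrm (L z) <= N z.
  have [->|Lz] := eqVneq (L z) 0; first by rewrite nrm0 gauge_ge0.
  have nL : 0 < nrm (L z) by rewrite nrm_gt0.
  pose th : C := (nrm (L z))%:C%C / L z.
  have nth : nrm th = 1.
    by rewrite nrmM nrmV nrm_real gtr0_norm // divff // gt_eqF.
  have Lth : L (th *: z) = (nrm (L z))%:C%C by rewrite linearZ /= -[_ *: _]/(th * L z) divfK.
  have : q (th *: z) = nrm (L z).
    by have := congr1 (@complex.Re R) Lth.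
  by move=> <-; apply: le_trans (qN _) _; rewrite gaugeZ // nth mul1r.
exists L => //.
have Lw : complex.Re (L w) = N w by rewrite /= qw.
have := LN w; have := nrm_sqr (L w); rewrite Lw.
have N0 := gauge_ge0 gN w; have L0 := nrm_ge0 (L w) => h1 h2.
have im0 : complex.Im (L w) = 0.
  apply/eqP; rewrite -sqrf_eq0 eq_le sqr_ge0 andbT; nra.
by rewrite [LHS]complexE Lw im0 mulr0 addr0.
Qed.

End HahnBanach.

(** * Schwarz's lemma for gauges *)

Section Schwarz.
Context {R : realType} {n : nat}.
Local Notation C := R[i].
Local Notation V := 'rV[C]_n.
Implicit Types (N : V -> R) (K : set V).

Lemma open_gauge N (r : R) : gauge_norm N -> open [set z | N z < r].
Proof.
move=> gN; apply/open_nrmP => z /= zr.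
have [|d d0 dP] := @gauge_cont R n N z gN (r - N z); first by rewrite subr_gt0.
exists d => // y /dP; rewrite -rmorphB nrm_real ltr_norml; lra.
Qed.

Lemma closed_gauge_le N (r : R) : gauge_norm N -> closed [set z | N z <= r].
Proof.
move=> gN; rewrite (_ : [set _ | _] = ~` [set z | r < N z]).
  apply/open_closedC/open_nrmP => z /= zr.
  have [|d d0 dP] := @gauge_cont R n N z gN (N z - r); first by rewrite subr_gt0.
  exists d => // y /dP; rewrite -rmorphB nrm_real ltr_norml; lra.
by apply/seteqP; split => x /=; rewrite leNgt => /negP.
Qed.

Lemma closed_gauge_ge N (r : R) : gauge_norm N -> closed [set z | r <= N z].
Proof.
move=> gN; rewrite (_ : [set _ | _] = ~` [set z | N z < r]).
  exact/open_closedC/open_gauge.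
by apply/seteqP; split => x /=; rewrite leNgt => /negP.
Qed.

Lemma compact_gauge N (r : R) : gauge_norm N -> compact [set z | N z <= r].
Proof.
move=> gN; have [k k0 kP] := gauge_ge gN.
apply: subclosed_compact (@compact_nrm_ball R n (k * r)) _.
  exact: closed_gauge_le.
by move=> z /= zr; apply: le_trans (kP z) _; rewrite ler_wpM2l // ltW.
Qed.

Lemma compact_gauge_lt N K (r : R) : gauge_norm N -> compact K -> 0 < r ->
  K `<=` [set z | N z < r] -> exists s : R, [/\ 0 <= s, s < r & forall z, K z -> N z <= s].
Proof.
move=> gN cK r0 Kr; have [K0|nK] := pselect (K !=set0); last first.
  by exists 0; split => // z Kz; exfalso; apply: nK; exists z.
have [|c Kc cP] := @compact_argmax_cont R V K N K0 cK.
  by move=> x _; exact: gauge_cont.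
by exists (N c); split => //; [exact: gauge_ge0|exact: Kr].
Qed.

Lemma schwarz_gauge N (k : V -> C) : gauge_norm N ->
  (forall z, N z < 1 -> differentiable k z) ->
  (forall z, N z < 1 -> nrm (k z) <= 1) -> k 0 = 0 ->
  forall z, N z < 1 -> nrm (k z) <= N z.
Proof.
move=> gN dk k1 k0 z z1; have [->|z0] := eqVneq z 0.
  by rewrite k0 nrm0 gauge_ge0.
have Nz : 0 < N z.
  rewrite lt_neqAle gauge_ge0 // andbT eq_sym; apply: contra z0 => /eqP h.
  by apply/eqP; exact: gauge_eq0 h.
have Nc : (N z)%:C%C != 0 :> C by rewrite -nrm_gt0 nrm_real gtr0_norm.
pose u := (N z)%:C%C^-1 *: z.
have Nu : N u = 1 by rewrite gaugeZ // nrmV nrm_real gtr0_norm // mulVf // gt_eqF.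
have zE : z = (N z)%:C%C *: u by rewrite scalerA mulfV ?scale1r.
pose g (t : C) := k (0 + t *: u).
have inb (t : C) : nrm t < 1 -> N (0 + t *: u) < 1.
  by move=> t1; rewrite add0r gaugeZ // Nu mulr1.
have gz : g (N z)%:C%C = k z by rewrite /g add0r -zE.
have nNz : nrm ((N z)%:C%C : C) = N z by rewrite nrm_real gtr0_norm.
rewrite -gz -[leRHS]nNz; apply: schwarz_disk.
- by move=> t /inb h; apply: differentiable_line; exact: dk.
- by move=> t /inb; exact: k1.
- by rewrite /g scale0r addr0.
- by rewrite nNz.
Qed.

(** Schwarz's lemma for [h] followed by the automorphism of the disk that sends [b] to 0: the
    composite vanishes at 0 and has modulus [b] at the zero [w] of [h]. *)
Lemma schwarz_shift N (h : V -> C) w (b : R) : gauge_norm N ->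
  (forall z, N z < 1 -> differentiable h z) ->
  (forall z, N z < 1 -> nrm (h z) < 1) -> 0 <= b -> h 0 = b%:C%C ->
  N w < 1 -> h w = 0 -> b <= N w.
Proof.
move=> gN dh h1 b0 h0 w1 hw.
have b1 : b < 1.
  by have := h1 0; rewrite (gauge0 gN) h0 nrm_real ger0_norm //; apply; exact: ltr01.
have mob (x : C) : nrm x < 1 -> 1 - b%:C%C * x != 0 /\
    nrm ((x - b%:C%C) / (1 - b%:C%C * x)) <= 1.
  move=> x1; have bx : nrm (b%:C%C * x) < 1.
    rewrite nrmM nrm_real ger0_norm //; have := nrm_ge0 x; nra.
  have d0 : 0 < nrm (1 - b%:C%C * x).
    by have := nrmB_ge (1 : C) (b%:C%C * x); rewrite nrm1; lra.
  split; first by rewrite -nrm_gt0.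
  rewrite nrmM nrmV ler_pdivrMr // mul1r.
  rewrite -(@ler_pXn2r _ 2) ?nnegrE ?nrm_ge0 // !nrm_sqr.
  have x2 : nrm x ^+ 2 <= 1 by rewrite expr_le1 ?nrm_ge0 // ltW.
  move: x2; rewrite nrm_sqr; case: (x) => p q /=; simpc => /= x2.
  have : 0 <= (1 - b ^+ 2) * (1 - (p ^+ 2 + q ^+ 2)).
    by rewrite mulr_ge0 ?subr_ge0 // expr_le1 // ltW.
  lra.
pose k z := (h z - b%:C%C) / (1 - b%:C%C * h z).
have kw : nrm (k w) = b.
  by rewrite /k hw mulr0 subr0 divr1 sub0r nrmN nrm_real ger0_norm.
rewrite -kw; apply: schwarz_gauge => //.
- move=> z z1; apply: diffM; first by apply: diffB; [exact: dh|exact: diffC].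
  apply: diffV; last by have [] := mob _ (h1 z z1).
  by apply: diffB; [exact: diffC|apply: diffM; [exact: diffC|exact: dh]].
- by move=> z z1; have [] := mob _ (h1 z z1).
- by rewrite /k h0 subrr mul0r.
Qed.

End Schwarz.

(** * Hartogs' theorem *)

Section Hartogs.
Context {R : realType} {n : nat}.
Local Notation C := R[i].
Local Notation V := 'rV[C]_n.
Implicit Types (N : V -> R) (K : set V).

Lemma kernel_vector (L : {linear V -> C}) : (2 <= n)%N -> exists2 v : V, v != 0 & L v = 0.
Proof.
move=> n2; have n0 : (0 < n)%N by exact: leq_trans n2.
pose e0 : V := delta_mx ord0 (Ordinal n0); pose e1 : V := delta_mx ord0 (Ordinal n2).
have [L0|L0] := eqVneq (L e0) 0.
  exists e0 => //; apply/eqP => /rowP /(_ (Ordinal n0)).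
  by rewrite !mxE !eqxx /= => /eqP; rewrite oner_eq0.
exists (L e1 *: e0 - L e0 *: e1); last first.
  have -> : L (L e1 *: e0 - L e0 *: e1) = L e1 * L e0 - L e0 * L e1.
    by rewrite linearB !linearZ.
  by rewrite mulrC subrr.
apply/eqP => /rowP /(_ (Ordinal n2)); rewrite !mxE !eqxx /= mulr0 mulr1 sub0r => /eqP.
by rewrite oppr_eq0 (negbTE L0).
Qed.

(* On every line through the origin Cauchy's formula over a circle surrounding [K]
   gives a candidate extension; it agrees with [f] on the lines missing [K]. *)
Theorem hartogs_lines N K (L : {linear V -> C}) (f : V -> C) : (2 <= n)%N ->
  gauge_norm N -> compact K -> K `<=` [set z | N z < 1] ->
  (exists2 k : R, 0 < k & forall z, nrm (L z) <= k * N z) ->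
  (forall z, K z -> L z != 0) -> connected ([set z | N z < 1] `\` K) ->
  (forall z, ([set z | N z < 1] `\` K) z -> differentiable f z) ->
  exists F : V -> C, (forall z, N z < 1 -> differentiable F z) /\
    forall z, ([set z | N z < 1] `\` K) z -> F z = f z.
Proof.
move=> n2 gN cK KOm [kL kL0 LN] LK cD df; have r32 : (1 : R) < 3 / 2 by lra.
have N0 := gauge0 gN; have Nge := gauge_ge0 gN.
have [s [s0 s1 Ks]] := compact_gauge_lt gN cK ltr01 KOm.
have NR (t : R) z : 0 <= t -> N (t%:C%C *: z) = t * N z by exact: gauge_real.
have Npos z : z != 0 -> 0 < N z.
  move=> z0; rewrite lt_neqAle Nge andbT eq_sym; apply: contra z0 => /eqP h.
  by apply/eqP; exact: gauge_eq0 h.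
have cN z : cont_at (fun y => (N y)%:C%C) z by exact: gauge_cont.
have Lb : exists2 k : R, 0 < k & forall z, nrm (L z) <= k * nrm z.
  have [k' k'0 k'P] := gauge_le gN; exists (kL * k'); first exact: mulr_gt0.
  by move=> z; apply: le_trans (LN z) _; rewrite -mulrA ler_pM2l.
have cL z : cont_at L z.
  by have [k _ kP] := Lb; have [dL _] := linear_is_diff z kP; exact: diff_cont_at.
have [c c0 cK'] : exists2 c : R, 0 < c & forall w, K w -> c <= nrm (L w).
  have [K0|nK] := pselect (K !=set0); last first.
    by exists 1 => // w Kw; exfalso; apply: nK; exists w.
  have [|w Kw wP] := @compact_argmin R V K (fun z => nrm (L z)) K0 cK.
    move=> x _ e e0; have [d d0 dP] := cont_at_nrm (cL x) e0.
    by exists d => // y _ /dP; rewrite -rmorphB nrm_real.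
  by exists (nrm (L w)) => //; rewrite nrm_gt0 LK.
have offK z : s < N z -> N z < 1 -> ([set z | N z < 1] `\` K) z.
  by move=> sz z1; split => //= /Ks; lra.
have oD : open ([set z | N z < 1] `\` K).
  apply: openI; first exact: open_gauge.
  by apply: closed_openC; apply: compact_closed => //; exact: norm_hausdorff.
(* Cauchy's integrand for the function [t |-> f (t *: z)] at the point [t = 1], on the circle of
   radius [r]. *)
pose kf (r : R) (z : V) (w : C) :=
  f ((r%:C%C * w) *: z) * (r%:C%C * w / (r%:C%C * w - 1)).
(* The circle encloses [t = 1], and its image on the line lies in the shell [s < N < 1], which
   misses [K]. *)
pose adm (r : R) (z : V) := [/\ 1 < r, s < r * N z & r * N z < 1].
have adm_eq r1 r2 z : adm r1 z -> adm r2 z -> mean (kf r1 z) = mean (kf r2 z).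
  suff H r r' : r <= r' -> adm r z -> adm r' z -> mean (kf r z) = mean (kf r' z).
    move=> a1 a2; have [h|/ltW h] := leP r1 r2; first exact: H.
    by apply/esym; exact: H.
  move=> rr [r1' sr _] [_ _ r'1].
  apply: (@mean_annulus R (fun t : C => f (t *: z) * (t / (t - 1))) r r') => //.
    exact: lt_trans r1'.
  move=> t /andP[rt tr'].
  have Nz0 := Nge z.
  have t1 : t - 1 != 0.
    rewrite subr_eq0; apply/eqP => h; move: rt; rewrite h nrm1; lra.
  apply: diffM; last first.
    apply: diffM; first exact: diffI.
    apply: (@diffV R C (fun t => t - 1)); last exact: t1.
    by apply: diffB; [exact: diffI|exact: diffC].
  have := @differentiable_line R V C f 0 z t; rewrite add0r => h.
  rewrite (_ : (fun _ => _) = fun s : C => f (0 + s *: z)); last first.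
    by apply/funext => y; rewrite add0r.
  apply: h; apply: df; apply: offK; rewrite gaugeZ //.
    by apply: lt_le_trans sr _; rewrite ler_wpM2r.
  by apply: le_lt_trans r'1; rewrite ler_wpM2r.
pose rad z := (Num.max s (N z) + 1) / 2 / N z.
have adm_rad z : z != 0 -> N z < 1 -> adm (rad z) z.
  move=> z0 z1; have Nz := Npos z z0.
  have m1 : Num.max s (N z) < 1 by rewrite gt_max s1.
  have ms : s <= Num.max s (N z) by rewrite le_max lexx.
  have mN : N z <= Num.max s (N z) by rewrite le_max lexx orbT.
  rewrite /adm /rad divfK ?gt_eqF //; split; [|lra|lra].
  by rewrite ltr_pdivlMr // mul1r; lra.
pose F0 z := mean (kf (rad z) z).
have adm_near r z : adm r z -> exists2 d : R, 0 < d &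
    forall y, nrm (y - z) < d -> [/\ adm r y, r * N y <= (1 + r * N z) / 2 &
      (s + r * N z) / 2 <= r * N y].
  move=> [r1 sr rN1]; have r0 : 0 < r by lra.
  pose e := Num.min (r * N z - s) (1 - r * N z) / 2 / r.
  have e0 : 0 < e by rewrite !divr_gt0 // lt_min !subr_gt0 sr.
  have [d d0 dP] := cN z e e0; exists d => // y /dP; rewrite -rmorphB nrm_real.
  have e1 : e * r <= (r * N z - s) / 2.
    by rewrite /e divfK ?gt_eqF // ler_pM2r // ge_min lexx.
  have e2 : e * r <= (1 - r * N z) / 2.
    by rewrite /e divfK ?gt_eqF // ler_pM2r // ge_min lexx orbT.
  rewrite -(ltr_pM2r r0) -{1}(gtr0_norm r0) -normrM ltr_norml mulrBl.
  by rewrite ![_ * r]mulrC in e1 e2 * => /andP[h1 h2]; split; [split|..]; lra.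
have adm_holo r z : adm r z -> differentiable (fun y => mean (kf r y)) z.
  move=> az; have [d d0 dP] := adm_near r z az; have [r1 sr rN1] := az.
  have r0 : 0 < r by lra.
  pose Sh := [set y | N y <= (1 + r * N z) / 2] `&` [set y | (s + r * N z) / 2 <= N y].
  have cSh : compact Sh.
    by apply: compact_closedI; [exact: compact_gauge|exact: closed_gauge_ge].
  have ShD y : Sh y -> ([set z | N z < 1] `\` K) y.
    by move=> [/= h1 h2]; apply: offK; lra.
  have [M M0 MP] : exists2 M : R, 0 <= M & forall y, Sh y -> nrm (f y) <= M.
    have [S0|nS] := pselect (Sh !=set0); last first.
      by exists 0 => // y Sy; exfalso; apply: nS; exists y.
    have [|y Sy yP] := @compact_argmax_cont R V Sh (fun y => nrm (f y)) S0 cSh.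
      by move=> x /ShD Dx; apply/cont_at_nrm/diff_cont_at/df.
    by exists (nrm (f y)) => //; exact: nrm_ge0.
  have inSh w y : nrm w = 1 -> nrm (y - z) < d -> Sh ((r%:C%C * w) *: y).
    move=> w1 /dP[_ h1 h2].
    by split; rewrite /= gaugeZ // nrm_polar // ltW.
  apply: (@mean_holo R V (fun y => kf r y) z d (M * (r / (r - 1)))) => //.
    move=> w w1 y yd; apply: diffM; last exact: diffC.
    have h : differentiable f ((r%:C%C * w) *: y) by apply: df; apply: ShD; exact: inSh.
    have [dZ _] := @is_diff_scaler C V (r%:C%C * w) y.
    exact: (@diff_compf R V V C ( *:%R (r%:C%C * w)) f y dZ h).
  move=> w w1 y yd; rewrite nrmM; apply: ler_pM; rewrite ?nrm_ge0 //.
    by apply: MP; exact: inSh.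
  rewrite nrmM nrmV nrm_polar ?(ltW r0) // ler_pM2l //.
  have := nrmB_ge (r%:C%C * w) 1; rewrite nrm_polar ?(ltW r0) // nrm1 => h.
  by rewrite lef_pV2 ?posrE; lra.
have F0_holo z : z != 0 -> N z < 1 -> differentiable F0 z.
  move=> z0 z1; have az := adm_rad z z0 z1.
  have [d d0 dP] := adm_near _ _ az.
  pose d' := Num.min d (nrm z); have d'0 : 0 < d' by rewrite lt_min d0 nrm_gt0.
  apply: (@eq_near_differentiable R V C (fun y => mean (kf (rad z) y)) F0 z d' d'0).
    move=> y; rewrite lt_min => /andP[/dP[ay h _] yz]; apply: adm_eq => //.
    apply: adm_rad.
      by apply: contraTneq yz => ->; rewrite sub0r nrmN ltxx.
    have [r1 _ h2] := ay; have := Nge y; nra.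
  exact: adm_holo.
(* If [t *: z] with [N (t *: z) < 1] were in [K], then [c <= nrm t * nrm (L z) < c]. So the whole
   disc on the line through a good [z] avoids [K] and Cauchy's formula returns [f z]. *)
pose good z := [/\ z != 0, N z < 1 & nrm (L z) < c * N z].
have F0_good z : good z -> F0 z = f z.
  move=> [z0 z1 Lz]; have [r1 _ rN1] := adm_rad z z0 z1.
  have r0 : 0 < rad z by lra.
  have Nz := Npos z z0.
  have lineD (t : C) : nrm t <= rad z -> ([set z | N z < 1] `\` K) (t *: z).
    move=> tr; have tN : N (t *: z) < 1.
      by rewrite gaugeZ //; apply: le_lt_trans rN1; rewrite ler_wpM2r // ltW.
    split => //= /cK'; rewrite linearZ /= -[_ *: _]/(t * L z) nrmM => h.
    have t0 : 0 <= nrm t by exact: nrm_ge0.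
    have h1 : nrm t * nrm (L z) <= nrm t * (c * N z) by rewrite ler_wpM2l // ltW.
    move: tN; rewrite gaugeZ // => tN.
    have h2 : c * (nrm t * N z) < c by rewrite gtr_pMr.
    by rewrite mulrCA in h1; lra.
  have ar : nrm (1 : C) < rad z by rewrite nrm1.
  have := @cauchy_formula R (fun t : C => f (0 + t *: z)) (rad z) 1 ar.
  rewrite scale1r add0r => <-.
    by apply: eq_mean => w w1; rewrite add0r.
  move=> t tr; apply: differentiable_line; rewrite add0r.
  by apply: df; exact: lineD.
have D0 : ([set z | N z < 1] `\` K) 0.
  by split; [rewrite /= N0|move=> /LK; rewrite linear0 eqxx].
have [e e0 eP] : exists2 e : R, 0 < e & forall z, N z < e -> ([set z | N z < 1] `\` K) z.
  have [d d0 dP] := open_ball oD D0; have [k k0 kP] := gauge_ge gN.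
  exists (d / k); first exact: divr_gt0.
  move=> z; rewrite ltr_pdivlMr // mulrC => h; apply: dP; rewrite subr0.
  exact: le_lt_trans (kP z) h.
(* [F0] is only known to be holomorphic off 0, so the line used for uniqueness must avoid 0: it
   starts at a nonzero [z1] with [L z1 = 0], which is good together with its neighbours, and goes to
   a [z] with [L z != 0]. The vector [z1] exists because [n >= 2]. *)
have F0_near0 z : z != 0 -> N z < e / 4 -> F0 z = f z.
  move=> z0 ze; have [Lz|Lz] := eqVneq (L z) 0.
    apply: F0_good; split => //; last by rewrite Lz nrm0 mulr_gt0 // Npos.
    have h : N z < e by lra.
    by have [] := eP z h.
  have [v v0 Lv] := kernel_vector L n2; have Nv := Npos v v0.
  pose z1 := (e / 8 / N v)%:C%C *: v.
  have t0 : 0 < e / 8 / N v by rewrite !divr_gt0.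
  have Nz1 : N z1 = e / 8 by rewrite NR ?(ltW t0) // divfK // gt_eqF.
  have Lz1 : L z1 = 0 by rewrite linearZ /= Lv scaler0.
  have z10 : z1 != 0 by apply: contraTneq e0 => z10; move: Nz1; rewrite z10 N0; lra.
  have lineP (t : C) : nrm t <= 3 / 2 ->
      z1 + t *: (z - z1) != 0 /\ N (z1 + t *: (z - z1)) < e.
    move=> t32; split.
      apply/eqP => h; have := congr1 L h.
      rewrite linear0 linearD Lz1 add0r linearZ linearB Lz1 subr0 => /eqP.
      rewrite scaler_eq0 (negbTE Lz) orbF => /eqP t0'.
      by move: h; rewrite t0' scale0r addr0 => /eqP; rewrite (negbTE z10).
    apply: le_lt_trans (gaugeD gN _ _) _; rewrite gaugeZ // Nz1.
    have h1 : N (z - z1) <= e / 4 + e / 8.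
      apply: le_trans (gaugeD gN _ _) _; rewrite gaugeN // Nz1; lra.
    have h2 : nrm t * N (z - z1) <= 3 / 2 * (e / 4 + e / 8).
      by rewrite ler_pM ?nrm_ge0.
    by lra.
  have [g1 g2 g3] : good z1.
    have h : N z1 < e by lra.
    split => //; first by have [] := eP z1 h.
    by rewrite Lz1 nrm0 mulr_gt0 // Npos.
  have [d d0 dP] : exists2 d : R, 0 < d & forall y, nrm (y - z1) < d -> good y.
    have [d1 d10 h1] := cN z1 (e / 16) (divr_gt0 e0 (ltr0Sn _ _)).
    have ce : 0 < c * (e / 16) by rewrite mulr_gt0 // divr_gt0.
    have [d2 d20 h2] := cL z1 _ ce.
    exists (Num.min d1 d2); first by rewrite lt_min d10.
    move=> y; rewrite lt_min => /andP[/h1 k1 /h2 k2].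
    move: k1 k2; rewrite -rmorphB nrm_real ltr_norml Lz1 subr0 Nz1 => /andP[k1 k2] k3.
    have Ny : e / 16 < N y by lra.
    split; first by apply: contraTneq Ny => ->; rewrite N0; lra.
      have h : N y < e by lra.
      by have [] := eP y h.
    by apply: lt_trans k3 _; rewrite ltr_pM2l.
  pose phi y := F0 y - f y.
  have dphi y : y != 0 -> N y < e -> differentiable phi y.
    move=> y0 ye; have [y1 yK] := eP y ye.
    by apply: diffB; [exact: F0_holo|exact: df].
  apply/eqP; rewrite -subr_eq0; apply/eqP.
  apply: (@zero_line R V phi z1 z (3 / 2) d r32 d0).
  - by move=> t /lineP[h1 h2]; apply: diff_cont_at; exact: dphi.
  - by move=> t /ltW /lineP[h1 h2] _; exact: dphi.
  - by move=> y /dP /F0_good h; rewrite /phi h subrr.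
(* At 0 there is no line to integrate on, and [rad 0] is meaningless; as [F0] agrees with [f]
   nearby, the value [f 0] makes [F] holomorphic at 0. *)
pose F z := if z == 0 then f 0 else F0 z.
have Fnear z : N z < e / 4 -> F z = f z.
  by rewrite /F; case: eqP => [-> //|/eqP z0]; exact: F0_near0.
have [k k0 kP] := gauge_le gN.
have nearE z : nrm z < e / 4 / k -> N z < e / 4.
  by rewrite ltr_pdivlMr // mulrC; apply: le_lt_trans.
have ek : 0 < e / 4 / k by rewrite !divr_gt0.
have dF z : N z < 1 -> differentiable F z.
  move=> z1; have [->|z0] := eqVneq z 0.
    apply: (@eq_near_differentiable R V C f F 0 _ ek); last exact: df.
    by move=> y; rewrite subr0 => /nearE /Fnear.
  have nz : 0 < nrm z by rewrite nrm_gt0.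
  apply: (@eq_near_differentiable R V C F0 F z _ nz); last exact: F0_holo.
  move=> y yz; rewrite /F; case: eqP => // y0.
  by move: yz; rewrite y0 sub0r nrmN ltxx.
exists F; split => // z Dz; apply/eqP; rewrite -subr_eq0; apply/eqP.
apply: (@identity_theorem R V ([set z | N z < 1] `\` K) (fun z => F z - f z) 0
  (e / 4 / k) oD cD _ D0 ek _ z Dz).
- by move=> y Dy; apply: diffB; [apply: dF; case: Dy|exact: df].
- by move=> y; rewrite subr0 => /nearE /Fnear ->; rewrite subrr.
Qed.

End Hartogs.

(** * Extension from the complement of a compact subset of a homogeneous ball *)

Section HartogsBall.
Context {R : realType} {n : nat}.
Local Notation C := R[i].
Local Notation V := 'rV[C]_n.
Implicit Types (N : V -> R) (K D : set V).

Lemma within_cont_at (A : set V) (f : V -> V) : (forall x, A x -> cont_at f x) ->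
  {within A, continuous f}.
Proof.
move=> cf; apply: continuous_in_subspaceT => x; rewrite inE => /cf h.
by apply/cont_atE.
Qed.

Lemma gauge_lin N (L : {linear V -> C}) x : gauge_norm N ->
  (forall z, nrm (L z) <= N z) -> differentiable L x.
Proof.
move=> gN LN; have [k k0 kP] := gauge_le gN.
have Lk z : nrm (L z) <= k * nrm z by exact: le_trans (LN z) (kP z).
by have [dL _] := linear_is_diff x Lk.
Qed.

Lemma gauge_vector N (b : R) : (0 < n)%N -> gauge_norm N -> 0 <= b ->
  exists v : V, N v = b.
Proof.
move=> n0 gN b0; pose e : V := delta_mx ord0 (Ordinal n0).
have Ne : 0 < N e.
  rewrite lt_neqAle gauge_ge0 // andbT eq_sym; apply/eqP => /(gauge_eq0 gN).
  by move=> /rowP /(_ (Ordinal n0)); rewrite !mxE !eqxx /= => /eqP; rewrite oner_eq0.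
exists ((b / N e)%:C%C *: e); rewrite gauge_real ?divr_ge0 ?(ltW Ne) //.
by rewrite divfK // gt_eqF.
Qed.

(* A point [phi 0] far from [phi K] is obtained by moving to the origin a point [a]
   with [N a] larger than [N] on [K]. *)
Lemma avoid_hyperplane N K : (0 < n)%N -> gauge_norm N ->
  homogeneous [set z | N z < 1] -> compact K -> K `<=` [set z | N z < 1] ->
  exists2 phi, automorphism [set z | N z < 1] phi &
    exists2 L : {linear V -> C}, (forall z, nrm (L z) <= N z) &
      forall w, K w -> L (phi w) != 0.
Proof.
move=> n0 gN hB cK KB; have N0 := gauge0 gN.
have [s [s0 s1 Ks]] := compact_gauge_lt gN cK ltr01 KB.
have [a Na] : exists a, N a = (1 + s) / 2 by apply: gauge_vector => //; lra.
have Ba : [set z | N z < 1] a by rewrite /= Na; lra.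
have B0 : [set z | N z < 1] 0 by rewrite /= N0.
have [phi aphi phia] := hB a 0 Ba B0; exists phi => //.
have [[dphi Bphi] [psi [[dpsi Bpsi] psiK phiK]]] := aphi.
have psi0 : psi 0 = a by rewrite -phia psiK.
have [L' L'N L'a] := hahn_banach a gN.
(* The function [L' (psi y)] takes the value [N a] at 0 and vanishes at [phi 0]. *)
have far : (1 + s) / 2 <= N (phi 0).
  apply: (@schwarz_shift R n N (fun y => L' (psi y)) (phi 0) ((1 + s) / 2) gN).
  - move=> y By; have dL := @gauge_lin N L' (psi y) gN L'N.
    by apply: (@diff_compf R V V C psi L' y _ dL); exact: dpsi.
  - by move=> y By; apply: le_lt_trans (L'N _) _; exact: Bpsi.
  - lra.
  - by rewrite psi0 L'a Na.
  - exact: Bphi.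
  - by rewrite psiK // linear0.
(* The function [L (phi y)] takes the value [N (phi 0)] at 0; a zero [w] of it in [K] would give
   [N (phi 0) <= N w <= s]. *)
have [L LN Lp] := hahn_banach (phi 0) gN; exists L => // w Kw; apply/eqP => Lw.
have : N (phi 0) <= N w.
  apply: (@schwarz_shift R n N (fun y => L (phi y)) w (N (phi 0)) gN) => //.
  - move=> y By; have dL := @gauge_lin N L (phi y) gN LN.
    by apply: (@diff_compf R V V C phi L y _ dL); exact: dphi.
  - by move=> y By; apply: le_lt_trans (LN _) _; exact: Bphi.
  - exact: gauge_ge0.
  - exact: KB.
by have := Ks w Kw; lra.
Qed.

Theorem hartogs_ball N K (f : V -> C) : (2 <= n)%N ->
  gauge_norm N -> homogeneous [set z | N z < 1] ->
  compact K -> K `<=` [set z | N z < 1] ->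
  connected ([set z | N z < 1] `\` K) ->
  (forall z, ([set z | N z < 1] `\` K) z -> differentiable f z) ->
  exists F : V -> C, (forall z, N z < 1 -> differentiable F z) /\
    forall z, ([set z | N z < 1] `\` K) z -> F z = f z.
Proof.
move=> n2 gN hB cK KB cD df; have n0 : (0 < n)%N by exact: leq_trans n2.
have [phi [[dphi Bphi] [psi [[dpsi Bpsi] psiK phiK]]] [L LN L0]] :=
  avoid_hyperplane n0 gN hB cK KB.
have imD : [set z | N z < 1] `\` phi @` K = phi @` ([set z | N z < 1] `\` K).
  apply/seteqP; split => [y [By nKy]|_ [x [Bx nKx] <-]].
    exists (psi y); last exact: phiK.
    by split; [exact: Bpsi|move=> h; apply: nKy; exists (psi y) => //; exact: phiK].
  split; first exact: Bphi.
  by move=> [x' Kx' /(congr1 psi)]; rewrite !psiK //; [move=> h; rewrite h in Kx'|exact: KB].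
have [F' [dF' F'f]] : exists F : V -> C, (forall z, N z < 1 -> differentiable F z) /\
    forall z, ([set z | N z < 1] `\` phi @` K) z -> F z = f (psi z).
  apply: (@hartogs_lines R n N (phi @` K) L (fun y => f (psi y))) => //.
  - apply: continuous_compact => //; apply: within_cont_at => x /KB Bx.
    by apply: diff_cont_at; exact: dphi.
  - by move=> _ [x /KB Bx <-]; exact: Bphi.
  - by exists 1 => // y; rewrite mul1r.
  - by move=> _ [x Kx <-]; exact: L0.
  - rewrite imD; apply: connected_continuous_connected => //.
    by apply: within_cont_at => x [Bx _]; apply: diff_cont_at; exact: dphi.
  - rewrite imD => _ [x [Bx nKx] <-]; apply: (@diff_compf R V V C psi f).
      by apply: dpsi; exact: Bphi.
    by rewrite psiK //; exact: df.
exists (fun y => F' (phi y)); split=> [z Bz|z Dz].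
  by apply: (@diff_compf R V V C phi F'); [exact: dphi|apply: dF'; exact: Bphi].
have [Bz _] := Dz; rewrite F'f; first by rewrite psiK.
by rewrite imD; exists z.
Qed.

(** Suppose the extension took a value [F w] of modulus at least 1. Then [1 / (f - F w)] would
    extend as well, to some [H], and the identity [H * (F - F w) = 1] would spread from the
    complement of [K] to [w], where its left side is 0. *)
Lemma hartogs_disk N K (f : V -> C) : (2 <= n)%N ->
  gauge_norm N -> homogeneous [set z | N z < 1] -> connected [set z | N z < 1] ->
  compact K -> K `<=` [set z | N z < 1] ->
  connected ([set z | N z < 1] `\` K) -> ([set z | N z < 1] `\` K) !=set0 ->
  (forall z, ([set z | N z < 1] `\` K) z -> differentiable f z) ->
  exists F : V -> C, [/\ (forall z, N z < 1 -> differentiable F z),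
    forall z, ([set z | N z < 1] `\` K) z -> F z = f z &
    (forall z, ([set z | N z < 1] `\` K) z -> nrm (f z) < 1) ->
    forall z, N z < 1 -> nrm (F z) < 1].
Proof.
move=> n2 gN hB cB cK KB cD [p Dp] df.
have [F [dF Ff]] := @hartogs_ball N K f n2 gN hB cK KB cD df.
exists F; split => // f1 w Bw; rewrite ltNge; apply/negP => Fw.
have fc z : ([set z | N z < 1] `\` K) z -> f z - F w != 0.
  by move=> /f1 h; rewrite subr_eq0; apply: contraTneq Fw => <-; rewrite -ltNge.
have [|H [dH Hf]] := @hartogs_ball N K (fun z => (f z - F w)^-1) n2 gN hB cK KB cD.
  move=> z Dz; apply: (@diffV R V (fun z => f z - F w)); last exact: fc.
  by apply: diffB; [exact: df|exact: diffC].
have oB := @open_gauge R n N 1 gN.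
have oD : open ([set z | N z < 1] `\` K).
  apply: openI => //.
  by apply: closed_openC; apply: compact_closed => //; exact: norm_hausdorff.
have [d d0 dP] := open_ball oD Dp; have [Bp _] := Dp.
have : H w * (F w - F w) - 1 = 0.
  apply: (@identity_theorem R V [set z | N z < 1] (fun z => H z * (F z - F w) - 1) p d
    oB cB _ Bp d0 _ w Bw).
  - move=> z Bz; apply: diffB; last exact: diffC.
    by apply: diffM; [exact: dH|apply: diffB; [exact: dF|exact: diffC]].
  - by move=> y /dP Dy; rewrite (Hf y Dy) (Ff y Dy) (mulVf (fc y Dy)) subrr.
by move/eqP; rewrite subrr mulr0 sub0r oppr_eq0 oner_eq0.
Qed.

(** Coordinates extend separately. For the bound at [w], a functional [L] norming [F w] reduces to
    the scalar case: [L (F z)] is the extension of [L (f z)], which maps into the unit disk. *)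
Theorem hartogs_map N K (f : V -> V) : (2 <= n)%N ->
  gauge_norm N -> homogeneous [set z | N z < 1] -> connected [set z | N z < 1] ->
  compact K -> K `<=` [set z | N z < 1] ->
  connected ([set z | N z < 1] `\` K) -> ([set z | N z < 1] `\` K) !=set0 ->
  holo_map ([set z | N z < 1] `\` K) [set z | N z < 1] f ->
  exists2 F : V -> V, holo_map [set z | N z < 1] [set z | N z < 1] F &
    forall z, ([set z | N z < 1] `\` K) z -> F z = f z.
Proof.
move=> n2 gN hB cB cK KB cD D0 [df Bf].
have ext i : exists G : V -> C, (forall z, N z < 1 -> differentiable G z) /\
    forall z, ([set z | N z < 1] `\` K) z -> G z = f z ord0 i.
  apply: (@hartogs_ball N K (fun z => f z ord0 i)) => // z Dz.
  by apply: diff_coord; exact: df.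
have [G GP] := choice ext.
pose F z : V := \row_i G i z.
have Ff z : ([set z | N z < 1] `\` K) z -> F z = f z.
  by move=> Dz; apply/rowP => i; rewrite mxE; have [_ ->] := GP i.
have FE : F = fun z => \sum_i G i z *: (delta_mx ord0 i : V).
  by apply/funext => z; rewrite [F z]row_sum_delta; apply: eq_bigr => i _; rewrite mxE.
have dF z : N z < 1 -> differentiable F z.
  move=> Bz; rewrite FE.
  suff h (r : seq 'I_n) : differentiable (fun z => \sum_(i <- r) G i z *: (delta_mx ord0 i : V)) z.
    exact: h.
  elim: r => [|i r IH].
    rewrite (_ : (fun _ => _) = fun=> 0); first exact: diffC.
    by apply/funext => y; rewrite big_nil.
  rewrite (_ : (fun _ => _) = fun y => G i y *: (delta_mx ord0 i : V) +
     \sum_(i <- r) G i y *: (delta_mx ord0 i : V)); last first.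
    by apply/funext => y; rewrite big_cons.
  apply: diffD => //; have [h _] := GP i.
  exact: (@differentiableZl C V V (G i) (delta_mx ord0 i) z (h z Bz)).
exists F => //; split => // w Bw; rewrite /= ltNge; apply/negP => Fw.
have [L LN Lw] := hahn_banach (F w) gN.
have dL x : differentiable L x by exact: gauge_lin gN LN.
have [|H [dH Hf H1]] := @hartogs_disk N K (fun z => L (f z)) n2 gN hB cB cK KB cD D0.
  by move=> z Dz; apply: (@diff_compf R V V C f L z) => //; exact: df.
have : nrm (H w) < 1.
  by apply: H1 => // z /Bf; exact: le_lt_trans (LN _).
have -> : H w = L (F w).
  have [p Dp] := D0; have [Bp _] := Dp.
  have oB := @open_gauge R n N 1 gN.
  have oD : open ([set z | N z < 1] `\` K).
    apply: openI => //.
    by apply: closed_openC; apply: compact_closed => //; exact: norm_hausdorff.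
  have [d d0 dP] := open_ball oD Dp.
  apply/eqP; rewrite -subr_eq0; apply/eqP.
  apply: (@identity_theorem R V [set z | N z < 1] (fun z => H z - L (F z)) p d
    oB cB _ Bp d0 _ w Bw).
  - move=> z Bz; apply: diffB; first exact: dH.
    by apply: (@diff_compf R V V C F L z) => //; exact: dF.
  - by move=> y /dP Dy; rewrite Hf // Ff // subrr.
by rewrite Lw nrm_real ger0_norm ?gauge_ge0 // ltNge Fw.
Qed.

End HartogsBall.

(** * The Caratheodory distance *)

Section HyperbolicTangent.
Context {R : realType}.
Implicit Types x y : R.

Lemma tanhE x : tanh x = 1 - 2 / (expR (2 * x) + 1).
Proof.
have e0 := expR_gt0 x.
rewrite /tanh expRN (_ : expR (2 * x) = expR x * expR x); last first.
  by rewrite mulr_natl mulr2n expRD.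
field; apply/andP; split; last by rewrite gt_eqF.
by rewrite gt_eqF // ltr_wpDl // mulr_ge0 // ltW.
Qed.

Lemma ltr_tanh x y : x < y -> tanh x < tanh y.
Proof.
move=> xy; have h : expR (2 * x) < expR (2 * y) by rewrite ltr_expR; lra.
have h0 := expR_gt0 (2 * x); rewrite !tanhE ltrD2l ltrN2 ltr_pM2l // ltf_pV2 ?posrE; lra.
Qed.

Lemma tanh0 : tanh (0 : R) = 0.
Proof. by rewrite /tanh oppr0 subrr mul0r. Qed.

Lemma artanhK x : -1 < x -> x < 1 -> tanh (artanh x) = x.
Proof.
move=> x1 x2; have q0 : 0 < (1 + x) / (1 - x) by rewrite divr_gt0; lra.
rewrite tanhE /artanh [X in expR X]mulrC divfK // lnK ?posrE //.
by field; apply/andP; split; lra.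
Qed.

Lemma ler_artanh x y : -1 < x -> x <= y -> y < 1 -> artanh x <= artanh y.
Proof.
move=> x1 xy y1; rewrite leNgt; apply/negP => /ltr_tanh.
by rewrite !artanhK; lra.
Qed.

Lemma artanh_ltP x y : -1 < x -> x < 1 -> (artanh x < y <-> x < tanh y).
Proof.
move=> x1 x2; split=> [/ltr_tanh|h]; first by rewrite artanhK.
rewrite ltNge; apply/negP; rewrite le_eqVlt => /orP[/eqP hy|/ltr_tanh].
  by move: h; rewrite hy artanhK // ltxx.
by rewrite artanhK // => h'; lra.
Qed.

Lemma sup_is_max (A : set R) m : A m -> ubound A m -> sup A = m.
Proof.
move=> Am ubm; apply/eqP; rewrite eq_le; apply/andP; split.
  by apply: ge_sup => //; exists m.
by apply: ub_le_sup => //; exists m.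
Qed.

End HyperbolicTangent.

Section CaratheodoryBall.
Context {R : realType} {n : nat}.
Local Notation C := R[i].
Local Notation V := 'rV[C]_n.
Variables (N : V -> R).
Local Notation B := [set z | N z < 1].

Lemma unit_diskP (x : C) : unit_disk x <-> nrm x < 1.
Proof. by rewrite /unit_disk /= nrmE -[1]/(1%:C%C) ltcR. Qed.

(** The functional norming [phi w], composed with [phi], attains the supremum; Schwarz's lemma for
    [F \o psi] bounds every competitor. The extension property is a hypothesis so that the lemma
    serves both the ball, where it is trivial, and the complement of the compact set, where it is
    Hartogs' theorem. *)
Lemma carath_gauge D phi z w : gauge_norm N -> D `<=` B ->
  (forall f : V -> C, holo_map D unit_disk f -> exists2 F : V -> C,
     holo_map B unit_disk F & forall y, D y -> F y = f y) ->
  automorphism B phi -> D z -> D w -> phi z = 0 ->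
  carath D z w = artanh (N (phi w)).
Proof.
move=> gN DB ext [[dphi Bphi] [psi [[dpsi Bpsi] psiK phiK]]] Dz Dw phiz.
have Bw : N (phi w) < 1 by apply: Bphi; exact: DB.
have N0 := gauge_ge0 gN.
apply: sup_is_max.
  have [L LN Lw] := hahn_banach (phi w) gN.
  exists (fun y => L (phi y)); split.
  - split=> y /DB By.
      apply: (@diff_compf R V V C phi L y); first exact: dphi.
      exact: gauge_lin gN LN.
    by apply/unit_diskP; apply: le_lt_trans (LN _) _; exact: Bphi.
  - by rewrite phiz linear0.
  - by congr artanh; rewrite -/(nrm _) Lw nrm_real ger0_norm.
move=> _ [f [hf fz ->]]; have [F [dF BF] Ff] := ext f hf.
have h : nrm (F (psi (phi w))) <= N (phi w).
  apply: (@schwarz_gauge R n N (fun y => F (psi y)) gN) => //.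
  - move=> y By; apply: (@diff_compf R V V C psi F y); first exact: dpsi.
    by apply: dF; exact: Bpsi.
  - by move=> y By; apply/ltW/unit_diskP/BF; exact: Bpsi.
  - by rewrite -phiz psiK ?Ff //; exact: DB.
move: h; rewrite psiK ?Ff //; last exact: DB.
move=> h; have f0 := nrm_ge0 (f w).
by apply: (@ler_artanh R (nrm (f w)) (N (phi w)) _ h Bw); lra.
Qed.

Lemma carath_ball_gauge D phi z (r : R) : gauge_norm N -> D `<=` B ->
  (forall f : V -> C, holo_map D unit_disk f -> exists2 F : V -> C,
     holo_map B unit_disk F & forall y, D y -> F y = f y) ->
  automorphism B phi -> D z -> phi z = 0 ->
  forall w, carath_ball D z r w <-> D w /\ N (phi w) < tanh r.
Proof.
move=> gN DB ext aphi Dz phiz w; rewrite /carath_ball /=.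
have N0 := gauge_ge0 gN (phi w).
have H : D w -> (carath D z w < r <-> N (phi w) < tanh r).
  move=> Dw; rewrite (@carath_gauge D phi z w) //; apply: artanh_ltP; first by lra.
  by have [[_ Bphi] _] := aphi; apply: Bphi; exact: DB.
by split=> -[Dw] /(H Dw).
Qed.

Lemma carath_dist_gauge S phi z (d : R) : gauge_norm N -> S `<=` B ->
  automorphism B phi -> B z -> phi z = 0 ->
  is_min [set N (phi w) | w in S] d -> is_carath_dist B S z d.
Proof.
move=> gN SB aphi Bz phiz; rewrite /is_carath_dist.
suff -> : [set tanh (carath B z w) | w in S] = [set N (phi w) | w in S] by [].
apply: eq_imagel => w /SB Bw; rewrite (@carath_gauge B phi z w) //; last first.
  by move=> f hf; exists f.
have [[_ Bphi] _] := aphi; rewrite artanhK //; last exact: Bphi.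
by apply: lt_le_trans (gauge_ge0 gN _); lra.
Qed.

End CaratheodoryBall.

(** * Levi forms and analytic discs *)

Section RealTaylor.
Context {R : realType} {n : nat}.
Local Notation C := R[i].
Local Notation V := 'rV[C]_n.
Implicit Types (f g h : V -> R) (U : set V) (a b : bool * 'I_n).

Definition has_deriv (k : R -> R) (t d : R) := forall e : R, 0 < e ->
  exists2 r : R, 0 < r & forall u, `|u| < r -> `|k (t + u) - k t - d * u| <= e * `|u|.

Lemma has_derivP k t d : has_deriv k t d -> is_derive t 1 k d.
Proof.
move=> kd; apply/is_derive1_caratheodory.
exists (fun z => if z == t then d else (k z - k t) / (z - t)); split.
- move=> z; case: eqVneq => [->|zt]; first by rewrite !subrr mulr0.
  by rewrite divfK // subr_eq0.
- apply/cvgrPdist_le => e e0; rewrite eqxx; have [r r0 rP] := kd e e0.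
  apply/nbhs_ballP; exists r => //= z; rewrite /ball /= distrC => zt.
  case: eqVneq => [_|zt0]; first by rewrite subrr normr0 ltW.
  have zt1 : 0 < `|z - t| by rewrite normr_gt0 subr_eq0.
  have := rP (z - t) zt; rewrite [t + _]addrC subrK distrC => h.
  rewrite -(ler_pM2r zt1) -normrM mulrBl divfK ?subr_eq0 //.
- by rewrite eqxx.
Qed.

Lemma has_deriv_lin k t (d c : R) : has_deriv k t d ->
  has_deriv (fun s => k s - c * s) t (d - c).
Proof.
move=> kd e e0; have [r r0 rP] := kd e e0; exists r => // u /rP.
by rewrite (_ : k (t + u) - c * (t + u) - (k t - c * t) - (d - c) * u =
  k (t + u) - k t - d * u); last by ring.
Qed.

Lemma has_deriv_sqr k t (d c : R) : has_deriv k t d ->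
  has_deriv (fun s => k s - c * s ^+ 2) t (d - 2 * c * t).
Proof.
move=> kd e e0; have [r r0 rP] := kd (e / 2) (divr_gt0 e0 (ltr0Sn _ _)).
have c1 : 0 < 2 * (`|c| + 1) by rewrite mulr_gt0 // ltr_wpDl.
exists (Num.min r (e / (2 * (`|c| + 1)))); first by rewrite lt_min r0 divr_gt0.
move=> u; rewrite lt_min => /andP[/rP h1]; rewrite ltr_pdivlMr // => h2.
rewrite (_ : _ - _ = (k (t + u) - k t - d * u) - c * u * u); last by ring.
apply: le_trans (ler_normB _ _) _; rewrite !normrM.
have h3 : `|c| * `|u| <= e / 2.
  have := normr_ge0 u; have := normr_ge0 c; nra.
have := ler_wpM2r (normr_ge0 u) h3; lra.
Qed.

Lemma mean_value_bound k (dk : R -> R) (M : R) :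
  (forall t, 0 <= t <= 1 -> has_deriv k t (dk t)) ->
  (forall t, 0 <= t <= 1 -> `|dk t| <= M) -> `|k 1 - k 0| <= M.
Proof.
move=> kd kM.
have [||c] := @MVT R k dk 0 1 ltr01.
- by move=> x; rewrite in_itv /= => /andP[/ltW x0 /ltW x1]; apply/has_derivP/kd; rewrite x0.
- apply: derivable_within_continuous => x; rewrite in_itv /= => x01.
  by have [] := has_derivP (kd x x01).
by rewrite in_itv /= => /andP[/ltW c0 /ltW c1] ->; rewrite subr0 mulr1 kM // c0.
Qed.

Definition rcoord a (x : V) : R :=
  if a.1 then complex.Im (x ord0 a.2) else complex.Re (x ord0 a.2).
Definition dir a : V := rdir a.1 a.2.
Definition pd a f : V -> R := rpartial a.1 a.2 f.

Lemma nrm_dir a : nrm (dir a) <= 1.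
Proof.
have i1 : nrm ('i%C : C) <= 1.
  by rewrite -(@ler_pXn2r R 2) ?nnegrE ?nrm_ge0 // nrm_sqr /= expr1n; lra.
rewrite /dir /rdir nrmZ; apply: (@le_trans _ _ (1 * 1)); last by rewrite mulr1.
apply: ler_pM; rewrite ?nrm_ge0 //; first by case: a.1; rewrite ?nrm1.
apply: nrm_rowle => // j; rewrite mxE /=.
by case: (j == a.2); rewrite /= ?nrm1 ?nrm0 ?ler01.
Qed.

Lemma rcoord_sum x : x = \sum_a (rcoord a x)%:C%C *: dir a.
Proof.
rewrite (eq_bigr (fun a : bool * 'I_n => (rcoord (a.1, a.2) x)%:C%C *: dir (a.1, a.2))).
  rewrite -(pair_bigA _ (fun (b : bool) j => (rcoord (b, j) x)%:C%C *: dir (b, j))) /=.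
  rewrite big_bool /= -big_split /=.
  rewrite [LHS]row_sum_delta; apply: eq_bigr => j _.
  rewrite /rcoord /dir /rdir /= scale1r scalerA -scalerDl; congr (_ *: _).
  by case: (x ord0 j) => u v; simpc.
by case.
Qed.

Lemma rcoord_le a x : `|rcoord a x| <= nrm x.
Proof.
apply: le_trans (nrm_coord x a.2); rewrite /rcoord.
by case: ifP => _; [exact: Im_le_nrm|exact: Re_le_nrm].
Qed.

Lemma rcoordD a x y : rcoord a (x + y) = rcoord a x + rcoord a y.
Proof. by rewrite /rcoord !mxE; case: ifP; rewrite raddfD. Qed.

Lemma rcoordZ a (t : R) x : rcoord a (t%:C%C *: x) = t * rcoord a x.
Proof.
by rewrite /rcoord !mxE; case: ifP => _; case: (x _ _) => u v; simpc.
Qed.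

Lemma rcoord_dir a b : rcoord a (dir b) = (a == b)%:R.
Proof.
case: a b => [a i] [b j]; rewrite /rcoord /dir /rdir !mxE /= -pair_eqE /pair_eq /=.
by case: a b => [] []; case: (i == j); simpc.
Qed.

Lemma Ck_pd k U f a : Ck_on k.+1 U f -> Ck_on k U (pd a f).
Proof. by move=> [_ /(_ a.1 a.2) []]. Qed.

Lemma pd_deriv k U f a z : Ck_on k.+1 U f -> U z ->
  has_deriv (fun t => f (z + t%:C%C *: dir a)) 0 (pd a f z).
Proof.
move=> [_ /(_ a.1 a.2) [df _]] Uz; apply: is_derive_nrmP.
by rewrite /pd /rpartial derive1E; exact: derivableP (df z Uz).
Qed.

Lemma pd_deriv_at k U f a z (c t : R) : Ck_on k.+1 U f -> U (z + (t * c)%:C%C *: dir a) ->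
  has_deriv (fun t => f (z + (t * c)%:C%C *: dir a)) t
            (pd a f (z + (t * c)%:C%C *: dir a) * c).
Proof.
move=> fC Uz e e0; have c1 : 0 < `|c| + 1 by rewrite ltr_wpDl.
have [r r0 rP] := pd_deriv a fC Uz (divr_gt0 e0 c1).
exists (r / (`|c| + 1)); first exact: divr_gt0.
move=> u; rewrite ltr_pdivlMr // => ur.
have uc : `|u * c| <= `|u| * (`|c| + 1) by rewrite normrM ler_wpM2l // lerDl.
have := rP (u * c) (le_lt_trans uc ur).
have -> : z + ((t + u) * c)%:C%C *: dir a =
    z + (t * c)%:C%C *: dir a + (u * c)%:C%C *: dir a.
  by rewrite mulrDl rmorphD scalerDl addrA.
rewrite add0r scale0r addr0 -!mulrA [c * u]mulrC => h.
by apply: le_trans h _; rewrite ler_pM2l // mulrC ler_pdivrMr.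
Qed.

(** The directions of the list are followed one at a time, each step being estimated by the mean
    value theorem and continuity of one partial derivative; [y] accumulates the displacement already
    made. *)
Lemma C1_list U f z (s : seq (bool * 'I_n)) : open U -> Ck_on 1 U f -> U z ->
  forall e : R, 0 < e -> exists2 d : R, 0 < d & forall y (c : bool * 'I_n -> R),
    nrm y + \sum_(a <- s) `|c a| < d ->
    `|f (z + (y + \sum_(a <- s) (c a)%:C%C *: dir a)) - f (z + y) -
      \sum_(a <- s) pd a f z * c a| <= e * \sum_(a <- s) `|c a|.
Proof.
move=> oU fC Uz e e0; elim: s => [|a s [d d0 IH]].
  by exists 1 => // y c _; rewrite !big_nil addr0 subrr subr0 normr0 mulr0.
have [d1 d10 d1P] := open_ball oU Uz.
have [d2 d20 d2P] : exists2 d : R, 0 < d &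
    forall y, nrm (y - z) < d -> `|pd a f y - pd a f z| <= e.
  have [cf _] := Ck_pd a fC.
  have /(@cvgrPdist_le _ _ _ _ _) /(_ e e0) /nbhs_nrmP [d2 d20 h] := cf z Uz.
  by exists d2 => // y /h; rewrite distrC.
exists (Num.min d (Num.min d1 d2)); first by rewrite !lt_min d0 d10.
move=> y c; rewrite !big_cons !lt_min => /andP[h0 /andP[h1 h2]].
have S0 : 0 <= \sum_(a <- s) `|c a| by apply: sumr_ge0.
have ca : forall t : R, 0 <= t <= 1 -> nrm ((t * c a)%:C%C *: dir a) <= `|c a|.
  move=> t /andP[t0 t1]; rewrite nrmZ nrm_real normrM (ger0_norm t0).
  have := nrm_dir a; have := nrm_ge0 (dir a); have := normr_ge0 (c a) => p0 p1 p2.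
  have q : t * `|c a| <= `|c a| by rewrite ler_piMl.
  have q0 : 0 <= t * `|c a| by rewrite mulr_ge0.
  by nra.
have near t : 0 <= t <= 1 -> nrm (z + y + (t * c a)%:C%C *: dir a - z) <
    Num.min d1 d2.
  move=> /ca h; rewrite addrAC [z + y]addrC addrK lt_min.
  have := nrmD y ((t * c a)%:C%C *: dir a); lra.
have step : `|f (z + (y + (c a)%:C%C *: dir a)) - f (z + y) - pd a f z * c a| <= e * `|c a|.
  pose k t := f (z + y + (t * c a)%:C%C *: dir a) - pd a f z * c a * t.
  have -> : f (z + (y + (c a)%:C%C *: dir a)) - f (z + y) - pd a f z * c a = k 1 - k 0.
    by rewrite /k !mul1r mul0r mulr0 mulr1 scale0r addr0 subr0 [z + (y + _)]addrA [LHS]addrAC.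
  apply: (@mean_value_bound k
    (fun t => pd a f (z + y + (t * c a)%:C%C *: dir a) * c a - pd a f z * c a)).
    move=> t t01; apply: has_deriv_lin; apply: (pd_deriv_at fC).
    by apply: d1P; have := near t t01; rewrite lt_min => /andP[].
  move=> t /near; rewrite lt_min => /andP[_ /d2P h].
  by rewrite -mulrBl normrM ler_wpM2r.
have h01 : 0 <= (1 : R) <= 1 by rewrite ler01 lexx.
have h := ca 1 h01; rewrite mul1r in h.
have h' : nrm (y + (c a)%:C%C *: dir a) + \sum_(a <- s) `|c a| < d.
  have := nrmD y ((c a)%:C%C *: dir a); lra.
have := IH _ _ h'; rewrite -!addrA in step * => h3.
set A := f (z + (y + ((c a)%:C%C *: dir a + _))) in h3 *.
set B := f (z + (y + (c a)%:C%C *: dir a)) in h3 step.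
set S := \sum_(a <- s) _ * _ in h3 *; set T := \sum_(a <- s) _ in h3 *.
move: h3 step; rewrite mulrDr !ler_norml; lra.
Qed.

Lemma C1_frechet U f z : open U -> Ck_on 1 U f -> U z ->
  forall e : R, 0 < e -> exists2 d : R, 0 < d & forall x, nrm x < d ->
    `|f (z + x) - f z - \sum_a pd a f z * rcoord a x| <= e * nrm x.
Proof.
move=> oU fC Uz e e0; pose m : R := #|{: bool * 'I_n}|%:R.
have m0 : 0 <= m by exact: ler0n.
have sm x : \sum_a `|rcoord a x| <= m * nrm x.
  apply: le_trans (ler_sum _ (fun a _ => rcoord_le a x)) _.
  by rewrite sumr_const mulr_natl.
have m1 : 0 < m + 1 by lra.
have [d d0 dP] := C1_list (index_enum _) oU fC Uz (divr_gt0 e0 m1).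
exists (d / (m + 1)); first exact: divr_gt0.
move=> x; rewrite ltr_pdivlMr // => xd.
have x0 := nrm_ge0 x; have smx := sm x.
have := dP 0 (fun a => rcoord a x); rewrite nrm0 add0r -rcoord_sum addr0 add0r => h.
apply: le_trans (h _) _; first by lra.
rewrite mulrAC ler_pdivrMr // -mulrA ler_pM2l //; lra.
Qed.

Definition grad f z x : R := \sum_a pd a f z * rcoord a x.
Definition hess f z x y : R := \sum_a \sum_b pd b (pd a f) z * rcoord b x * rcoord a y.

Lemma gradD f z x y : grad f z (x + y) = grad f z x + grad f z y.
Proof. by rewrite -big_split /=; apply: eq_bigr => a _; rewrite rcoordD mulrDr. Qed.

Lemma gradZ f z (t : R) x : grad f z (t%:C%C *: x) = t * grad f z x.
Proof. by rewrite mulr_sumr; apply: eq_bigr => a _; rewrite rcoordZ mulrCA. Qed.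

Lemma hessDl f z x x' y : hess f z (x + x') y = hess f z x y + hess f z x' y.
Proof.
rewrite -big_split; apply: eq_bigr => a _; rewrite -big_split; apply: eq_bigr => b _ /=.
by rewrite rcoordD mulrDr mulrDl.
Qed.

Lemma hessDr f z x y y' : hess f z x (y + y') = hess f z x y + hess f z x y'.
Proof.
rewrite -big_split; apply: eq_bigr => a _; rewrite -big_split; apply: eq_bigr => b _ /=.
by rewrite rcoordD mulrDr.
Qed.

Lemma hessZl f z (t : R) x y : hess f z (t%:C%C *: x) y = t * hess f z x y.
Proof.
rewrite mulr_sumr; apply: eq_bigr => a _; rewrite mulr_sumr; apply: eq_bigr => b _.
by rewrite rcoordZ; ring.
Qed.

Lemma hessZr f z (t : R) x y : hess f z x (t%:C%C *: y) = t * hess f z x y.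
Proof.
rewrite mulr_sumr; apply: eq_bigr => a _; rewrite mulr_sumr; apply: eq_bigr => b _.
by rewrite rcoordZ; ring.
Qed.

Lemma hess_bound f z : exists2 M : R, 0 <= M &
  forall x y, `|hess f z x y| <= M * nrm x * nrm y.
Proof.
exists (\sum_a \sum_b `|pd b (pd a f) z|).
  by apply: sumr_ge0 => a _; apply: sumr_ge0.
move=> x y; rewrite -mulrA mulr_suml; apply: le_trans (ler_norm_sum _ _ _) _.
apply: ler_sum => a _; rewrite mulr_suml; apply: le_trans (ler_norm_sum _ _ _) _.
apply: ler_sum => b _; rewrite -mulrA !normrM ler_wpM2l //.
by apply: ler_pM => //; exact: rcoord_le.
Qed.

Theorem taylor2 U f z : open U -> Ck_on 2 U f -> U z ->
  forall e : R, 0 < e -> exists2 d : R, 0 < d & forall x, nrm x < d ->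
    `|f (z + x) - f z - grad f z x - hess f z x x / 2| <= e * nrm x ^+ 2.
Proof.
move=> oU fC Uz e e0; have [d1 d10 d1P] := open_ball oU Uz.
pose m : R := #|{: bool * 'I_n}|%:R.
have m0 : 0 <= m by exact: ler0n.
have m1 : 0 < m + 1 by lra.
have fC1 : Ck_on 1 U f.
  have [cf df] := fC; split => // b j; have [df1 [cf1 _]] := df b j; split => //.
have [d2 d20 d2P] : exists2 d : R, 0 < d & forall a x, nrm x < d ->
    `|pd a f (z + x) - pd a f z - grad (pd a f) z x| <= e / (m + 1) * nrm x.
  suff [d d0 dP] : exists2 d : R, 0 < d & forall a, a \in index_enum {: bool * 'I_n} ->
      forall x, nrm x < d ->
      `|pd a f (z + x) - pd a f z - grad (pd a f) z x| <= e / (m + 1) * nrm x.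
    by exists d => // a; apply: dP; rewrite mem_index_enum.
  elim: (index_enum _) => [|a s [d d0 IH]]; first by exists 1.
  have [d' d'0 d'P] := C1_frechet oU (Ck_pd a fC) Uz (divr_gt0 e0 m1).
  exists (Num.min d d'); first by rewrite lt_min d0.
  move=> b; rewrite inE => /orP[/eqP ->|/IH h] x; rewrite lt_min => /andP[h1 h2].
    exact: d'P.
  exact: h.
exists (Num.min d1 d2); first by rewrite lt_min d10.
move=> x; rewrite lt_min => /andP[x1 x2].
have small t : 0 <= t <= 1 -> nrm (t%:C%C *: x) <= nrm x.
  by move=> /andP[t0 t1]; rewrite nrmZ nrm_real (ger0_norm t0) ler_piMl ?nrm_ge0.
(* The derivative of [k] is the sum of the first order remainders of the partial derivatives, each
   weighted by a coordinate of [x]; [C1_frechet] makes these small. *)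
pose k (t : R) := f (z + t%:C%C *: x) - grad f z x * t - hess f z x x / 2 * t ^+ 2.
have -> : f (z + x) - f z - grad f z x - hess f z x x / 2 = k 1 - k 0.
  by rewrite /k scale1r scale0r addr0 !mulr0 expr1n expr0n /= mulr0 !mulr1; ring.
apply: (@mean_value_bound k (fun t => grad f (z + t%:C%C *: x) x - grad f z x -
   2 * (hess f z x x / 2) * t)).
  move=> t t01; apply: has_deriv_sqr; apply: has_deriv_lin.
  have Ut : U (z + t%:C%C *: x).
    by apply: d1P; rewrite addrC addKr; apply: le_lt_trans (small t t01) _.
  move=> e' e'0; have x10 : 0 < nrm x + 1 by rewrite ltr_wpDl ?nrm_ge0.
  have [d d0 dP] := C1_frechet oU fC1 Ut (divr_gt0 e'0 x10).
  exists (d / (nrm x + 1)); first exact: divr_gt0.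
  move=> u; rewrite ltr_pdivlMr // => ud; have u0 := normr_ge0 u.
  have nu : nrm (u%:C%C *: x) <= `|u| * (nrm x + 1).
    by rewrite nrmZ nrm_real ler_wpM2l // lerDl.
  have := dP _ (le_lt_trans nu ud); rewrite -/(grad _ _ _) gradZ.
  have -> : z + (t + u)%:C%C *: x = z + t%:C%C *: x + u%:C%C *: x.
    by rewrite rmorphD scalerDl addrA.
  rewrite [u * _]mulrC => h; apply: le_trans h _.
  by rewrite -mulrA ler_pM2l // mulrC ler_pdivrMr.
move=> t t01; have /andP[t0 t1] := t01.
have -> : grad f (z + t%:C%C *: x) x - grad f z x - 2 * (hess f z x x / 2) * t =
    \sum_a (pd a f (z + t%:C%C *: x) - pd a f z - grad (pd a f) z (t%:C%C *: x)) *
           rcoord a x.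
  have -> : 2 * (hess f z x x / 2) * t = \sum_a grad (pd a f) z (t%:C%C *: x) * rcoord a x.
    rewrite [2 * _]mulrC divfK // [_ * t]mulrC mulr_sumr; apply: eq_bigr => a _.
    by rewrite gradZ -mulrA /grad mulr_suml.
  by rewrite /grad -!sumrB; apply: eq_bigr => a _; rewrite !mulrBl.
apply: le_trans (ler_norm_sum _ _ _) _.
have x0 := nrm_ge0 x.
apply: (@le_trans _ _ (\sum_(a : bool * 'I_n) e / (m + 1) * nrm x * nrm x)).
  apply: ler_sum => a _; rewrite normrM; apply: ler_pM => //; last exact: rcoord_le.
  have st := small t t01; apply: le_trans (d2P a _ (le_lt_trans st x2)) _.
  by rewrite ler_wpM2l // divr_ge0 // ltW.
rewrite sumr_const -[_ *+ _]mulr_natl -/m -mulrA -expr2 mulrA ler_wpM2r ?sqr_ge0 //.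
by rewrite mulrCA ler_piMr ?(ltW e0) // ler_pdivrMr //; lra.
Qed.

End RealTaylor.

(** * From Wirtinger derivatives to discs outside the domain *)

Section LeviDiscs.
Context {R : realType} {n : nat}.
Local Notation C := R[i].
Local Notation V := 'rV[C]_n.
Implicit Types (f rho : V -> R) (U : set V) (a b : bool * 'I_n).

Lemma pd_unique f a z d : has_deriv (fun t => f (z + t%:C%C *: dir a)) 0 d -> pd a f z = d.
Proof. by move=> /has_derivP h; rewrite /pd /rpartial derive1E; exact: derive_val. Qed.

Lemma pd_cst (c : R) a z : pd a (fun=> c) z = 0.
Proof.
apply: pd_unique => e e0; exists 1 => // u _.
by rewrite subrr sub0r mul0r oppr0 normr0 mulr_ge0 // ltW.
Qed.

Lemma pd_half U f a z : Ck_on 1 U f -> U z -> pd a (fun y => f y / 2) z = pd a f z / 2.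
Proof.
move=> fC Uz; apply: pd_unique => e e0.
have [r r0 rP] := pd_deriv a fC Uz e0; exists r => // u /rP h.
have -> : f (z + (0 + u)%:C%C *: dir a) / 2 - f (z + 0%:C%C *: dir a) / 2 -
    pd a f z / 2 * u = (f (z + (0 + u)%:C%C *: dir a) - f (z + 0%:C%C *: dir a) -
    pd a f z * u) / 2 by ring.
rewrite normrM (ger0_norm (_ : 0 <= 2^-1 :> R)) //.
have := normr_ge0 (f (z + (0 + u)%:C%C *: dir a) - f (z + 0%:C%C *: dir a) - pd a f z * u).
by lra.
Qed.

Lemma complex_half (x y : R) : (x +i* y)%C / 2 = (x / 2 +i* (y / 2))%C.
Proof.
have two : (2 : C) != 0 by rewrite pnatr_eq0.
apply: (mulIf two); rewrite divfK // mulr_natr mulr2n; simpc.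
by rewrite -!splitr.
Qed.

Lemma cpartial_pair (f g : V -> R) (k : bool) j z :
  cpartial k j (fun y => (f y +i* g y)%C) z = (pd (k, j) f z +i* pd (k, j) g z)%C.
Proof. by []. Qed.

Lemma cpartial_real f (k : bool) j z :
  cpartial k j (fun y => (f y)%:C%C) z = (pd (k, j) f z)%:C%C.
Proof.
have -> : cpartial k j (fun y => (f y)%:C%C) z = (pd (k, j) f z +i* pd (k, j) (fun=> 0) z)%C.
  by [].
by rewrite pd_cst.
Qed.

Lemma wirtinger_minus (x y x' y' : R) :
  ((x +i* y)%C - 'i%C * (x' +i* y')%C) / 2 = ((x + y') / 2 +i* ((y - x') / 2))%C.
Proof. by rewrite -complex_half; congr (_ / 2); simpc. Qed.

Lemma wirtinger_plus (x x' : R) :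
  (x%:C%C + 'i%C * x'%:C%C) / 2 = (x / 2 +i* (x' / 2))%C.
Proof. by rewrite -complex_half; congr (_ / 2); simpc. Qed.

Lemma dz_real rho j z :
  dz j (fun y => (rho y)%:C%C) z = (pd (false, j) rho z / 2 +i* - (pd (true, j) rho z / 2))%C.
Proof.
rewrite /dz (cpartial_real rho false j z) (cpartial_real rho true j z).
by rewrite wirtinger_minus addr0 sub0r mulNr.
Qed.

Lemma dzbar_real rho j : dzbar j (fun y => (rho y)%:C%C) =
  fun z => (pd (false, j) rho z / 2 +i* (pd (true, j) rho z / 2))%C.
Proof.
apply/funext => z; rewrite /dzbar (cpartial_real rho false j z) (cpartial_real rho true j z).
exact: wirtinger_plus.
Qed.

Lemma half_quarterD (x y u v : R) : x = u / 2 -> y = v / 2 -> (x + y) / 2 = (u + v) / 4.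
Proof. by move=> -> ->; field. Qed.

Lemma half_quarterB (x y u v : R) : x = u / 2 -> y = v / 2 -> (x - y) / 2 = (u - v) / 4.
Proof. by move=> -> ->; field. Qed.

Lemma dz_dzbar_real U rho j k z : Ck_on 2 U rho -> U z ->
  dz j (dzbar k (fun y => (rho y)%:C%C)) z =
  ((pd (false, j) (pd (false, k) rho) z + pd (true, j) (pd (true, k) rho) z) / 4 +i*
   ((pd (false, j) (pd (true, k) rho) z - pd (true, j) (pd (false, k) rho) z) / 4))%C.
Proof.
move=> rC Uz; rewrite dzbar_real /dz.
rewrite (cpartial_pair (fun z => pd (false, k) rho z / 2) (fun z => pd (true, k) rho z / 2) false).
rewrite (cpartial_pair (fun z => pd (false, k) rho z / 2) (fun z => pd (true, k) rho z / 2) true).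
have e (b b' : bool) : pd (b, j) (fun y => pd (b', k) rho y / 2) z =
    pd (b, j) (pd (b', k) rho) z / 2.
  exact: (@pd_half U (pd (b', k) rho) (b, j) z (Ck_pd (b', k) rC) Uz).
rewrite wirtinger_minus; congr (_ +i* _)%C.
  exact: half_quarterD (e false false) (e true true).
exact: half_quarterB (e false true) (e true false).
Qed.

Lemma sum_bool_ord (F : bool * 'I_n -> R) :
  \sum_a F a = \sum_j (F (true, j) + F (false, j)).
Proof.
rewrite (eq_bigr (fun a : bool * 'I_n => F (a.1, a.2))); last by case.
by rewrite -(pair_bigA _ (fun (b : bool) j => F (b, j))) /= big_bool /= -big_split.
Qed.

Lemma rcoord_i (b : bool) j (v : V) : rcoord (b, j) ('i%C *: v) =
  if b then rcoord (false, j) v else - rcoord (true, j) v.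
Proof. by rewrite /rcoord mxE /=; case: (v ord0 j) => x y; case: b; simpc. Qed.

(** The real and imaginary parts of the complex equation are, up to factors [1 / 2] and [- 1 / 2],
    the two real ones. *)
Lemma tangent_grad rho z (v : V) : complex_tangent rho z v ->
  grad rho z v = 0 /\ grad rho z ('i%C *: v) = 0.
Proof.
move=> /eqP; rewrite eq_complex => /andP[/eqP h1 /eqP h2].
have term (p q : R) (u : C) : (p / 2 +i* - (q / 2))%C * u =
    ((p * complex.Re u + q * complex.Im u) / 2 +i*
     ((p * complex.Im u - q * complex.Re u) / 2))%C.
  by case: u => x y; simpc; rewrite /=; congr (_ +i* _)%C; field.
have zeroR : \sum_j (pd (false, j) rho z * rcoord (false, j) v +
    pd (true, j) rho z * rcoord (true, j) v) = 0.
  apply: (mulIf (_ : 2^-1 != 0 :> R)); first by rewrite invr_eq0 pnatr_eq0.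
  rewrite mul0r -[RHS]h1 raddf_sum mulr_suml; apply: eq_bigr => j _.
  by rewrite dz_real term.
have zeroI : \sum_j (pd (false, j) rho z * rcoord (true, j) v -
    pd (true, j) rho z * rcoord (false, j) v) = 0.
  apply: (mulIf (_ : 2^-1 != 0 :> R)); first by rewrite invr_eq0 pnatr_eq0.
  rewrite mul0r -[RHS]h2 raddf_sum mulr_suml; apply: eq_bigr => j _.
  by rewrite dz_real term.
rewrite /grad !sum_bool_ord; split.
  by rewrite -[RHS]zeroR; apply: eq_bigr => j _; rewrite addrC.
rewrite -[RHS]oppr0 -[in RHS]zeroI -sumrN; apply: eq_bigr => j _.
have swap (p q a b x y : R) : a = x -> b = - y -> p * a + q * b = - (q * y - p * x).
  by move=> -> ->; ring.
exact: swap (rcoord_i true j v) (rcoord_i false j v).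
Qed.

(** The sum of the two Hessian values is four times the real part of the Levi form; the proof
    matches the terms for each pair of indices. *)
Lemma levi_hess U rho z (v : V) : Ck_on 2 U rho -> U z -> 0 < levi_form rho z v ->
  0 < hess rho z v v + hess rho z ('i%C *: v) ('i%C *: v).
Proof.
move=> rC Uz; rewrite ltcE => /andP[_ /= h].
have term (p q r s : R) (u u' : C) :
    p * complex.Re u * complex.Re u' + q * complex.Re u * complex.Im u' +
    r * complex.Im u * complex.Re u' + s * complex.Im u * complex.Im u' +
    (p * complex.Im u * complex.Im u' - q * complex.Im u * complex.Re u' -
    r * complex.Re u * complex.Im u' + s * complex.Re u * complex.Re u') =
    4 * complex.Re (((p + s) / 4 +i* ((q - r) / 4))%C * u * u'^*%C).
  by case: u u' => x y [x' y']; simpc => /=; field.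
suff -> : hess rho z v v + hess rho z ('i%C *: v) ('i%C *: v) =
  4 * complex.Re (levi_form rho z v) by rewrite mulr_gt0.
rewrite /levi_form raddf_sum mulr_sumr /hess !sum_bool_ord -big_split /=.
under [RHS]eq_bigr do rewrite raddf_sum mulr_sumr.
rewrite [RHS]exchange_big; apply: eq_bigr => k _; rewrite /= !sum_bool_ord -!big_split /=.
apply: eq_bigr => j _; rewrite (dz_dzbar_real _ _ rC Uz).
apply: etrans (term _ _ _ _ _ _).
have swap (s q r p x y x' y' X Y X' Y' : R) : X = x -> Y = - y -> X' = x' -> Y' = - y' ->
    s * y * y' + q * x * y' + (r * y * x' + p * x * x') +
      (s * X * X' + q * Y * X' + (r * X * Y' + p * Y * Y')) =
    p * x * x' + q * x * y' + r * y * x' + s * y * y' +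
      (p * y * y' - q * y * x' - r * x * y' + s * x * x').
  by move=> -> -> -> ->; ring.
exact: swap (rcoord_i true j v) (rcoord_i false j v)
  (rcoord_i true k v) (rcoord_i false k v).
Qed.

Lemma scale_complex (x y : R) (v : V) : (x +i* y)%C *: v = x%:C%C *: v + y%:C%C *: ('i%C *: v).
Proof. by rewrite scalerA -scalerDl; congr (_ *: _); simpc. Qed.

Lemma grad_complex rho z (q : C) (v : V) : grad rho z (q *: v) =
  complex.Re q * grad rho z v + complex.Im q * grad rho z ('i%C *: v).
Proof. by case: q => x y; rewrite scale_complex gradD !gradZ. Qed.

Lemma hess_add rho z (x y : V) : hess rho z (x + y) (x + y) =
  hess rho z x x + hess rho z x y + (hess rho z y x + hess rho z y y).
Proof. by rewrite hessDl !hessDr. Qed.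

Lemma hess_complex rho z (q : C) (v : V) : hess rho z (q *: v) (q *: v) =
  complex.Re q ^+ 2 * hess rho z v v +
  complex.Re q * complex.Im q * (hess rho z v ('i%C *: v) + hess rho z ('i%C *: v) v) +
  complex.Im q ^+ 2 * hess rho z ('i%C *: v) ('i%C *: v).
Proof.
case: q => x y; rewrite scale_complex !hessDl !hessDr !hessZl !hessZr /=.
have assoc (a b c d : R) : x * (x * a) + x * (y * b) + (y * (x * c) + y * (y * d)) =
  x ^+ 2 * a + x * y * (b + c) + y ^+ 2 * d by ring.
exact: assoc.
Qed.

(* [w] cancels the part of the second order term that is not a multiple of
   [|zeta|^2]. *)
Theorem levi_discs U rho Q (v : V) (d : R) : open U -> Ck_on 2 U rho -> U Q -> rho Q = 0 ->
  (exists (b : bool) j, rpartial b j rho Q != 0) -> complex_tangent rho Q v ->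
  0 < levi_form rho Q v -> 0 < d ->
  exists (w nu : V) (r : R), 0 < r /\ forall (zeta : C) (t : R),
    nrm zeta <= r -> 0 <= t -> t <= r ->
    nrm (zeta *: v + zeta ^+ 2 *: w + t%:C%C *: nu) < d /\
    (0 < nrm zeta + t -> 0 < rho (Q + (zeta *: v + zeta ^+ 2 *: w + t%:C%C *: nu))).
Proof.
move=> oU rC UQ rQ [b0 [j0 grad0]] tv lv d0.
have [gv giv] := tangent_grad tv; have Hpos := levi_hess rC UQ lv.
pose G x := grad rho Q x; pose H x y := hess rho Q x y.
pose iv := 'i%C *: v.
set a := hess _ _ v v in Hpos; set b := hess _ _ _ _ in Hpos.
pose c := H v iv; pose e := H iv v.
have [nu Gnu] : exists nu, G nu = 1.
  exists ((pd (b0, j0) rho Q)^-1%:C%C *: dir (b0, j0)); rewrite /G gradZ /grad.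
  rewrite (bigD1 (b0, j0)) //= big1 ?addr0 => [|a' a'b]; last first.
    by rewrite rcoord_dir (negbTE a'b) mulr0.
  by rewrite rcoord_dir eqxx mulr1 mulVf.
(* For [zeta = x + i y], half the Hessian at [zeta *: v] is [(a + b) / 4 * |zeta|^2 + (a - b) / 4 *
   (x^2 - y^2) + (c + e) / 2 * x * y], while [zeta ^+ 2 *: w] contributes [(x^2 - y^2) * G w + 2 * x
   * y * G ('i *: w)]. So [G w] and [G ('i *: w)] must be [A] and [B]; [al] solves these two linear
   equations for [w = al *: nu]. *)
pose A := - (a - b) / 4; pose B := - (c + e) / 4; pose be := G ('i%C *: nu).
have be1 : 1 + be ^+ 2 != 0 by rewrite gt_eqF // ltr_wpDr ?sqr_ge0.
pose al := ((A + be * B) / (1 + be ^+ 2) +i* ((be * A - B) / (1 + be ^+ 2)))%C.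
pose w := al *: nu.
have Gw : G w = A.
  by rewrite /w /al scale_complex /G gradD !gradZ -/(G _) -/(G ('i%C *: _)) Gnu -/be; field.
have Giw : G ('i%C *: w) = B.
  have -> : 'i%C *: w = (- ((be * A - B) / (1 + be ^+ 2)) +i*
      ((A + be * B) / (1 + be ^+ 2)))%C *: nu.
    by rewrite /w scalerA; congr (_ *: _); rewrite /al; simpc.
  by rewrite scale_complex /G gradD !gradZ -/(G _) -/(G ('i%C *: _)) Gnu -/be; field.
have [M M0 MP] := hess_bound rho Q.
pose m := nrm v + nrm w + nrm nu + 1.
have v0 := nrm_ge0 v; have w0 := nrm_ge0 w; have nu0 := nrm_ge0 nu.
have m0 : 0 < m by rewrite /m ltr_wpDl // !addr_ge0.
have vm : nrm v <= m by rewrite /m -!addrA lerDl !addr_ge0.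
have wm : nrm w <= m by rewrite /m [nrm v + _]addrC -!addrA lerDl !addr_ge0.
have num : nrm nu <= m by rewrite /m [_ + nrm nu]addrC -!addrA lerDl !addr_ge0.
(* The main part is at least [ka * (s ^+ 2 + t)] with [s = nrm zeta]. The terms containing [Z] and
   the Taylor error will each take at most a quarter of [ka]. *)
pose ka := Num.min ((a + b) / 4) 1.
have ka0 : 0 < ka by rewrite lt_min ltr01 andbT; lra.
have m2 : 0 < m ^+ 2 by rewrite exprn_gt0.
have ep0 : 0 < ka / 32 / m ^+ 2 by rewrite !divr_gt0.
have [d1 d10 d1P] := taylor2 oU rC UQ ep0.
(* The displacement is at most [3 * m * r], hence below [d] and [d1]; the last entry bounds the
   Hessian terms containing [Z] by [ka / 2 * (s ^+ 2 + t)]. *)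
pose r := Num.min (Num.min 1 (Num.min d d1 / (4 * m))) (ka / (8 * (M + 1) * m ^+ 2)).
have r0 : 0 < r.
  rewrite !lt_min ltr01 /= !divr_gt0 ?mulr_gt0 ?lt_min ?d0 ?d10 //; lra.
have r1 : r <= 1 by rewrite /r !ge_min lexx.
have rd : 4 * m * r <= Num.min d d1.
  rewrite mulrC -ler_pdivlMr ?mulr_gt0 //; by rewrite /r !ge_min lexx orbT.
have rM : 8 * M * m ^+ 2 * r <= ka.
  have h : r * (8 * (M + 1) * m ^+ 2) <= ka.
    by rewrite -ler_pdivlMr ?mulr_gt0 //; [rewrite /r ge_min lexx orbT|lra].
  apply: le_trans h; rewrite [leRHS]mulrC ler_pM2r // ler_pM2r // ler_pM2l //; lra.
exists w, nu, r; split => // zeta t zr t0 tr.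
set Y := zeta *: v; set Z := zeta ^+ 2 *: w + t%:C%C *: nu.
rewrite -addrA -/Z; pose s := nrm zeta.
have s0 : 0 <= s by exact: nrm_ge0.
have Yn : nrm Y <= m * s.
  by rewrite nrmZ [leRHS]mulrC; exact: (ler_wpM2l s0 vm).
have Zn : nrm Z <= m * (s ^+ 2 + t).
  have e1 : nrm (zeta ^+ 2 *: w) = s ^+ 2 * nrm w by rewrite nrmZ nrmX.
  have e2 : nrm (t%:C%C *: nu) = t * nrm nu by rewrite nrmZ nrm_real (ger0_norm t0).
  apply: le_trans (nrmD _ _) _; rewrite e1 e2 mulrDr.
  apply: lerD; rewrite [leRHS]mulrC; first exact: (ler_wpM2l (sqr_ge0 s) wm).
  exact: (ler_wpM2l t0 num).
have s2 : s ^+ 2 <= r * s by rewrite expr2 ler_wpM2r.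
have sr : s * r <= s by rewrite ler_piMr.
have Xn : nrm (Y + Z) <= m * (2 * s + t).
  apply: le_trans (nrmD _ _) _; apply: le_trans (lerD Yn Zn) _.
  by rewrite -mulrDr ler_pM2l //; lra.
have Xr : m * (2 * s + t) <= 3 * m * r.
  by rewrite mulrAC [leRHS]mulrC ler_pM2l //; rewrite -/s in zr; lra.
have mr : 0 < m * r by rewrite mulr_gt0.
have : nrm (Y + Z) < Num.min d d1 by lra.
rewrite lt_min => /andP[Xd Xd1]; split => // st.
have := d1P _ Xd1; rewrite rQ subr0 -/(G _) -/(H _ _).
have GX : G (Y + Z) = (complex.Re zeta ^+ 2 - complex.Im zeta ^+ 2) * A +
    2 * complex.Re zeta * complex.Im zeta * B + t.
  have GY : G Y = 0 by rewrite /G /Y grad_complex gv giv !mulr0 addr0.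
  have -> : G (Y + Z) = G Y + (G (zeta ^+ 2 *: w) + t * G nu) by rewrite /G !gradD gradZ.
  rewrite GY add0r Gnu mulr1 {1}/G grad_complex -/(G w) -/(G ('i%C *: w)) Gw Giw.
  congr (_ * _ + _ * _ + _); case: (zeta) => x y; rewrite expr2; simpc; rewrite /=; ring.
have HX : H (Y + Z) (Y + Z) = complex.Re zeta ^+ 2 * a +
    complex.Re zeta * complex.Im zeta * (c + e) +
    complex.Im zeta ^+ 2 * b + (H Y Z + H Z Y + H Z Z).
  have -> : H (Y + Z) (Y + Z) = H Y Y + H Y Z + (H Z Y + H Z Z).
    exact: hess_add.
  rewrite (_ : H Y Y = complex.Re zeta ^+ 2 * a +
    complex.Re zeta * complex.Im zeta * (c + e) + complex.Im zeta ^+ 2 * b).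
    by rewrite !addrA.
  exact: hess_complex.
have s2E : s ^+ 2 = complex.Re zeta ^+ 2 + complex.Im zeta ^+ 2 by exact: nrm_sqr.
have q0 : 0 <= s ^+ 2 + t by rewrite addr_ge0 // sqr_ge0.
have HYZ : `|H Y Z + H Z Y + H Z Z| <= ka / 2 * (s ^+ 2 + t).
  have h1 : nrm Y <= m * r by apply: le_trans Yn _; rewrite ler_pM2l.
  have h2 : nrm Z <= m * (2 * r).
    by apply: le_trans Zn _; rewrite ler_pM2l //; rewrite -/s in zr; lra.
  have h3 := MP Y Z; have h4 := MP Z Y; have h5 := MP Z Z.
  have h6 : `|H Y Z + H Z Y + H Z Z| <= M * nrm Z * (2 * nrm Y + nrm Z).
    have t1 := ler_normD (H Y Z + H Z Y) (H Z Z); have t2 := ler_normD (H Y Z) (H Z Y).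
    have -> : M * nrm Z * (2 * nrm Y + nrm Z) =
      M * nrm Y * nrm Z + M * nrm Z * nrm Y + M * nrm Z * nrm Z by ring.
    move: h3 h4 h5 t1 t2; rewrite -!/(H _ _); lra.
  apply: le_trans h6 _.
  apply: (@le_trans _ _ (M * (m * (s ^+ 2 + t)) * (4 * (m * r)))).
    apply: ler_pM; [| |by rewrite ler_wpM2l|lra].
    - by rewrite mulr_ge0 // nrm_ge0.
    - by rewrite addr_ge0 ?mulr_ge0 ?nrm_ge0.
  have -> : M * (m * (s ^+ 2 + t)) * (4 * (m * r)) = (8 * M * m ^+ 2 * r) / 2 * (s ^+ 2 + t).
    by field.
  by rewrite ler_wpM2r // ler_pM2r.
have eX : ka / 32 / m ^+ 2 * nrm (Y + Z) ^+ 2 <= ka / 4 * (s ^+ 2 + t).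
  have h1 : nrm (Y + Z) ^+ 2 <= (m * (2 * s + t)) ^+ 2.
    rewrite ler_pXn2r ?nnegrE ?nrm_ge0 // mulr_ge0 ?(ltW m0) //.
    by rewrite addr_ge0 // mulr_ge0.
  apply: (@le_trans _ _ (ka / 32 / m ^+ 2 * (m * (2 * s + t)) ^+ 2)).
    by rewrite ler_pM2l.
  have -> : ka / 32 / m ^+ 2 * (m * (2 * s + t)) ^+ 2 = ka / 32 * (2 * s + t) ^+ 2.
    by rewrite exprMn mulrA divfK // gt_eqF.
  have h2 : (2 * s + t) ^+ 2 <= 8 * (s ^+ 2 + t).
    have tt : t ^+ 2 <= t by rewrite expr2 ler_piMr //; lra.
    by have := sqr_ge0 (2 * s - t); nra.
  have -> : ka / 4 * (s ^+ 2 + t) = ka / 32 * (8 * (s ^+ 2 + t)) by field.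
  by rewrite ler_pM2l // divr_gt0.
have q1 : 0 < s ^+ 2 + t.
  have [s00|s00] := eqVneq s 0; first by rewrite s00 expr0n /= add0r; rewrite -/s in st; lra.
  by rewrite ltr_wpDr // exprn_gt0 // lt_neqAle eq_sym s00.
have kat : ka * (s ^+ 2 + t) <= (a + b) / 4 * s ^+ 2 + t.
  have k1 : ka <= (a + b) / 4 by rewrite ge_min lexx.
  have k2 : ka <= 1 by rewrite ge_min lexx orbT.
  by have k3 := ler_wpM2r (sqr_ge0 s) k1; have k4 := ler_wpM2r t0 k2; rewrite mulrDr; lra.
have key : (complex.Re zeta ^+ 2 - complex.Im zeta ^+ 2) * A +
    2 * complex.Re zeta * complex.Im zeta * B + t + (complex.Re zeta ^+ 2 * a +
    complex.Re zeta * complex.Im zeta * (c + e) + complex.Im zeta ^+ 2 * b) / 2 =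
    (a + b) / 4 * s ^+ 2 + t by rewrite s2E /A /B; field.
have kq : 0 < ka * (s ^+ 2 + t) by rewrite mulr_gt0.
move: HYZ; rewrite GX HX !ler_norml => /andP[h1 h2] /andP[h3 h4].
move: key kat eX kq h1 h2 h3 h4.
set T1 := _ + _ + t; set T2 := _ + _ * b; set T3 := H Y Z + _ + _.
set T4 := nrm _ ^+ 2; set T5 := s ^+ 2 + t; set T6 := rho _.
by lra.
Qed.

End LeviDiscs.

(** * Comparison of the invariants *)

Section Fridman.
Context {R : realType} {n : nat}.
Local Notation C := R[i].
Local Notation V := 'rV[C]_n.
Implicit Types (N : V -> R) (U : set V).

Lemma shift_base (x p p' q : V) : x - (p' + q) + (p' - p) = x - (p + q).
Proof. by apply/rowP => i; rewrite !mxE; ring. Qed.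

Lemma shift_disc (y c p q : V) : y + c - (p + c + q) = y - (p + q).
Proof. by apply/rowP => i; rewrite !mxE; ring. Qed.

Lemma shift_circle (y c p q : V) : y + c - (p + c) = y - (p + q) + q.
Proof. by apply/rowP => i; rewrite !mxE; ring. Qed.

(* The discs of [levi_discs] lie in the image of [f] together with small translates,
   and their boundary circles stay at positive distance from the image of the sphere.
   The maximum principle applied to [(L \o g) ^+ M * Phi] keeps their centres inside
   the compact set [f @` [set x | N x <= s]], which therefore contains [Q]. *)
Theorem levi_point_filled N (f : V -> V) U (O : set V) rho Q v : gauge_norm N ->
  (forall y, N y < 1 -> differentiable f y) -> set_inj [set y | N y < 1] f ->
  open U -> Ck_on 2 U rho -> U Q -> rho Q = 0 ->
  (exists (b : bool) j, rpartial b j rho Q != 0) -> complex_tangent rho Q v ->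
  0 < levi_form rho Q v -> open O -> O Q ->
  (forall y, O y -> 0 < rho y -> (f @` [set y | N y < 1]) y) ->
  (f @` [set y | N y < 1]) Q.
Proof.
move=> gN df fi oU rC UQ rQ rg tv lv oO OQ fO.
pose B := [set y | N y < 1]; have oB : open B by exact: open_gauge.
have [g [Phi [gf cg cP dgP dens]]] := @inj_inverse R n B f oB df fi.
have ofB : open (f @` B) by exact: inj_open_image.
have gB y : (f @` B) y -> N (g y) < 1 by move=> [x Bx <-]; rewrite gf.
have Nge := gauge_ge0 gN.
have [d d0 dO] := open_ball oO OQ.
have half (x y z e u : R) : x <= y + z -> y < e -> e < u / 2 -> z < u / 2 -> x < u by lra.
have half' (x y z u p e : R) : x <= y + z -> y < u -> z <= u * p -> u * p + u <= e / 2 ->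
    0 < e -> x < e by lra.
have [w [nu [r [r0 disc]]]] := levi_discs oU rC UQ rQ rg tv lv d0.
pose c (t : C) : V := t *: v + t ^+ 2 *: w.
have dc (p : V) t : differentiable (fun t => p + c t) t.
  apply: diffD; first exact: diffC.
  apply: diffD; first exact: (@differentiableZl C C V (fun t : C => t) v t (diffI t)).
  exact: (@differentiableZl C C V (fun t : C => t ^+ 2) w t (diffX 2 (diffI t))).
have inW (zeta : C) (t : R) : nrm zeta <= r -> 0 <= t -> t <= r -> 0 < nrm zeta + t ->
    (f @` B) (Q + c zeta + t%:C%C *: nu).
  move=> h1 h2 h3 h4; have [k1 k2] := disc zeta t h1 h2 h3.
  rewrite -addrA; apply: fO; last exact: k2.
  by apply: dO; rewrite addrAC subrr add0r.
have circ (zeta : C) : nrm zeta = r -> (f @` B) (Q + c zeta).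
  move=> zr; have -> : Q + c zeta = Q + c zeta + 0%:C%C *: nu by rewrite scale0r addr0.
  by apply: inW; rewrite ?zr ?addr0 // ltW.
have cNg y : (f @` B) y -> cont_at (fun x => (N (g x))%:C%C) y.
  move=> /cg h; apply: (@cont_at_comp R V V C g (fun x => (N x)%:C%C) y h).
  exact: gauge_cont.
have circ0 : [set t : C | nrm t = r] !=set0.
  by exists r%:C%C; rewrite /= nrm_real gtr0_norm.
have ccirc : compact [set t : C | nrm t = r] by exact: compact_circle.
have [|z1 z1r z1P] := @compact_argmax_cont R C [set t : C | nrm t = r]
    (fun t => N (g (Q + c t))) circ0 ccirc.
  move=> t tr; apply: (@cont_at_comp R C V C (fun t => Q + c t) (fun y => (N (g y))%:C%C) t).
    by apply: diff_cont_at; exact: dc.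
  exact/cNg/circ.
have [|z2 z2r z2P] := @compact_argmax_cont R C [set t : C | nrm t = r]
    (fun t => nrm (Phi (Q + c t))) circ0 ccirc.
  move=> t tr; apply: cont_at_nrm.
  apply: (@cont_at_comp R C V C (fun t => Q + c t) Phi t).
    by apply: diff_cont_at; exact: dc.
  exact/cP/circ.
(* [s0] is the largest gauge on the preimage of the boundary circle; [s] leaves room for translated
   circles. *)
pose s0 := N (g (Q + c z1)); pose s := (1 + s0) / 2.
have s01 : s0 < 1 by exact/gB/circ.
have s00 : 0 <= s0 by exact: Nge.
have s1 : s < 1 by rewrite /s; lra.
have sp : 0 < s by rewrite /s; lra.
pose P0 := nrm (Phi (Q + c z2)) + 1.
have [de de0 deP] : exists2 de : R, 0 < de & forall t, nrm t = r ->
    forall x, nrm (x - (Q + c t)) < de -> N (g x) <= s /\ nrm (Phi x) <= P0.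
  apply: (@compact_uniform R C [set t : C | nrm t = r] (fun t de =>
    forall x, nrm (x - (Q + c t)) < de -> N (g x) <= s /\ nrm (Phi x) <= P0) ccirc).
  move=> t tr; have e0 : 0 < s - s0 by rewrite /s; lra.
  have [d1 d10 d1P] := cNg _ (circ t tr) _ e0.
  have [d2 d20 d2P] := cP _ (circ t tr) _ ltr01.
  have dm : 0 < Num.min d1 d2 / 2 by rewrite divr_gt0 // lt_min d10.
  have [d3 d30 d3P] := diff_cont_at (dc Q t) dm.
  exists (Num.min d3 (Num.min d1 d2 / 2)); first by rewrite lt_min d30.
  move=> t' de'; rewrite lt_min => /andP[/d3P t't _] /andP[_ de's] x xt'.
  have xt : nrm (x - (Q + c t)) < Num.min d1 d2.
    have := nrmD (x - (Q + c t')) (Q + c t' - (Q + c t)); rewrite addrA subrK.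
    move: de's; rewrite lt_min => /andP[_ de's] h.
    exact: half h xt' de's t't.
  move: xt; rewrite lt_min => /andP[/d1P h1 /d2P h2].
  move: h1; rewrite -rmorphB nrm_real ltr_norml => /andP[_ h1].
  have h3 := z1P t tr; have h4 := z2P t tr.
  split; first by have := lerD (ltW h1) h3; rewrite !subrK.
  have := lerD (le_trans (nrmB_ge (Phi x) (Phi (Q + c t))) (ltW h2)) h4.
  by rewrite subrK [1 + _]addrC.
have nu0 := nrm_ge0 nu.
have near e : 0 < e -> exists2 y, (f @` [set x | N x <= s]) y & nrm (y - Q) < e.
  move=> e0; pose m := nrm nu + 1; have m0 : 0 < m by rewrite /m; lra.
  pose t := Num.min r (Num.min (de / 2) (e / 2) / m).
  have t0 : 0 < t by rewrite !lt_min r0 /= divr_gt0 // lt_min !divr_gt0.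
  have tr : t <= r by rewrite ge_min lexx.
  have tm : t * m <= Num.min (de / 2) (e / 2).
    by rewrite -ler_pdivlMr // ge_min lexx orbT.
  have tnu : nrm (t%:C%C *: nu) <= t * nrm nu by rewrite nrmZ nrm_real (ger0_norm (ltW t0)).
  move: tm; rewrite le_min /m mulrDr mulr1 => /andP[tde te].
  have [et et0 etP] : exists2 et : R, 0 < et & forall a, nrm a <= r ->
      forall x, nrm (x - (Q + c a + t%:C%C *: nu)) < et -> (f @` B) x.
    apply: (@compact_uniform R C [set a : C | nrm a <= r] (fun a et =>
      forall x, nrm (x - (Q + c a + t%:C%C *: nu)) < et -> (f @` B) x) (@compact_disk R r)).
    move=> a ar; have Wa : (f @` B) (Q + c a + t%:C%C *: nu).
      by apply: inW => //; [exact: ltW|rewrite ltr_wpDl ?nrm_ge0].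
    have [d1 d10 d1P] := open_ball ofB Wa.
    have d12 : 0 < d1 / 2 by rewrite divr_gt0.
    have [d3 d30 d3P] := diff_cont_at (dc Q a) d12.
    exists (Num.min d3 (d1 / 2)); first by rewrite lt_min d30.
    move=> a' et'; rewrite lt_min => /andP[/d3P a'a _] /andP[_ et's] x xa'.
    apply: d1P; move: et's; rewrite lt_min => /andP[_ et's].
    have := nrmD (x - (Q + c a' + t%:C%C *: nu)) (Q + c a' - (Q + c a)).
    rewrite (shift_base x (Q + c a) (Q + c a') (t%:C%C *: nu)) => h.
    exact: half h xa' et's a'a.
  pose eta := Num.min et t; have eta0 : 0 < eta by rewrite lt_min et0.
  have c0 : c 0 = 0 by rewrite /c expr2 mul0r !scale0r addr0.
  have y0W : (f @` B) (Q + t%:C%C *: nu).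
    have -> : Q + t%:C%C *: nu = Q + c 0 + t%:C%C *: nu by rewrite c0 addr0.
    by apply: inW; rewrite ?nrm0 ?add0r // ltW.
  (* The centre is perturbed to a point where [Phi] does not vanish, so that the fixed factor
     [Phi y] can be divided out in the limit of powers. *)
  have [y yW [yy Phiy]] := dens _ y0W _ eta0.
  move: yy; rewrite lt_min => /andP[yet yt].
  have hW a : nrm a <= r -> (f @` B) (y + c a).
    move=> ar; apply: (etP a ar).
    suff -> : y + c a - (Q + c a + t%:C%C *: nu) = y - (Q + t%:C%C *: nu) by [].
    exact: shift_disc.
  have hb a : nrm a = r -> N (g (y + c a)) <= s /\ nrm (Phi (y + c a)) <= P0.
    move=> ar; apply: (deP a ar).
    rewrite (shift_circle y (c a) Q (t%:C%C *: nu)).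
    exact: half' (nrmD _ _) yt tnu tde de0.
  (* The maximum principle on the translated disc gives [nrm (Phi y) * N (g y) ^+ M <= P0 * s ^+ M]
     for all [M]. The factor [Phi] confines the points where [g] must be holomorphic to those where
     [Phi] does not vanish. *)
  have Ny : N (g y) <= s.
    rewrite leNgt; apply/negP => sN; have Np : 0 < N (g y) by exact: lt_trans sN.
    have [L LN Ly] := hahn_banach (g y) gN.
    have dL x : differentiable L x by exact: gauge_lin gN LN.
    suff : nrm (Phi y) <= 0 by rewrite leNgt nrm_gt0 Phiy.
    apply: (@geometric_le0 R (nrm (Phi y)) (s / N (g y)) P0).
    - by rewrite divr_ge0 // ltW.
    - by rewrite ltr_pdivrMr // mul1r.
    move=> M; have NM : 0 < N (g y) ^+ M by rewrite exprn_gt0.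
    rewrite exprMn exprVn mulrA ler_pdivlMr //.
    pose psi a := L (g (y + c a)) ^+ M * Phi (y + c a).
    have ch a : cont_at (fun a => y + c a) a by apply: diff_cont_at; exact: dc.
    have <- : nrm (psi 0) = nrm (Phi y) * N (g y) ^+ M.
      by rewrite /psi c0 addr0 Ly nrmM nrmX nrm_real (ger0_norm (Nge _)) mulrC.
    apply: (@max_disk R psi r (P0 * s ^+ M) r0).
    + move=> a ar; apply: cont_atM.
        apply: cont_atX; apply: (@cont_at_comp R C V C (fun a => g (y + c a)) L a).
          by apply: (@cont_at_comp R C V V (fun a => y + c a) g a (ch a)); exact/cg/hW.
        by apply: diff_cont_at.
      by apply: (@cont_at_comp R C V C (fun a => y + c a) Phi a (ch a)); exact/cP/hW.
    + move=> a /ltW ar pa; have Pa : Phi (y + c a) != 0.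
        by apply: contraNneq pa => h; rewrite /psi h mulr0.
      have [dg dPhi] := dgP _ (hW a ar) Pa.
      have dPa := @diff_compf R C V C (fun a => y + c a) Phi a (dc y a) dPhi.
      have dga := @diff_compf R C V V (fun a => y + c a) g a (dc y a) dg.
      have dLa := @diff_compf R C V C (fun a => g (y + c a)) L a dga (dL _).
      exact: (@diffM R C (fun a => L (g (y + c a)) ^+ M) (fun a => Phi (y + c a)) a
        (diffX M dLa) dPa).
    + move=> a /hb [h1 h2]; rewrite nrmM nrmX mulrC; apply: ler_pM => //.
      * exact: nrm_ge0.
      * by rewrite exprn_ge0 // nrm_ge0.
      * by apply: lerXn2r; rewrite ?nnegrE ?nrm_ge0 ?(ltW sp) //; exact: le_trans (LN _) h1.
    + by rewrite nrm0 ltW.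
  exists y.
    by have [x Bx fx] := yW; exists x => //=; move: Ny; rewrite -fx gf.
  have -> : y - Q = (y - (Q + t%:C%C *: nu)) + t%:C%C *: nu.
    by rewrite opprD addrA subrK.
  exact: half' (nrmD _ _) yt tnu te e0.
have cK : compact (f @` [set x | N x <= s]).
  apply: continuous_compact; last exact: compact_gauge.
  by apply: within_cont_at => x /= xs; apply/diff_cont_at/df; exact: le_lt_trans xs s1.
have [[x xs fx]|nQ] := pselect ((f @` [set x | N x <= s]) Q).
  by exists x => //; exact: le_lt_trans xs s1.
have oc : open (~` (f @` [set x | N x <= s])).
  by apply: closed_openC; apply: compact_closed => //; exact: norm_hausdorff.
have [e e0 eP] := open_ball oc nQ.
by have [y Ky yQ] := near e e0; exfalso; apply: (eP y yQ).
Qed.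

End Fridman.

Section Final.
Context {R : realType} {n : nat}.
Local Notation C := R[i].
Local Notation V := 'rV[C]_n.
Implicit Types (N : V -> R) (K G : set V) (phi : V -> V).

Lemma gauge_gt0 N (z : V) : gauge_norm N -> z != 0 -> 0 < N z.
Proof.
move=> gN z0; rewrite lt_neqAle (gauge_ge0 gN) andbT eq_sym.
by apply: contra z0 => /eqP h; apply/eqP; exact: gauge_eq0 h.
Qed.

(** Shrinking [phi w0] towards 0 lowers the gauge below the minimum, so [psi] of the shrunk points
    leaves [closure G]; these points tend to [w0], which therefore is not interior to [G]. *)
Lemma nearest_point N G phi : gauge_norm N -> automorphism [set z | N z < 1] phi ->
  open G -> G !=set0 -> compact (closure G) -> closure G `<=` [set z | N z < 1] ->
  (forall w, closure G w -> phi w != 0) ->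
  exists2 w0, boundary G w0 & (forall w, closure G w -> N (phi w0) <= N (phi w)) /\
    forall e : R, 0 < e -> exists2 w, ([set z | N z < 1] `\` closure G) w & nrm (w - w0) < e.
Proof.
move=> gN [[dphi Bphi] [psi [[dpsi Bpsi] psiK phiK]]] oG [p Gp] cK KB phi0.
have Nge := gauge_ge0 gN.
have K0 : closure G !=set0 by exists p; exact: subset_closure.
have [|w0 Kw0 w0P] := @compact_argmin R V (closure G) (fun w => N (phi w)) K0 cK.
  move=> x /KB Bx e e0.
  have [d d0 dP] := @cont_at_comp R V V C phi (fun y => (N y)%:C%C) x
    (diff_cont_at (dphi x Bx)) (gauge_cont (phi x) gN) e e0.
  by exists d => // y _ /dP; rewrite -rmorphB nrm_real.
have Bw0 := KB w0 Kw0; have Bpw0 := Bphi w0 Bw0.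
have d0 : 0 < N (phi w0) by exact: gauge_gt0 gN (phi0 w0 Kw0).
have near e : 0 < e -> exists2 w, ([set z | N z < 1] `\` closure G) w & nrm (w - w0) < e.
  move=> e0; have Bt : [set z | N z < 1] (phi w0) by [].
  have [e1 e10 e1P] := diff_cont_at (dpsi _ Bt) e0.
  pose m := nrm (phi w0) + 1; have m0 : 0 < m by rewrite /m ltr_wpDl ?nrm_ge0.
  pose s := Num.min 1 (e1 / (2 * m)).
  have s0 : 0 < s by rewrite lt_min ltr01 divr_gt0 // mulr_gt0.
  have s1 : s <= 1 by rewrite ge_min lexx.
  have sm : s * (2 * m) <= e1 by rewrite -ler_pdivlMr ?mulr_gt0 // ge_min lexx orbT.
  pose y := (1 - s)%:C%C *: phi w0.
  have s1' : 0 <= 1 - s by rewrite subr_ge0.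
  have Ny : N y < N (phi w0).
    by rewrite gauge_real // gtr_pMl // gtrBl.
  have By : N y < 1 by exact: lt_trans Ny Bpw0.
  exists (psi y).
    split; first exact: Bpsi.
    by move=> /w0P; rewrite phiK // leNgt Ny.
  rewrite -[X in _ - X](psiK w0 Bw0); apply: e1P.
  have -> : y - phi w0 = (- s)%:C%C *: phi w0.
    by rewrite /y -{2}(scale1r (phi w0)) -scalerBl rmorphB rmorphN /= addrAC subrr add0r.
  rewrite nrmZ nrm_real normrN (gtr0_norm s0).
  have h : s * nrm (phi w0) <= s * m by rewrite ler_pM2l // /m lerDl.
  have h2 : s * (2 * m) = 2 * (s * m) by ring.
  have h3 : 0 < s * m by rewrite mulr_gt0.
  lra.
exists w0; last by [].
split=> // /interior_subset Gw0; have [e e0 eP] := open_ball oG Gw0.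
have [w [_ nKw] wP] := near e e0; apply: nKw; apply: subset_closure; exact: eP.
Qed.

Lemma squeezing_le N K phi z w0 (f : V -> V) (r : R) : (2 <= n)%N -> gauge_norm N ->
  homogeneous [set z | N z < 1] -> connected [set z | N z < 1] ->
  compact K -> K `<=` [set z | N z < 1] -> connected ([set z | N z < 1] `\` K) ->
  automorphism [set z | N z < 1] phi -> phi z = 0 -> ([set z | N z < 1] `\` K) z ->
  K w0 -> (forall e : R, 0 < e ->
    exists2 w, ([set z | N z < 1] `\` K) w & nrm (w - w0) < e) ->
  inj_holo_map ([set z | N z < 1] `\` K) [set z | N z < 1] f -> f z = 0 ->
  [set w | N w < r] `<=` f @` ([set z | N z < 1] `\` K) -> r <= N (phi w0).
Proof.
move=> n2 gN hB cB cK KB cD [[dphi Bphi] [psi [[dpsi Bpsi] psiK phiK]]] phiz Dz Kw0 near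
  [hf fi] fz rf.
rewrite leNgt; apply/negP => dr; have [df Bf] := hf.
have D0 : ([set z | N z < 1] `\` K) !=set0 by exists z.
have [F [dF BF] Ff] := @hartogs_map R n N K f n2 gN hB cB cK KB cD D0 hf.
have Bw0 := KB w0 Kw0.
have NF : N (F w0) <= N (phi w0).
  have [L LN Lw] := hahn_banach (F w0) gN.
  have := @schwarz_gauge R n N (fun y => L (F (psi y))) gN _ _ _ (phi w0) (Bphi w0 Bw0).
  rewrite psiK // Lw nrm_real ger0_norm ?gauge_ge0 //; apply.
  - move=> y By; have By' := Bpsi y By.
    have dFp := @diff_compf R V V V psi F y (dpsi y By) (dF _ By').
    exact: (@diff_compf R V V C (fun y => F (psi y)) L y dFp (gauge_lin _ gN LN)).
  - by move=> y /Bpsi /BF By; apply: le_trans (LN _) _; exact: ltW.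
  - have [Bz _] := Dz; by rewrite -phiz psiK // Ff // fz linear0.
have [p Dp fp] := rf _ (le_lt_trans NF dr).
have oD : open ([set z | N z < 1] `\` K).
  apply: openI; first exact: open_gauge.
  by apply: closed_openC; apply: compact_closed => //; exact: norm_hausdorff.
have pw0 : 0 < nrm (p - w0).
  by rewrite nrm_gt0 subr_eq0; apply: contraPneq Dp => -> [].
have [d1 d10 d1P] := open_ball oD Dp.
(* Below, [x] is within [d] of [p], [w] is within [d] of [w0] and [f x = f w]. Injectivity gives
   [x = w], although [p] and [w0] are at least [2 d] apart. *)
pose d := Num.min d1 (nrm (p - w0)) / 2.
have d0 : 0 < d by rewrite divr_gt0 // lt_min d10.
have dd1 : d <= d1 / 2 by rewrite ler_pM2r // ge_min lexx.
have dpw : d <= nrm (p - w0) / 2 by rewrite ler_pM2r // ge_min lexx orbT.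
have [|r1 r10 r1P] := @inj_open_at R n ([set z | N z < 1] `\` K) f p d oD df fi d0.
  by move=> x xd; apply: d1P; lra.
have [d2 d20 d2P] := diff_cont_at (dF w0 Bw0) r10.
have m0 : 0 < Num.min d d2 by rewrite lt_min d0.
have [w Dw] := near _ m0; rewrite lt_min => /andP[wd /d2P Fw].
rewrite -fp Ff // in Fw; have [x xp fx] := r1P _ Fw.
have Dx : ([set z | N z < 1] `\` K) x by apply: d1P; lra.
have xw : x = w by apply: fi => //; rewrite inE.
have := nrmD (p - w) (w - w0); rewrite addrA subrK nrm_distC -{1}xw.
rewrite nrm_distC [nrm (p - x)]nrm_distC; lra.
Qed.

Lemma squeezing_mem N K phi z w0 : gauge_norm N ->
  K `<=` [set z | N z < 1] -> automorphism [set z | N z < 1] phi -> phi z = 0 ->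
  K w0 -> (forall w, K w -> N (phi w0) <= N (phi w)) ->
  exists f : V -> V, [/\ inj_holo_map ([set z | N z < 1] `\` K) [set z | N z < 1] f,
    f z = 0 & [set w | N w < N (phi w0)] `<=` f @` ([set z | N z < 1] `\` K)].
Proof.
move=> gN KB [[dphi Bphi] [psi [[dpsi Bpsi] psiK phiK]]] phiz Kw0 w0P.
have Bpw := Bphi _ (KB _ Kw0); exists phi; split=> //.
  split; first by split=> y [By _]; [exact: dphi|exact: Bphi].
  by move=> x y /[!inE] -[Bx _] [By _] /(congr1 psi); rewrite !psiK.
move=> y /= yd; have By : N y < 1 by exact: lt_trans yd Bpw.
exists (psi y); last exact: phiK.
by split; [exact: Bpsi|move=> /w0P; rewrite phiK // leNgt yd].
Qed.

Lemma fridman_mem N K phi w0 : gauge_norm N ->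
  K `<=` [set z | N z < 1] -> automorphism [set z | N z < 1] phi ->
  K w0 -> 0 < N (phi w0) -> (forall w, K w -> N (phi w0) <= N (phi w)) ->
  exists2 f : V -> V, inj_holo_map [set z | N z < 1] ([set z | N z < 1] `\` K) f &
    forall w, ([set z | N z < 1] `\` K) w -> N (phi w) < N (phi w0) ->
      (f @` [set z | N z < 1]) w.
Proof.
move=> gN KB [[dphi Bphi] [psi [[dpsi Bpsi] psiK phiK]]] Kw0 d0 w0P.
set d := N (phi w0) in d0 w0P *; have d1 : d < 1 by exact/Bphi/KB.
have Nd y : N (d%:C%C *: y) = d * N y by rewrite gauge_real // ltW.
have Bd y : N y < 1 -> N (d%:C%C *: y) < d by move=> By; rewrite Nd gtr_pMr.
have Bd1 y : N y < 1 -> [set z | N z < 1] (d%:C%C *: y).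
  by move=> /Bd h; exact: lt_trans h d1.
have dC : d%:C%C != 0 :> C by rewrite -nrm_gt0 nrm_real gtr0_norm.
exists (fun y => psi (d%:C%C *: y)); last first.
  move=> w [Bw _] wd; exists (d%:C%C^-1 *: phi w).
    rewrite /= gaugeZ // nrmV nrm_real gtr0_norm //.
    by rewrite mulrC ltr_pdivrMr // mul1r.
  by rewrite scalerA divff // scale1r psiK.
split; last first.
  move=> x y /[!inE] Bx By /(congr1 phi); rewrite !phiK; [|exact: Bd1..].
  exact: (scalerI dC).
split=> y By.
  have [dZ _] := @is_diff_scaler C V d%:C%C y.
  exact: (@diff_compf R V V V ( *:%R d%:C%C) psi y dZ (dpsi _ (Bd1 y By))).
split; first exact/Bpsi/Bd1.
by move=> /w0P; rewrite phiK; [rewrite leNgt Bd|exact: Bd1].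
Qed.

Lemma defining_not_closure G U (rho : V -> R) y : open U -> Ck_on 2 U rho ->
  (forall z, U z -> (G z <-> rho z < 0)) -> U y -> 0 < rho y -> ~ closure G y.
Proof.
move=> oU [cr _] Gr Uy ry Ky.
have /(@cvgrPdist_le _ _ _ _ _) /(_ (rho y / 2)) h := cr y Uy.
have nb : nbhs y (U `&` [set x | `|rho y - rho x| <= rho y / 2]).
  by apply: filterI; [exact: open_nbhs_nbhs|apply: h; rewrite divr_gt0].
have [x [Gx [Ux /= hx]]] := Ky _ nb.
have h1 : rho x < 0 by exact/(Gr x Ux).
by move: hx; rewrite ler_norml => /andP[_]; lra.
Qed.

(** A negative value would make [Q] interior to [G], a positive one would separate [Q] from [G]. *)
Lemma defining_zero G Q U (rho : V -> R) : boundary G Q ->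
  local_defining_function G Q U rho -> rho Q = 0.
Proof.
move=> [KQ nGQ] [oU UQ rC _ Gr].
have [rn|rp|//] := ltgtP (rho Q) 0; exfalso.
  apply: nGQ; have [cr _] := rC.
  have /(@cvgrPdist_le _ _ _ _ _) /(_ (- rho Q / 2)) h := cr Q UQ.
  have nb : nbhs Q (U `&` [set x | `|rho Q - rho x| <= - rho Q / 2]).
    by apply: filterI; [exact: open_nbhs_nbhs|apply: h; rewrite divr_gt0 // oppr_gt0].
  apply: filterS nb => x [Ux /= hx]; apply/Gr => //.
  by move: hx; rewrite ler_norml => /andP[]; lra.
exact: defining_not_closure oU rC Gr UQ rp KQ.
Qed.

Lemma fridman_le N G phi w0 (f : V -> V) (r : R) : gauge_norm N ->
  compact (closure G) -> closure G `<=` [set z | N z < 1] ->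
  boundary G `<=` closure (pseudoconvex_not_Levi_flat G) ->
  automorphism [set z | N z < 1] phi -> boundary G w0 ->
  inj_holo_map [set z | N z < 1] ([set z | N z < 1] `\` closure G) f ->
  (forall w, ([set z | N z < 1] `\` closure G) w -> N (phi w) < r ->
    (f @` [set z | N z < 1]) w) -> r <= N (phi w0).
Proof.
move=> gN cK KB dense [[dphi Bphi] _] bw0 [[df Df] fi] rf.
rewrite leNgt; apply/negP => dr; have [Kw0 _] := bw0.
(* An open neighbourhood of [w0] whose points off [closure G] are all values of [f]; density puts a
   Levi point [Q] into it. *)
pose U' := [set y | N y < 1 /\ N (phi y) < r].
have oU' : open U'.
  apply/open_nrmP => y [By yr].
  have [d1 d10 d1P] := open_ball (@open_gauge R n N 1 gN) By.
  have e0 : 0 < r - N (phi y) by rewrite subr_gt0.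
  have [d2 d20 d2P] := @cont_at_comp R V V C phi (fun y => (N y)%:C%C) y
    (diff_cont_at (dphi y By)) (gauge_cont (phi y) gN) _ e0.
  exists (Num.min d1 d2); first by rewrite lt_min d10.
  move=> x; rewrite lt_min => /andP[/d1P Bx /d2P]; rewrite -rmorphB nrm_real ltr_norml.
  by move=> /andP[_]; rewrite ltrD2r.
have U'w0 : U' w0 by split=> //; exact: KB.
have [Q [[bQ [U [rho [ldf _ [v tv lv]]]]] U'Q]] := dense w0 bw0 U' (open_nbhs_nbhs (conj oU' U'w0)).
have [oU UQ rC rg Gr] := ldf.
have rQ := defining_zero bQ ldf.
have : (f @` [set y | N y < 1]) Q.
  apply: (@levi_point_filled R n N f U (U' `&` U) rho Q v gN df fi oU rC UQ rQ (rg Q UQ) tv lv).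
  - exact: openI.
  - by [].
  - move=> y [[By yr] Uy] ry; apply: rf => //; split => //.
    exact: defining_not_closure oU rC Gr Uy ry.
by move=> [x /Df [_ nK] fx]; apply: nK; rewrite fx; case: bQ.
Qed.

End Final.

Unset Implicit Arguments.

Theorem theorem2p6 (R : realType) (n : nat) (hn : (2 <= n)%N)
    (Om G : set 'rV[R[i]]_n)
    (Om_domain : is_domain Om) (Om_bounded : bounded_set Om)
    (Om_balanced : balanced Om) (Om_convex : convex_set Om)
    (Om_homogeneous : homogeneous Om)
    (G_domain : is_domain G) (G_sub : G `<=` Om)
    (G_compact : compact (closure G)) (G_relcompact : closure G `<=` Om)
    (G_dense : boundary G `<=` closure (pseudoconvex_not_Levi_flat G))
    (D_connected : connected (Om `\` closure G))
    (z : 'rV[R[i]]_n) (z_in : (Om `\` closure G) z) :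
  squeezing Om (Om `\` closure G) z = fridman Om (Om `\` closure G) z /\
  is_carath_dist Om (boundary G) z (fridman Om (Om `\` closure G) z).
Proof.
have gN := minkowski_gauge Om_domain Om_bounded Om_balanced Om_convex.
have OmE : Om = [set y | minkowski_fun Om y < 1].
  apply/seteqP; split=> y; have h := minkowski_ltP Om_domain Om_balanced y ltr01.
    by move=> Oy; apply/h; rewrite invr1 scale1r.
  by move=> /h; rewrite invr1 scale1r.
have [_ Om_conn _] := Om_domain; have [oG _ G0] := G_domain.
(* [squeezing] is unfolded so that its Minkowski function is generalised along with the others; from
   here on [Om] is the unit ball of an abstract gauge [N]. *)
rewrite /squeezing; move: (minkowski_fun Om) gN OmE => N gN OmE.
move: Om_homogeneous G_relcompact D_connected z_in Om_conn.
rewrite OmE => {Om Om_domain Om_bounded Om_balanced Om_convex G_sub OmE} hB KB cD Dz cB.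
have [Bz nKz] := Dz.
have B0 : [set y | N y < 1] 0 by rewrite /= (gauge0 gN).
have [phi aphi phiz] := hB z 0 Bz B0.
have phi0 w : closure G w -> phi w != 0.
  have [_ [psi [_ psiK _]]] := aphi.
  move=> Kw; apply/eqP => pw; apply: nKz.
  by rewrite -(psiK z Bz) phiz -pw (psiK w (KB w Kw)).
have [w0 bw0 [w0P near]] := nearest_point gN aphi oG G0 G_compact KB phi0.
have [Kw0 _] := bw0; set d := N (phi w0) in w0P.
have d0 : 0 < d by exact: gauge_gt0 gN (phi0 w0 Kw0).
have d1 : d < 1 by have [[_ Bphi] _] := aphi; exact/Bphi/KB.
have dm1 : -1 < d by lra.
have ext (f : 'rV[R[i]]_n -> R[i]) :
    holo_map ([set y | N y < 1] `\` closure G) unit_disk f ->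
    exists2 F, holo_map [set y | N y < 1] unit_disk F &
      forall y, ([set y | N y < 1] `\` closure G) y -> F y = f y.
  move=> [df Df].
  have [F [dF Ff F1]] := @hartogs_disk R n N (closure G) f hn gN hB cB G_compact KB cD
    (ex_intro _ z Dz) df.
  exists F; last exact: Ff.
  split=> [|y By]; first exact: dF.
  apply/unit_diskP; apply: (F1 _ y By) => x Dx.
  by have /unit_diskP := Df x Dx.
have sub : [set y | N y < 1] `\` closure G `<=` [set y | N y < 1] by move=> y [].
have ballP t w := carath_ball_gauge t gN sub ext aphi Dz phiz w.
(* The supremum is attained, at the radius [artanh d], which is positive because [tanh] is
   increasing and [0 < d]. *)
have -> : fridman [set y | N y < 1] ([set y | N y < 1] `\` closure G) z = d.
  apply: sup_is_max.
    exists (artanh d); last exact: artanhK dm1 d1.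
    split.
      rewrite ltNge; apply/negP => h; move: d0.
      rewrite -(artanhK dm1 d1); move: h; rewrite le_eqVlt => /orP[/eqP ->|/ltr_tanh].
        by rewrite tanh0 ltxx.
      by rewrite tanh0; lra.
    have [f hf fP] := fridman_mem gN KB aphi Kw0 d0 w0P; exists f; first exact: hf.
    move=> w /(ballP (artanh d) w) [Dw]; rewrite (artanhK dm1 d1); exact: fP.
  move=> _ [r [r0 [f hf fP]] <-].
  apply: (fridman_le gN G_compact KB G_dense aphi bw0 hf) => w Dw wr.
  by apply: (fP w); apply/(ballP r w); split; [exact: Dw|exact: wr].
split.
  apply: sup_is_max.
    split; first exact: d0.
    exact: squeezing_mem gN KB aphi phiz Kw0 w0P.
  move=> r [_ [f [hf fz fP]]].
  exact: (squeezing_le hn gN hB cB G_compact KB cD aphi phiz Dz Kw0 near hf fz fP).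
apply: (carath_dist_gauge gN) aphi Bz phiz _ => [w [/KB] //|].
split; first by exists w0.
by move=> _ [w [Kw _] <-]; exact: w0P.
Qed.
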